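(* Let $\phi=(f_0:f_1:f_2):\mathbb{P}^1\to\mathbb{P}^2$ be a generically $1$-to-$1$ parametrization of the rational plane curve $\mathcal{C}$ of degree $d\geq 3$ over $\mathbb{C}$, with defining equation $F=0$, and consider the linear maps $\tilde\phi^j_q:\tilde\Omega^j_q\to\Omega^j(\mathbb{C}^2)_{qd}$, $j=0,1,2$, $q$ a positive integer, induced by pull-back of $j$-forms under $(f_0,f_1,f_2)$, where $$\tilde\Omega^j_q=\Omega^j(\mathbb{C}^3)_q\big/\left(F\,\Omega^j(\mathbb{C}^3)_{q-d}+\mathrm{d}F\wedge\Omega^{j-1}(\mathbb{C}^3)_{q-d}\right).$$ Then the following properties hold. \begin{itemize} \item[i)] $\ker\tilde\phi^0_q=0$ for any $q$. \item[ii)] $\dim\ker\tilde\phi^1_q=\tau(\mathcal{C})$ for any $q\geq 2d-2$. \item[iii)] $\dim\ker\tilde\phi^2_q=2\tau(\mathcal{C})$ for any $q\geq 2d$, and for any $q\geq 2d-2$ when $\mathcal{C}$ is in addition free. \end{itemize}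
   Context: Here $f_0,f_1,f_2\in\mathbb{C}[s,t]$ are homogeneous of the same degree $d$ with $\gcd(f_0,f_1,f_2)=1$, $\mathcal{C}$ is the image of $\phi$, and generically $1$-to-$1$ means that the fiber over a generic point of $\mathcal{C}$ is a single point (so $\deg\mathcal{C}=d$). Let $S=\mathbb{C}[x,y,z]$ and let $F\in S_d$ be a (reduced) defining equation of $\mathcal{C}$. Forms: $\Omega^j(\mathbb{C}^2)$ and $\Omega^j(\mathbb{C}^3)$ are the graded modules of global differential $j$-forms with polynomial coefficients on $\mathbb{C}^2$ (coordinates $s,t$) and $\mathbb{C}^3$ (coordinates $x,y,z$), graded so that the coordinates and their differentials all have degree $1$; a subscript denotes the homogeneous component of that degree (zero for negative degree), and $\Omega^{-1}=0$. The pull-back $\Omega^j(\mathbb{C}^3)_q\to\Omega^j(\mathbb{C}^2)_{qd}$ substitutes $x=f_0,y=f_1,z=f_2$ (and $\mathrm{d}x=\mathrm{d}f_0$, etc.); it vanishes on $F\,\Omega^j(\mathbb{C}^3)_{q-d}+\mathrm{d}F\wedge\Omega^{j-1}(\mathbb{C}^3)_{q-d}$, so it induces $\tilde\phi^j_q$. With $J=(F_x,F_y,F_z)$ the Jacobian ideal, the global Tjurina number is $\tau(\mathcal{C})=\dim_{\mathbb{C}}(S/J)_k$ for $k$ large (equivalently the sum of the Tjurina numbers of the singular points). The curve $\mathcal{C}$ is free if the graded $S$-module $AR(F)=\{(a,b,c)\in S^3: aF_x+bF_y+cF_z=0\}$ is free of rank two. *)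

(* Defs.v *)
From HB Require Import structures.
From mathcomp Require Import all_boot all_order all_algebra.
From mathcomp Require Import reals complex mpoly.

Set Implicit Arguments.
Unset Strict Implicit.
Unset Printing Implicit Defensive.

Import GRing.Theory.

Local Open Scope ring_scope.

(* [free_quot V W n]: the quotient V/W of the submodule V by its submodule W is
   free of rank n, i.e. has a basis made of the classes of n elements of V.
   Over a field this reads dim (V/W) = n. *)
Definition free_quot (A : nzRingType) (M : lmodType A) (V W : M -> Prop)
    (n : nat) : Prop :=
  (forall w, W w -> V w) /\
  exists e : 'I_n -> M, (forall i, V (e i)) /\
    forall v, V v -> exists! c : 'rV[A]_n, W (v - \sum_i c 0 i *: e i).

Section Forms.
Variables (K : fieldType) (n : nat).

Definition homogz (k : int) (p : {mpoly K[n]}) : Prop :=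
  match k with Posz m => p \is m.-homog | Negz _ => p = 0 end.

(* A polynomial differential form on K^n: [a I] is the coefficient of
   dx_{i1} /\ ... /\ dx_{ik}, where I = {i1 < ... < ik}. *)
Definition form := {ffun {set 'I_n} -> {mpoly K[n]}}.

(* The module Omega^j(K^n)_q. As every dx_i has degree 1, the coefficients of a
   j-form of degree q have degree q - j. Both j and q may be negative. *)
Definition Omega (j q : int) (a : form) : Prop :=
  forall I : {set 'I_n},
    if #|I|%:Z == j then homogz (q - j) (a I) else a I = 0.

Definition fscale (p : {mpoly K[n]}) (a : form) : form :=
  [ffun I => p * a I].

Definition form1 : form := [ffun I => (I == set0)%:R].

(* dx_I /\ dx_J = (-1)^(number of inversions between I and J) dx_(I u J) when
   I and J are disjoint, and 0 otherwise. *)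
Definition inversions (I J : {set 'I_n}) : nat :=
  #|[set u : 'I_n * 'I_n | [&& u.1 \in I, u.2 \in J & (u.2 < u.1)%N]]|.

Definition wedge (a b : form) : form :=
  [ffun L : {set 'I_n} =>
     \sum_(I : {set 'I_n} | I \subset L)
        (-1) ^+ inversions I (L :\: I) * (a I * b (L :\: I))].

(* The 1-form dp. *)
Definition mdiff (p : {mpoly K[n]}) : form :=
  [ffun I : {set 'I_n} => \sum_(i | I == [set i]) p^`M(i)].

Definition mdvd (g p : {mpoly K[n]}) : Prop := exists h, p = h * g.

Definition squarefree (p : {mpoly K[n]}) : Prop :=
  forall g, mdvd (g ^+ 2) p -> g \is a GRing.unit.

Definition gcd_is_1 (m : nat) (f : m.-tuple {mpoly K[n]}) : Prop :=
  forall g, (forall i, mdvd g (tnth f i)) -> g \is a GRing.unit.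

(* Nonzero row vectors as homogeneous coordinates of points of P^(n-1). *)
Definition proj_eq (u v : 'rV[K]_n) : Prop := exists2 c : K, c != 0 & u = c *: v.

End Forms.

(* Pull-back of forms by f : K^m -> K^n. The enumeration of I is increasing. *)
Definition pullback (K : fieldType) (m n : nat) (f : n.-tuple {mpoly K[m]})
    (a : form K n) : form K m :=
  \sum_(I : {set 'I_n})
     fscale (a I \mPo f)
            (\big[@wedge K m/form1 K m]_(i <- enum I) mdiff (tnth f i)).

Section Curve.
Variable K : fieldType.
Implicit Types (f : 3.-tuple {mpoly K[2]}) (F : {mpoly K[3]}).

Definition param f (u : 'rV[K]_2) : 'rV[K]_3 := \row_i (tnth f i).@[u 0].

Definition in_fiber f (p : 'rV[K]_3) (u : 'rV[K]_2) : Prop :=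
  u != 0 /\ proj_eq p (param f u).

Definition in_image f (p : 'rV[K]_3) : Prop := exists u, in_fiber f p u.

(* The points of the image outside the zero locus of G form a nonempty Zariski
   open subset of it; such sets are a basis of the topology. *)
Definition generically_1to1 f : Prop :=
  exists (k : nat) (G : {mpoly K[3]}),
    [/\ G \is k.-homog,
        (exists p, in_image f p /\ G.@[p 0] != 0) &
        forall p, in_image f p -> G.@[p 0] != 0 ->
          exists u, in_fiber f p u /\ forall v, in_fiber f p v -> proj_eq v u].

Definition reduced_equation f (d : nat) F : Prop :=
  [/\ F \is d.-homog, squarefree F &
      forall p : 'rV[K]_3, p != 0 -> (F.@[p 0] = 0 <-> in_image f p)].

Definition jacobian_ideal F (g : {mpoly K[3]}) : Prop :=
  exists a : 'I_3 -> {mpoly K[3]}, g = \sum_i a i * F^`M(i).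

Definition global_tjurina F (tau : nat) : Prop :=
  exists k0 : nat, forall k : nat, (k0 <= k)%N ->
    free_quot (fun g : {mpoly K[3]} => g \is k.-homog)
              (fun g => g \is k.-homog /\ jacobian_ideal F g) tau.

Definition AR F (r : 'rV[{mpoly K[3]}]_3) : Prop :=
  \sum_i r 0 i * F^`M(i) = 0.

Definition free_curve F : Prop := free_quot (AR F) (fun r => r = 0) 2.

(* The degree-q part of F Omega^j + dF /\ Omega^(j-1), where deg F = d. *)
Definition relations (d : nat) F (j q : int) (a : form K 3) : Prop :=
  exists b c : form K 3,
    [/\ Omega j (q - d%:Z) b, Omega (j - 1) (q - d%:Z) c &
        a = fscale F b + wedge (mdiff F) c].

(* The forms whose class modulo [relations] lies in the kernel of the map
   induced by the pull-back. *)
Definition pullback_ker f (j q : int) (a : form K 3) : Prop :=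
  Omega j q a /\ pullback f a = 0.

Definition ker_zero f (d : nat) F (j q : int) : Prop :=
  forall a, pullback_ker f j q a <-> relations d F j q a.

Definition ker_dim f (d : nat) F (j q : int) (r : nat) : Prop :=
  free_quot (M := {ffun {set 'I_3} -> {mpoly K[3]}})
    (pullback_ker f j q) (relations d F j q) r.

End Curve.

(* Main.v *)
Require Import Defs.
From HB Require Import structures.
From mathcomp Require Import all_boot all_order all_algebra all_fingroup all_field.
From mathcomp Require Import boolp reals complex mpoly zify ring.

Set Implicit Arguments.
Unset Strict Implicit.
Unset Printing Implicit Defensive.

Import GRing.Theory Num.Theory.
Local Open Scope ring_scope.

(** Notation: S = K[x,y,z], J is the Jacobian ideal of F, AR is the module of
    syzygies of the gradient dF, KR the submodule of its Koszul syzygies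
    dF x a, and E = (x,y,z). The field K may be any algebraically closed field
    with a norm, hence of characteristic 0.

    A general line z = al x + be y meets the curve in d simple points, and each
    of them has only one parameter ([good_line_exists]); this is a Bertini
    argument for a pencil of binary forms, by means of a Wronskian. Binary
    forms are handled through their dehomogenization [hat], ternary forms
    through their restriction [rho] to that line: a ternary form that restricts
    to 0 is divisible by the equation of the line, and this allows inductions on
    the degree.

    A ternary form that pulls back to 0 restricts to a polynomial with d known
    roots, hence to a multiple of rho F, and in the end it is a multiple of F
    ([pull_kernel]). This is the case of 0-forms.

    Along the curve, dF is orthogonal to f and to f', so it is parallel to
    f x f'. Hence a 1-form with coefficient vector u pulls back to 0 exactly
    when F divides dF x u ([tangent_log]), and a 2-form with coefficient vector
    u exactly when F divides u . dF ([flux_log]). Euler's relation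
    dF x (r x E) = d F r - (r . dF) E then shows that r |-> r x E induces an
    isomorphism from (AR/KR) in degree q-2 onto the kernel for 1-forms of degree
    q ([log1_dim]), while the kernel for 2-forms of degree q is an extension of
    (S/J) in degree q-3 by (AR/KR) in degree q-2 ([log2_dim]).

    It remains to see when these pieces have dimension tau. Multiplication by
    the equation of the line, from (S/J) in degree m to (S/J) in degree m+1, is
    bijective for m >= 2d-3 ([jacobian_hilbert]). It is surjective because rho F
    is squarefree; it is injective because the curve has many tangent vector
    fields ([syzygy_lift]), which come from the adjugate of a Bezout type matrix
    whose kernel along the curve contains the vector of Lagrange polynomials of the
    d parameters. So (S/J) has dimension tau in degrees >= 2d-3, and the Euler
    characteristic of the Koszul complex of dF, whose other homology vanishes
    ([koszul_parallel]), gives (AR/KR) the dimension tau in degrees >= 2d-4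
    ([koszul_homology_dim]).

    When the curve is free, AR has a homogeneous basis, of degrees a + b = d-1,
    whose vector product is a constant multiple of dF ([free_curve_basis]).
    Neither degree is 0, because the partial derivatives are linearly
    independent ([no_constant_syzygy]). The Hilbert function of S/J is then
    explicit, and constant already from degree 2d-5 on ([free_hilbert]). *)

(** * Dimensions of quotients of vector spaces *)

Section QuotientDimension.
Variables (K : fieldType).

Definition submod (M : lmodType K) (V : M -> Prop) : Prop :=
  V 0 /\ forall a u v, V u -> V v -> V (a *: u + v).

(** A linear isomorphism from V/W onto K^n, given as a map on M that is only
    meaningful on V: quotients need not be formed as types. *)
Definition coordinates (M : lmodType K) (V W : M -> Prop) n (k : M -> 'rV[K]_n) : Prop :=
  [/\ forall a u v, V u -> V v -> k (a *: u + v) = a *: k u + k v,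
      forall v, V v -> (W v <-> k v = 0) &
      forall c, exists2 v, V v & k v = c].

Section OneModule.
Variable M : lmodType K.
Implicit Types V W U : M -> Prop.

Lemma submodZ V a u : submod V -> V u -> V (a *: u).
Proof. by move=> [V0 VD] Vu; rewrite -[_ *: _]addr0; apply: VD. Qed.

Lemma submodD V u v : submod V -> V u -> V v -> V (u + v).
Proof. by move=> [V0 VD] Vu Vv; rewrite -[u]scale1r; apply: VD. Qed.

Lemma submodB V u v : submod V -> V u -> V v -> V (u - v).
Proof. by move=> [V0 VD] Vu Vv; rewrite addrC -scaleN1r; apply: VD. Qed.

Lemma submod_sum V I (r : seq I) (u : I -> M) :
  submod V -> (forall i, V (u i)) -> V (\sum_(i <- r) u i).
Proof.
move=> sV Vu; elim: r => [|i r IH]; first by rewrite big_nil; case: sV.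
by rewrite big_cons; apply: submodD.
Qed.

Lemma coordinates_sum V W n (k : M -> 'rV[K]_n) I (r : seq I) (c : I -> K) u :
  submod V -> coordinates V W k -> (forall i, V (u i)) ->
  k (\sum_(i <- r) c i *: u i) = \sum_(i <- r) c i *: k (u i).
Proof.
move=> sV [klin kker _] Vu; have k0 : k 0 = 0.
  have V0 := sV.1; have := klin 1 0 0 V0 V0.
  by rewrite !scale1r addr0 -[LHS]addr0 => /addrI.
elim: r => [|i r IH]; first by rewrite !big_nil.
rewrite !big_cons klin ?IH //.
by apply: submod_sum => // j; apply: submodZ.
Qed.

Lemma coordinatesB V W n (k : M -> 'rV[K]_n) u v :
  coordinates V W k -> V u -> V v -> k (u - v) = k u - k v.
Proof. by move=> [klin _ _] Vu Vv; rewrite addrC -scaleN1r klin // scaleN1r addrC. Qed.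

(** Bases of quotients are awkward to transport along linear maps, while
    coordinate maps compose with them. *)
Lemma free_quotP V W n : submod V -> submod W ->
  free_quot V W n <->
  (forall w, W w -> V w) /\ exists k : M -> 'rV[K]_n, coordinates V W k.
Proof.
move=> sV sW; split=> -[WV].
  case=> e [Ve He]; split=> //.
  have /choice [k Hk] : forall v, exists c : 'rV[K]_n, V v ->
      W (v - \sum_i c 0 i *: e i) /\
      forall c' : 'rV[K]_n, W (v - \sum_i c' 0 i *: e i) -> c = c'.
    move=> v; have [Vv|nVv] := pselect (V v); last by exists 0.
    by have [c Hc] := He v Vv; exists c.
  exists k; split.
  - move=> a u v Vu Vv; have Vw : V (a *: u + v) by apply: sV.2.
    apply: (Hk _ Vw).2.
    have -> : a *: u + v - \sum_i (a *: k u + k v) 0 i *: e i =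
       a *: (u - \sum_i k u 0 i *: e i) + (v - \sum_i k v 0 i *: e i).
      rewrite scalerBr scaler_sumr addrACA -opprD -big_split /=.
      by congr (_ - _); apply: eq_bigr => i _; rewrite !mxE scalerDl scalerA.
    by apply: sW.2; [case: (Hk u Vu) | case: (Hk v Vv)].
  - move=> v Vv; split=> [Wv|k0].
      apply: (Hk v Vv).2; rewrite big1 ?subr0 // => i _.
      by rewrite mxE scale0r.
    have [+ _] := Hk v Vv; rewrite k0 big1 ?subr0 // => i _.
    by rewrite mxE scale0r.
  - move=> c; have Vs : V (\sum_i c 0 i *: e i).
      by apply: submod_sum => // i; apply: submodZ.
    exists (\sum_i c 0 i *: e i) => //.
    by apply: (Hk _ Vs).2; rewrite subrr; case: sW.
case=> k kP; have [klin kker ksurj] := kP; split=> //.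
have /choice [e He] : forall i : 'I_n, exists v, V v /\ k v = delta_mx 0 i.
  by move=> i; have [v Vv kv] := ksurj (delta_mx 0 i); exists v.
have kc (c : 'rV[K]_n) : k (\sum_i c 0 i *: e i) = c.
  rewrite (coordinates_sum _ _ sV kP) => [|i]; last by case: (He i).
  rewrite [RHS]row_sum_delta; apply: eq_bigr => i _.
  by case: (He i) => _ ->.
have Vc (c : 'rV[K]_n) : V (\sum_i c 0 i *: e i).
  by apply: submod_sum => // i; apply: submodZ => //; case: (He i).
exists e; split=> [i|v Vv]; first by case: (He i).
exists (k v); split=> [|c'].
  by apply/kker; rewrite ?(coordinatesB kP) ?kc ?subrr //; apply: submodB.
move/kker; rewrite (coordinatesB kP) ?kc //.
by move=> H; apply/eqP; rewrite -subr_eq0 H //; apply: submodB.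
Qed.

Lemma free_quot_trans V U W a b : submod V -> submod U -> submod W ->
  free_quot V U a -> free_quot U W b -> free_quot V W (a + b)%N.
Proof.
move=> sV sU sW VU UW; have [WU _] := UW.
have [UV [k kP]] := (free_quotP a sV sU).1 VU.
have [_ [l lP]] := (free_quotP b sU sW).1 UW.
have [klin kker ksurj] := kP; have [llin lker lsurj] := lP.
have /choice [e He] : forall i : 'I_a, exists v, V v /\ k v = delta_mx 0 i.
  by move=> i; have [v Vv kv] := ksurj (delta_mx 0 i); exists v.
pose s (c : 'rV[K]_a) : M := \sum_i c 0 i *: e i.
have ks c : k (s c) = c.
  rewrite (coordinates_sum _ _ sV kP) => [|i]; last by case: (He i).
  rewrite [RHS]row_sum_delta; apply: eq_bigr => i _.
  by case: (He i) => _ ->.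
have Vs c : V (s c).
  by apply: submod_sum => // i; apply: submodZ => //; case: (He i).
have Us v : V v -> U (v - s (k v)).
  by move=> Vv; apply/kker; rewrite ?(coordinatesB kP) ?ks ?subrr //; apply: submodB.
have slin x c c' : s (x *: c + c') = x *: s c + s c'.
  rewrite /s scaler_sumr -big_split /=; apply: eq_bigr => i _.
  by rewrite !mxE scalerDl scalerA.
have s0 : s 0 = 0 by rewrite /s big1 // => i _; rewrite mxE scale0r.
apply/free_quotP => //; split=> [w /WU/UV //|].
(* s is a linear section of the coordinates modulo U; the correction by s (k v)
   brings v into U, where the second coordinates apply. *)
exists (fun v => row_mx (k v) (l (v - s (k v)))); split.
- move=> x u v Vu Vv; rewrite klin // slin scale_row_mx add_row_mx -llin; try exact: Us.
  by congr row_mx; congr l; rewrite scalerBr addrACA opprD.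
- move=> v Vv; split=> [Wv|/eqP].
    have kv0 : k v = 0 by apply/kker => //; apply: WU.
    rewrite kv0 s0 subr0; have -> : l v = 0 by apply/lker => //; apply: WU.
    by rewrite row_mx0.
  rewrite row_mx_eq0 => /andP[/eqP kv0]; rewrite kv0 s0 subr0 => /eqP lv0.
  by apply/lker => //; apply/kker.
- move=> c; have [u Uu lu] := lsurj (rsubmx c).
  exists (s (lsubmx c) + u); first by apply: submodD => //; apply: UV.
  have ku : k u = 0 by apply/kker => //; apply: UV.
  have -> : k (s (lsubmx c) + u) = lsubmx c.
    by rewrite addrC -[u]scale1r klin ?ks ?ku ?scaler0 ?add0r //; apply: UV.
  by rewrite addrC addKr lu hsubmxK.
Qed.

(** Lifting a basis of K^n along k and reading it in the coordinates l gives a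
    matrix with independent rows. *)
Lemma coordinates_leq V W n m (k : M -> 'rV[K]_n) (l : M -> 'rV[K]_m) :
  submod V -> coordinates V W k -> coordinates V W l -> (n <= m)%N.
Proof.
move=> sV kP lP; have [klin kker ksurj] := kP; have [llin lker lsurj] := lP.
have /choice [e He] : forall i : 'I_n, exists v, V v /\ k v = delta_mx 0 i.
  by move=> i; have [v Vv kv] := ksurj (delta_mx 0 i); exists v.
pose A := \matrix_(i < n) l (e i).
suff /eqP <- : row_free A by apply: rank_leq_col.
rewrite -kermx_eq0; apply/rowV0P => c /sub_kermxP cA.
have Vs : V (\sum_i c 0 i *: e i).
  by apply: submod_sum => // i; apply: submodZ => //; case: (He i).
have ls : l (\sum_i c 0 i *: e i) = 0.
  rewrite (coordinates_sum _ _ sV lP) => [|i]; last by case: (He i).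
  rewrite -[RHS]cA mulmx_sum_row; apply: eq_bigr => i _.
  by rewrite rowK.
have : k (\sum_i c 0 i *: e i) = 0 by apply/kker => //; apply/lker.
rewrite (coordinates_sum _ _ sV kP) => [|i]; last by case: (He i).
move=> <-; rewrite [LHS]row_sum_delta; apply: eq_bigr => i _.
by case: (He i) => _ ->.
Qed.

Lemma free_quot_uniq V W n m : submod V -> submod W ->
  free_quot V W n -> free_quot V W m -> n = m.
Proof.
move=> sV sW /(free_quotP _ sV sW)[_ [k kP]] /(free_quotP _ sV sW)[_ [l lP]].
by apply/eqP; rewrite eqn_leq (coordinates_leq sV kP lP) (coordinates_leq sV lP kP).
Qed.

End OneModule.

(** Adding to a matrix one vector of U that its row space misses raises the rank,
    so this stops after at most n steps. *)
Lemma submod_rowspace n (U : 'rV[K]_n -> Prop) : submod U ->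
  exists B : 'M[K]_n, forall u, U u <-> (u <= B)%MS.
Proof.
move=> sU.
suff H k (B : 'M[K]_n) : (n - \rank B <= k)%N -> (forall u, (u <= B)%MS -> U u) ->
    exists B : 'M[K]_n, forall u, U u <-> (u <= B)%MS.
  apply: (H n 0); first exact: leq_subr.
  by move=> u; rewrite submx0 => /eqP ->; case: sU.
elim: k B => [|k IH] B rB BU.
  exists B => u; split=> [_|/BU //]; apply: submx_full.
  by rewrite /row_full eqn_leq rank_leq_col -subn_eq0 -leqn0.
have [UB|] := pselect (forall u, U u -> (u <= B)%MS).
  by exists B => u; split=> [/UB|/BU].
move=> /existsNP [u /not_implyP [Uu /negP nuB]].
apply: (IH (B + u)%MS).
  have : (\rank B < \rank (B + u)%MS)%N.
    apply: rank_ltmx; rewrite /ltmx addsmxSl /=.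
    by apply: contra nuB => /(submx_trans (addsmxSr _ _)).
  by move: rB; have := rank_leq_col (B + u)%MS; lia.
move=> w /sub_addsmxP [[x y] /= ->]; apply: (submodD sU).
  by apply: BU; apply: submxMl.
rewrite [y]mx11_scalar mul_scalar_mx; exact: (submodZ _ sU).
Qed.

(** A linear map h that induces a bijection from V/W onto V'/W' transports
    dimensions both ways; being given modulo W', surjectivity and injectivity can
    be checked without inverting h. *)
Lemma free_quot_image (M N : lmodType K) (V W : M -> Prop) (V' W' : N -> Prop)
    (h : M -> N) n :
  submod V -> submod W -> submod V' -> submod W' ->
  (forall a u v, h (a *: u + v) = a *: h u + h v) ->
  (forall w, W w -> V w) -> (forall w, W' w -> V' w) ->
  (forall v, V v -> V' (h v)) ->
  (forall v', V' v' -> exists2 v, V v & W' (v' - h v)) ->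
  (forall v, V v -> (W v <-> W' (h v))) ->
  free_quot V W n <-> free_quot V' W' n.
Proof.
move=> sV sW sV' sW' hlin WV WV' hV hsurj hW.
split=> [/(free_quotP _ sV sW)[_ [k kP]]|/(free_quotP _ sV' sW')[_ [k kP]]];
  have [klin kker ksurj] := kP; apply/free_quotP => //; split=> //; last first.
  exists (k \o h); split=> /=.
  - by move=> a u v Vu Vv; rewrite hlin klin //; apply: hV.
  - by move=> v Vv; rewrite hW //; apply: kker; apply: hV.
  - move=> c; have [v' Vv' <-] := ksurj c; have [v Vv Wv] := hsurj _ Vv'.
    have Vhv := hV _ Vv; exists v => //.
    apply/eqP; rewrite eq_sym -subr_eq0 -(coordinatesB kP) //.
    by apply/eqP/kker => //; apply: submodB.
(* A choice of preimages; it is linear modulo W only, which suffices once it is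
   composed with the coordinates k. *)
have /choice [s Hs] : forall v', exists v, V' v' -> V v /\ W' (v' - h v).
  move=> w; have [/hsurj[x Vx Wx]|nV] := pselect (V' w); first by exists x.
  by exists 0.
have hB u v : h (u - v) = h u - h v.
  by rewrite addrC -scaleN1r hlin scaleN1r addrC.
have kE u v : V u -> V v -> W' (h u - h v) -> k u = k v.
  move=> Vu Vv Wuv; apply/eqP; rewrite -subr_eq0 -(coordinatesB kP) //.
  apply/eqP/kker; first by apply: submodB.
  by apply/hW; [apply: submodB | rewrite hB].
exists (k \o s); split=> /=.
- move=> a u v Vu Vv; have Vw : V' (a *: u + v) by apply: sV'.2.
  have [su1 su2] := Hs _ Vu; have [sv1 sv2] := Hs _ Vv; have [sw1 sw2] := Hs _ Vw.
  rewrite -klin //; apply: kE => //; first by apply: sV.2.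
  rewrite hlin.
  have -> : h (s (a *: u + v)) - (a *: h (s u) + h (s v)) =
    (a *: (u - h (s u)) + (v - h (s v))) - ((a *: u + v) - h (s (a *: u + v))).
    by rewrite scalerBr addrACA -opprD opprB [RHS]addrC addrA subrK.
  by apply: submodB => //; apply: sW'.2.
- move=> v' Vv'; have [s1 s2] := Hs _ Vv'.
  rewrite -kker // hW //; split=> [Wv|Wh].
    by rewrite -[h _](subKr v'); apply: submodB.
  by rewrite -[v'](subrK (h (s v'))); apply: submodD.
- move=> c; have [v Vv <-] := ksurj c; exists (h v); first by apply: hV.
  have [s1 s2] := Hs _ (hV _ Vv); apply: kE => //.
  by rewrite -opprB -scaleN1r; apply: submodZ.
Qed.

Lemma submod_zero (M : lmodType K) : submod (fun v : M => v = 0).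
Proof. by split=> // a u v -> ->; rewrite scaler0 addr0. Qed.

Lemma free_quot_sub (M : lmodType K) (V U : M -> Prop) n :
  submod V -> submod U -> (forall u, U u -> V u) -> free_quot V (fun v => v = 0) n ->
  exists b, [/\ (b <= n)%N, free_quot U (fun v => v = 0) b & free_quot V U (n - b)].
Proof.
move=> sV sU UV Vn; have s0 := submod_zero M.
have [_ [k kP]] := (free_quotP n sV s0).1 Vn; have [klin kker ksurj] := kP.
pose U' c := exists2 u, U u & k u = c.
have k0 : k 0 = 0 by apply/kker => //; case: sV.
have sU' : submod U'.
  split; first by exists 0 => //; case: sU.
  move=> a _ _ [u Uu <-] [v Uv <-]; exists (a *: u + v); first by apply: sU.2.
  by rewrite klin //; apply: UV.
have [B BP] := submod_rowspace sU'.
exists (\rank B); split; first exact: rank_leq_col.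
  apply/free_quotP => //; split; first by move=> w ->; case: sU.
  exists (fun u => k u *m pinvmx (row_base B)); split.
  - by move=> a u v Uu Uv; rewrite klin ?mulmxDl ?scalemxAl //; apply: UV.
  - move=> u Uu; split=> [->|]; first by rewrite k0 mul0mx.
    have kuB : (k u <= row_base B)%MS by rewrite eq_row_base; apply/BP; exists u.
    move=> H; apply/(kker _ (UV _ Uu)); rewrite -(mulmxKpV kuB) H.
    by rewrite mul0mx.
  - move=> c; have /BP [u Uu ku] : (c *m row_base B <= B)%MS.
      by rewrite -(eq_row_base B) submxMl.
    exists u => //; rewrite ku.
    have /row_free_inj := row_base_free B; apply.
    by rewrite mulmxKpV ?submxMl.
have rC : \rank (cokermx B) = (n - \rank B)%N by rewrite mxrank_coker.
rewrite -rC; apply/free_quotP => //; split=> //.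
exists (fun v => k v *m col_base (cokermx B)); split.
- by move=> a u v Vu Vv; rewrite klin // mulmxDl scalemxAl.
- have Hk c : c *m col_base (cokermx B) = 0 <-> (c <= B)%MS.
    have -> : (c <= B)%MS =
        (c *m col_base (cokermx B) *m row_base (cokermx B) == 0).
      by rewrite submxE -mulmxA mulmx_base.
    split=> [->|/eqP H]; first by rewrite mul0mx.
    have /row_free_inj := row_base_free (cokermx B); apply.
    by rewrite H mul0mx.
  move=> v Vv; rewrite Hk -BP; split=> [Uv|[u Uu ku]]; first by exists v.
  suff -> : v = u by [].
  apply/eqP; rewrite -subr_eq0; apply/eqP/kker; first by apply: submodB => //; apply: UV.
  by rewrite (coordinatesB kP) ?ku ?subrr //; apply: UV.
- move=> c.
  have /submxP [c' Hc'] : (c <= col_base (cokermx B))%MS.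
    by apply: submx_full; apply: col_base_full.
  by have [v Vv kv] := ksurj c'; exists v => //; rewrite kv.
Qed.

Lemma free_quot_quotient (M : lmodType K) (V U : M -> Prop) n b :
  submod V -> submod U -> (forall u, U u -> V u) -> free_quot V (fun v => v = 0) n ->
  free_quot U (fun v => v = 0) b -> (b <= n)%N /\ free_quot V U (n - b).
Proof.
move=> sV sU UV Vn Ub; have [b' [le Ub' VU]] := free_quot_sub sV sU UV Vn.
by rewrite (free_quot_uniq sU (@submod_zero M) Ub Ub').
Qed.

Lemma free_quot_kernel (M : lmodType K) (V U : M -> Prop) n a :
  submod V -> submod U -> (forall u, U u -> V u) -> free_quot V (fun v => v = 0) n ->
  free_quot V U a -> (a <= n)%N /\ free_quot U (fun v => v = 0) (n - a).
Proof.
move=> sV sU UV Vn VU; have [b' [le Ub' VU']] := free_quot_sub sV sU UV Vn.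
by rewrite (free_quot_uniq sV sU VU VU') leq_subr subKn.
Qed.

End QuotientDimension.

(** * Polynomial substitutions and homogeneous components *)

Section MPolyEval.
Variables (K : fieldType) (n : nat).
Implicit Types (p q : {mpoly K[n]}) (h : 'I_n -> {poly K}).

(** Induction on the construction of a polynomial from constants and variables,
    suited to statements about ring morphisms. *)
Lemma mpoly_alg_ind (P : {mpoly K[n]} -> Prop) :
  (forall c, P c%:MP) -> (forall i, P 'X_i) ->
  (forall p q, P p -> P q -> P (p + q)) ->
  (forall p q, P p -> P q -> P (p * q)) -> forall p, P p.
Proof.
move=> PC PX PD PM; elim/mpolyind => [|c m p _ _ Pp]; first by rewrite -mpolyC0.
apply: PD => //; rewrite -mul_mpolyC; apply: (PM) => //.
rewrite mpolyXE_id; apply: (big_ind P) => [|q r|i _]; first by rewrite -mpolyC1.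
  exact: (PM).
by elim: (m i) => [|k IH]; rewrite ?expr0 -?mpolyC1 // exprS; apply: (PM).
Qed.

(** Linear statements about forms of degree d need only be checked on monomials. *)
Lemma dhomog_ind d (P : {mpoly K[n]} -> Prop) :
  P 0 -> (forall c p q, P p -> P q -> P (c *: p + q)) ->
  (forall m : 'X_{1..n}, mdeg m = d -> P 'X_[m]) ->
  forall p, p \is d.-homog -> P p.
Proof.
move=> P0 PD PX p /dhomogP hp; rewrite [p]mpolyE big_seq.
elim/big_rec: _ => // m q mp Pq; apply: PD => //.
by apply: PX; apply: hp.
Qed.

Definition ev h p : {poly K} := mmap (@polyC K) h p.

HB.instance Definition _ h := GRing.RMorphism.copy (ev h) (ev h).

Lemma evC h c : ev h c%:MP = c%:P. Proof. exact: mmapC. Qed.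
Lemma evXU h i : ev h 'X_i = h i. Proof. by rewrite /ev mmapX mmap1U. Qed.
Lemma evZ h c p : ev h (c *: p) = c *: ev h p.
Proof. by rewrite -mul_mpolyC rmorphM /= evC mul_polyC. Qed.
Lemma evX h m : ev h 'X_[m] = \prod_i h i ^+ m i.
Proof. by rewrite /ev mmapX. Qed.

Lemma horner_ev h p x : (ev h p).[x] = p.@[fun i => (h i).[x]].
Proof.
elim/mpoly_alg_ind: p => [c|i|p q|p q].
- by rewrite evC hornerC mevalC.
- by rewrite evXU mevalXU.
- by rewrite rmorphD hornerD mevalD => -> ->.
- by rewrite rmorphM hornerM mevalM => -> ->.
Qed.

Lemma deriv_ev h p : (ev h p)^`() = \sum_i ev h p^`M(i) * (h i)^`().
Proof.
elim/mpoly_alg_ind: p => [c|i|p q IHp IHq|p q IHp IHq].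
- by rewrite evC derivC big1 // => i _; rewrite mderivC rmorph0 mul0r.
- rewrite evXU (bigD1 i) //= big1 ?addr0 => [|j ji]; rewrite mderivX mnm1E.
    by rewrite eqxx scale1r -{1}[U_(i)%MM]add0m addmK mpolyX0 rmorph1 mul1r.
  by rewrite eq_sym (negbTE ji) scale0r rmorph0 mul0r.
- rewrite rmorphD derivD IHp IHq -big_split; apply: eq_bigr => i _.
  by rewrite mderivD rmorphD mulrDl.
- rewrite rmorphM derivM IHp IHq mulr_suml mulr_sumr -big_split; apply: eq_bigr => i _.
  by rewrite mderivM rmorphD !rmorphM /= mulrDl mulrAC mulrA.
Qed.

Lemma size_mul_leS (p q : {poly K}) a b :
  (size p <= a.+1)%N -> (size q <= b.+1)%N -> (size (p * q)%R <= (a + b).+1)%N.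
Proof.
move=> pa qb; have := poly.size_polyMleq p q; lia.
Qed.

Lemma size_ev h k d p : (forall i, (size (h i) <= k.+1)%N) -> p \is d.-homog ->
  (size (ev h p) <= (d * k).+1)%N.
Proof.
move=> hk; elim/dhomog_ind: p / => [|c p q Hp Hq|m <-].
- by rewrite rmorph0 size_poly0.
- rewrite rmorphD /= evZ; apply: leq_trans (size_polyD _ _) _.
  by rewrite geq_max Hq (leq_trans (size_scale_leq _ _)).
- rewrite evX mdegE big_distrl /=.
  elim/big_rec2: _ => [|i a q _ Hq]; first by rewrite size_poly1.
  apply: size_mul_leS => //.
  elim: (m i) => [|e IH]; first by rewrite size_poly1.
  by rewrite exprS mulSn; apply: size_mul_leS.
Qed.

Lemma meval_homog d p (c : K) v : p \is d.-homog ->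
  p.@[fun i => c * v i] = c ^+ d * p.@[v].
Proof.
elim/dhomog_ind: p / => [|a p q Hp Hq|m <-].
- by rewrite !meval0 mulr0.
- by rewrite !mevalD !mevalZ Hp Hq mulrDr mulrCA.
- rewrite !mevalX mdegE -prodrXr -big_split; apply: eq_bigr => i _.
  by rewrite exprMn.
Qed.

Lemma mderiv_homog d p i : p \is d.+1.-homog -> p^`M(i) \is d.-homog.
Proof.
elim/dhomog_ind: p / => [|a p q Hp Hq|m md].
- by rewrite mderiv0 rpred0.
- by rewrite mderivD mderivZ rpredD // rpredZ.
- rewrite mderivX; have [->|mi] := posnP (m i); first by rewrite scale0r rpred0.
  have Um : (U_(i) <= m)%MM by rewrite lep1mP -lt0n.
  have := congr1 mdeg (submK Um); rewrite mdegD mdeg1 md addn1 => -[H].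
  by rewrite rpredZ // dhomogX /= H.
Qed.

Lemma euler d p : p \is d.-homog -> \sum_i 'X_i * p^`M(i) = d%:R *: p.
Proof.
elim/dhomog_ind: p / => [|a p q Hp Hq|m <-].
- by rewrite scaler0 big1 // => i _; rewrite mderiv0 mulr0.
- rewrite scalerDr -Hq scalerA mulrC -scalerA -Hp scaler_sumr -big_split /=.
  by apply: eq_bigr => i _; rewrite mderivD mderivZ mulrDr scalerAr.
- rewrite mdegE natr_sum scaler_suml; apply: eq_bigr => i _.
  rewrite mderivX; have [->|mi] := posnP (m i); first by rewrite !scale0r mulr0.
  rewrite -scalerAr -mpolyXD addmC submK // ; by rewrite lep1mP -lt0n.
Qed.

End MPolyEval.

Lemma ev_comp (K : fieldType) n m (f : n.-tuple {mpoly K[m]}) h p :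
  ev h (p \mPo f) = ev (fun i => ev h (tnth f i)) p.
Proof.
elim/mpoly_alg_ind: p => [c|i|p q|p q].
- by rewrite comp_mpolyC !evC.
- by rewrite comp_mpolyXU evXU (tnth_nth 0).
- by rewrite comp_mpolyD !rmorphD /= => -> ->.
- by rewrite [(p * q) \mPo f]rmorphM !rmorphM /= => -> ->.
Qed.

Lemma comp_homog (K : fieldType) n m d e (f : n.-tuple {mpoly K[m]}) p :
  (forall i, tnth f i \is d.-homog) -> p \is e.-homog ->
  p \mPo f \is (e * d).-homog.
Proof.
move=> hf; elim/dhomog_ind: p / => [|a p q Hp Hq|k <-].
- by rewrite rmorph0 rpred0.
- by rewrite comp_mpolyD comp_mpolyZ rpredD // rpredZ.
- rewrite comp_mpolyX mdegE big_distrl /=.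
  elim/big_rec2: _ => [|i a q _ Hq]; first exact: dhomog1.
  by apply: dhomogM => //; rewrite mulnC; apply: dhomogMn.
Qed.

Section HomogeneousParts.
Variables (K : fieldType) (n : nat).
Implicit Types (p g h : {mpoly K[n]}).

Lemma mpoly_lin_ind (P : {mpoly K[n]} -> Prop) :
  P 0 -> (forall c p q, P p -> P q -> P (c *: p + q)) ->
  (forall m, P 'X_[m]) -> forall p, P p.
Proof.
move=> P0 PD PX; elim/mpolyind => [//|c m p _ _ Pp]; exact: PD.
Qed.

Lemma homogX1 i : ('X_i : {mpoly K[n]}) \is 1.-homog.
Proof. by rewrite dhomogX /= mdeg1. Qed.

Lemma homogXn i k : ('X_i ^+ k : {mpoly K[n]}) \is k.-homog.
Proof. by have := dhomogMn k (homogX1 i); rewrite mul1n. Qed.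

Lemma pihomogM k e h g : g \is e.-homog ->
  pihomog mdeg (k + e) (h * g) = pihomog mdeg k h * g.
Proof.
move=> hg; elim/mpoly_lin_ind: h => [|c p q Hp Hq|m].
- by rewrite mul0r !raddf0 mul0r.
- by rewrite mulrDl -scalerAl !linearP /= Hp Hq mulrDl scalerAl.
- have hm : 'X_[m] * g \is (mdeg m + e).-homog by apply: dhomogM; rewrite ?dhomogX.
  rewrite pihomogX; have [<-|mk] := eqVneq (mdeg m) k; first exact: pihomog_dE.
  by rewrite mul0r; apply: pihomog_ne0 hm; rewrite eqn_add2r.
Qed.

Lemma pihomogM_small k e h g : g \is e.-homog -> (k < e)%N ->
  pihomog mdeg k (h * g) = 0.
Proof.
move=> hg ke; elim/mpoly_lin_ind: h => [|c p q Hp Hq|m].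
- by rewrite mul0r raddf0.
- by rewrite mulrDl -scalerAl linearP /= Hp Hq scaler0 addr0.
- have hm : 'X_[m] * g \is (mdeg m + e).-homog by apply: dhomogM; rewrite ?dhomogX.
  by apply: pihomog_ne0 hm; rewrite neq_ltn orbC; apply/orP; left; lia.
Qed.

(** The quotient may be replaced by its homogeneous component of the right degree. *)
Lemma homog_quotient m e p h g : g \is e.-homog -> p \is (m + e).-homog ->
  p = h * g -> exists2 h', h' \is m.-homog & p = h' * g.
Proof.
move=> hg hp e1; exists (pihomog mdeg m h); first exact: pihomogP.
by rewrite -(pihomogM _ _ hg) -e1 pihomog_dE.
Qed.

Lemma homog_quotient_small m e p h g : g \is e.-homog -> p \is m.-homog -> (m < e)%N ->
  p = h * g -> p = 0.
Proof.
by move=> hg hp me e1; rewrite -(pihomog_dE hp) e1 (pihomogM_small _ hg).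
Qed.

Lemma ev_ext (h1 h2 : 'I_n -> {poly K}) p : h1 =1 h2 -> ev h1 p = ev h2 p.
Proof.
move=> e; elim/mpoly_alg_ind: p => [c|i|p q|p q].
- by rewrite !evC.
- by rewrite !evXU.
- by rewrite !rmorphD /= => -> ->.
- by rewrite !rmorphM /= => -> ->.
Qed.

End HomogeneousParts.

(** * Binary forms as univariate polynomials, and restriction to a line *)

Notation i0 := (@Ordinal 3 0 isT).
Notation i1 := (@Ordinal 3 1 isT).
Notation i2 := (@Ordinal 3 2 isT).
Notation j0 := (@Ordinal 2 0 isT).
Notation j1 := (@Ordinal 2 1 isT).

Lemma sum_ord3 (V : nmodType) (G : 'I_3 -> V) : \sum_i G i = G i0 + G i1 + G i2.
Proof.
rewrite !big_ord_recl big_ord0 addr0 addrA.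
by congr (G _ + G _ + G _); apply: val_inj.
Qed.

Lemma sum_ord2 (V : nmodType) (G : 'I_2 -> V) : \sum_i G i = G j0 + G j1.
Proof.
rewrite !big_ord_recl big_ord0 addr0.
by congr (G _ + G _); apply: val_inj.
Qed.

Lemma prod_ord2 (A : comPzRingType) (G : 'I_2 -> A) : \prod_i G i = G j0 * G j1.
Proof.
rewrite !big_ord_recl big_ord0 mulr1.
by congr (G _ * G _); apply: val_inj.
Qed.

Lemma ord3P (P : 'I_3 -> Prop) : P i0 -> P i1 -> P i2 -> forall i, P i.
Proof.
move=> P0 P1 P2 i; have : (i < 3)%N := ltn_ord i.
case: i => [[|[|[|//]]] lti] _; [move: P0|move: P1|move: P2];
 by congr P; apply: val_inj.
Qed.

Lemma ord2P (P : 'I_2 -> Prop) : P j0 -> P j1 -> forall i, P i.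
Proof.
move=> P0 P1 i; case: i => [[|[|//]] lti]; [move: P0|move: P1];
 by congr P; apply: val_inj.
Qed.

Lemma poly_sum_coef (K : fieldType) n (q : {poly K}) : (size q <= n)%N ->
  q = \sum_(k < n) q`_k *: 'X^k.
Proof.
move=> sq; rewrite -poly_def; apply/polyP => i; rewrite coef_poly.
by have [//|ge] := ltnP i n; rewrite nth_default //; apply: leq_trans ge.
Qed.

Section Dehomogenization.
Variable K : fieldType.
Implicit Types (p : {mpoly K[2]}).

Definition hat p : {poly K} := ev (fun i : 'I_2 => if i == j0 then 'X else 1) p.
HB.instance Definition _ := GRing.RMorphism.copy hat hat.

Lemma hatZ c p : hat (c *: p) = c *: hat p. Proof. exact: evZ. Qed.
Lemma hatXU i : hat 'X_i = if i == j0 then 'X else 1. Proof. exact: evXU. Qed.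

Lemma hatX m : hat 'X_[m] = 'X^(m j0).
Proof. by rewrite /hat evX prod_ord2 /= expr1n mulr1. Qed.

(** No coefficient is lost when the second variable is set to 1, since the degree
    determines the other exponent. *)
Lemma hat_coef n p m : p \is n.-homog -> mdeg m = n -> (hat p)`_(m j0) = p@_m.
Proof.
move=> hp mn; elim/dhomog_ind: p / hp => [|c p q Hp Hq|m' m'n].
- by rewrite rmorph0 coef0 mcoeff0.
- by rewrite rmorphD /= /hat evZ coefD coefZ mcoeffD mcoeffZ -Hp -Hq.
- rewrite hatX coefXn mcoeffX; congr (nat_of_bool _)%:R.
  apply/eqP/eqP => [e|-> //]; apply/mnmP; apply: ord2P => //.
  by move: mn m'n e; rewrite !mdegE !sum_ord2; lia.
Qed.

Lemma hat_inj n p : p \is n.-homog -> hat p = 0 -> p = 0.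
Proof.
move=> hp hp0; apply/mpolyP => m; rewrite mcoeff0.
have [mn|mn] := eqVneq (mdeg m) n; last exact: dhomog_nemf_coeff hp mn.
by rewrite -(hat_coef hp mn) hp0 coef0.
Qed.

Lemma size_hat n p : p \is n.-homog -> (size (hat p) <= n.+1)%N.
Proof.
move=> hp; have := size_ev (k := 1) _ hp; rewrite muln1; apply=> i.
by case: ifP; rewrite ?size_polyX ?size_poly1.
Qed.

Lemma hat_surj n (q : {poly K}) : (size q <= n.+1)%N ->
  exists2 p, p \is n.-homog & hat p = q.
Proof.
move=> sq; exists (\sum_(k < n.+1) q`_k *: ('X_j0 ^+ k * 'X_j1 ^+ (n - k))).
  apply: rpred_sum => k _; apply: rpredZ.
  have := dhomogM (homogXn K j0 k) (homogXn K j1 (n - k)).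
  by rewrite subnKC ?leq_ord.
rewrite {2}(poly_sum_coef sq) rmorph_sum /=; apply: eq_bigr => k _.
by rewrite /hat evZ rmorphM !rmorphXn /= !evXU /= expr1n mulr1.
Qed.

Lemma hat_mderiv0 p : hat p^`M(j0) = (hat p)^`().
Proof. by rewrite /hat deriv_ev sum_ord2 /= derivX derivC mulr0 addr0 mulr1. Qed.

(** Euler's relation expresses the derivative in the second variable. *)
Lemma hat_mderiv1 n p : p \is n.-homog ->
  hat p^`M(j1) = n%:R *: hat p - 'X * (hat p)^`().
Proof.
move=> hp; rewrite -hat_mderiv0 -hatZ -(euler hp) sum_ord2 rmorphD !rmorphM /=.
by rewrite !hatXU /= mul1r addrAC subrr add0r.
Qed.

Lemma horner_hat p x : (hat p).[x] = p.@[fun i => if i == j0 then x else 1].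
Proof.
rewrite horner_ev; apply: meval_eq => i.
by case: ifP; rewrite ?hornerX ?hornerC.
Qed.

End Dehomogenization.

Section Restriction.
Variables (K : fieldType) (al be : K).
Implicit Types (p : {mpoly K[3]}).

Definition line : {mpoly K[3]} := 'X_i2 - al *: 'X_i0 - be *: 'X_i1.

(** Restriction to the line, in its affine coordinate X = x/y. *)
Definition rho p : {poly K} :=
  ev (fun i : 'I_3 => [tuple 'X; 1; al *: 'X + be%:P]`_i) p.
HB.instance Definition _ := GRing.RMorphism.copy rho rho.

Lemma rhoZ c p : rho (c *: p) = c *: rho p. Proof. exact: evZ. Qed.
Lemma rhoX0 : rho 'X_i0 = 'X. Proof. exact: evXU. Qed.
Lemma rhoX1 : rho 'X_i1 = 1. Proof. exact: evXU. Qed.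
Lemma rhoX2 : rho 'X_i2 = al *: 'X + be%:P. Proof. exact: evXU. Qed.
Lemma rho_line : rho line = 0.
Proof.
by rewrite /line !rmorphB /= !rhoZ rhoX0 rhoX1 rhoX2 alg_polyC addrAC addrK subrr.
Qed.

Lemma line_homog : line \is 1.-homog.
Proof. by rewrite /line !rpredB ?rpredZ // dhomogX /= mdeg1. Qed.

Lemma line_neq0 : line != 0.
Proof.
apply/eqP => /(congr1 (mcoeff U_(i2)%MM)); rewrite mcoeff0 !mcoeffB !mcoeffZ !mcoeffXU.
by rewrite eqxx !mulr0 !subr0 => /eqP; rewrite oner_eq0.
Qed.

Lemma size_rho m p : p \is m.-homog -> (size (rho p) <= m.+1)%N.
Proof.
move=> hp; have := size_ev (k := 1) _ hp; rewrite muln1; apply.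
apply: ord3P; rewrite /= ?size_polyX ?size_poly1 //.
apply: leq_trans (size_polyD _ _) _; rewrite geq_max size_polyC.
by rewrite (leq_trans (size_scale_leq _ _)) ?size_polyX //; case: (be == 0).
Qed.

Lemma rho_surj m (q : {poly K}) : (size q <= m.+1)%N ->
  exists2 p, p \is m.-homog & rho p = q.
Proof.
move=> sq; exists (\sum_(k < m.+1) q`_k *: ('X_i0 ^+ k * 'X_i1 ^+ (m - k))).
  apply: rpred_sum => k _; apply: rpredZ.
  have := dhomogM (homogXn K i0 k) (homogXn K i1 (m - k)).
  by rewrite subnKC ?leq_ord.
rewrite {2}(poly_sum_coef sq) rmorph_sum /=; apply: eq_bigr => k _.
by rewrite rhoZ rmorphM !rmorphXn /= rhoX0 rhoX1 expr1n mulr1.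
Qed.

(** Dividing by the equation of the line leaves the substitution
    z = al x + be y. *)
Lemma mod_line p : exists h : {mpoly K[3]}, p = h * line +
  ((p \mPo [tuple 'X_j0; 'X_j1; al *: 'X_j0 + be *: 'X_j1 : {mpoly K[2]}])
     \mPo [tuple 'X_i0; 'X_i1]).
Proof.
elim/mpoly_alg_ind: p => [c|i|p q [h {1}->] [k {1}->]|p q [h {1}->] [k {1}->]].
- by exists 0; rewrite !comp_mpolyC mul0r add0r.
- move: i; apply: ord3P.
  + by exists 0; rewrite mul0r add0r; do 2 rewrite ?comp_mpolyXU /=.
  + by exists 0; rewrite mul0r add0r; do 2 rewrite ?comp_mpolyXU /=.
  + exists 1; rewrite mul1r comp_mpolyXU /= comp_mpolyD !comp_mpolyZ !comp_mpolyXU /=.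
    by rewrite /line -!mul_mpolyC; ring.
- by exists (h + k); rewrite !comp_mpolyD; ring.
- set p' := (p \mPo _) \mPo _; set q' := (q \mPo _) \mPo _.
  have -> : ((p * q) \mPo [tuple 'X_j0; 'X_j1; al *: 'X_j0 + be *: 'X_j1])
     \mPo [tuple 'X_i0; 'X_i1] = p' * q'.
    by rewrite -[RHS]rmorphM /=; congr (_ \mPo _); rewrite -[RHS]rmorphM.
  by exists (h * k * line + h * q' + p' * k); ring.
Qed.

Lemma rho_ker_any p m : p \is m.-homog -> rho p = 0 -> exists h, p = h * line.
Proof.
move=> hp rp; have [h ->] := mod_line p; exists h.
rewrite [X in X \mPo [tuple 'X_i0; 'X_i1]](_ : _ = 0) ?rmorph0 ?addr0 //.
have h1 (j : 'I_2) : ('X_j : {mpoly K[2]}) \is 1.-homog by rewrite dhomogX /= mdeg1.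
apply: (@hat_inj _ (m * 1)).
  apply: comp_homog hp; apply: ord3P; rewrite (tnth_nth 0) //=.
  by rewrite rpredD // rpredZ.
rewrite -rp /hat ev_comp /rho; apply: ev_ext; apply: ord3P => /=.
- by rewrite (tnth_nth 0) evXU.
- by rewrite (tnth_nth 0) evXU.
- by rewrite (tnth_nth 0) /= rmorphD /= !evZ !evXU /= alg_polyC.
Qed.

Lemma rho_ker0 p : p \is 0.-homog -> rho p = 0 -> p = 0.
Proof.
move=> hp rp; have [h e] := rho_ker_any hp rp.
exact: homog_quotient_small line_homog hp isT e.
Qed.

(** This division by the equation of the line is what inductions on the degree
    rest on. *)
Lemma rho_kerS m p : p \is m.+1.-homog -> rho p = 0 ->
  exists2 h, h \is m.-homog & p = h * line.
Proof.
move=> hp rp; have [h e] := rho_ker_any hp rp.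
by apply: homog_quotient line_homog _ e; rewrite addn1.
Qed.

End Restriction.

(** * Lagrange interpolation, and syzygies of a squarefree binary form *)

Section Interpolation.
Variables (K : fieldType) (d : nat) (x : 'I_d -> K).
Hypothesis x_inj : injective x.

Lemma poly_zero_at (p : {poly K}) :
  (size p <= d)%N -> (forall i, p.[x i] = 0) -> p = 0.
Proof.
move=> sp px; apply: (@roots_geq_poly_eq0 _ p [seq x i | i <- enum 'I_d]).
- by apply/allP => _ /mapP[i _ ->]; apply/rootP.
- by rewrite map_inj_uniq ?enum_uniq.
- by rewrite size_map size_enum_ord.
Qed.

Lemma poly_eq_at (p q : {poly K}) : (size p <= d)%N -> (size q <= d)%N ->
  (forall i, p.[x i] = q.[x i]) -> p = q.
Proof.
move=> sp sq pq; apply/eqP; rewrite -subr_eq0; apply/eqP/poly_zero_at.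
  by apply: leq_trans (size_polyD _ _) _; rewrite size_polyN geq_max sp.
by move=> i; rewrite hornerD hornerN pq subrr.
Qed.

Definition lag i : {poly K} :=
  \prod_(j | j != i) ((x i - x j)^-1 *: ('X - (x j)%:P)).

Lemma lag_at i j : (lag i).[x j] = (i == j)%:R.
Proof.
rewrite /lag horner_prod; have [<-|ij] := eqVneq i j.
  rewrite big1 // => k ki; rewrite hornerZ hornerXsubC mulVf // subr_eq0.
  by apply: contra ki => /eqP/x_inj->.
by rewrite (bigD1 j) 1?eq_sym //= hornerZ hornerXsubC subrr mulr0 mul0r.
Qed.

Lemma size_lag i : (size (lag i) <= d)%N.
Proof.
have d0 : (0 < d)%N by case: (d) i => [[]|//].
suff : (size (lag i) <= (\sum_(j < d | j != i) 1).+1)%N.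
  by rewrite sum1_card cardC1 card_ord prednK.
rewrite /lag; elim/big_rec2: _ => [|j a q _ Hq]; first by rewrite size_poly1.
apply: size_mul_leS => //; apply: leq_trans (size_scale_leq _ _) _.
by rewrite size_XsubC.
Qed.

Lemma size_sum_leq I (r : seq I) (p : I -> {poly K}) n :
  (forall i, (size (p i) <= n)%N) -> (size (\sum_(i <- r) p i)%R <= n)%N.
Proof.
move=> H; elim/big_ind: _ => [|s t Hs Ht|//]; first by rewrite size_poly0.
by apply: leq_trans (size_polyD _ _) _; rewrite geq_max Hs.
Qed.

Lemma sum_lag (c : 'I_d -> K) i : (\sum_j c j *: lag j).[x i] = c i.
Proof.
rewrite horner_sum (bigD1 i) //= hornerZ lag_at eqxx mulr1 big1 ?addr0 // => j ji.
by rewrite hornerZ lag_at (negbTE ji) mulr0.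
Qed.

Lemma lag_interpolation (p : {poly K}) : (size p <= d)%N ->
  \sum_j p.[x j] *: lag j = p.
Proof.
move=> sp; apply: poly_eq_at => // [|i]; last by rewrite sum_lag.
by apply: size_sum_leq => i; apply: leq_trans (size_scale_leq _ _) (size_lag i).
Qed.

(** The difference has d roots, and degree less than d since the leading
    coefficients agree. *)
Lemma poly_split_at (p : {poly K}) : (size p <= d.+1)%N ->
  (forall i, p.[x i] = 0) -> p = p`_d *: \prod_i ('X - (x i)%:P).
Proof.
move=> sp px; set P := \prod_i _.
have mP : P \is monic by apply: monic_prod => i _; apply: monicXsubC.
have sP : size P = d.+1 by rewrite size_prod_XsubC /index_enum -enumT size_enum_ord.
apply/eqP; rewrite -subr_eq0; apply/eqP/poly_zero_at => [|i].
  rewrite leqNgt; apply/negP => lt.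
  have : (size (p - p`_d *: P)%R <= d.+1)%N.
    apply: leq_trans (size_polyD _ _) _; rewrite size_polyN geq_max sp.
    by rewrite (leq_trans (size_scale_leq _ _)) ?sP.
  move: lt => /[swap] le lt.
  have /eqP sE : size (p - p`_d *: P)%R == d.+1 by rewrite eqn_leq le.
  have : lead_coef (p - p`_d *: P) = 0.
    rewrite /lead_coef sE /= coefB coefZ.
    by move/monicP: mP; rewrite /lead_coef sP /= => ->; rewrite mulr1 subrr.
  by move/eqP; rewrite lead_coef_eq0 => /eqP e; rewrite e size_poly0 in lt.
rewrite hornerD hornerN hornerZ px /P horner_prod (bigD1 i) //=.
by rewrite hornerXsubC subrr mul0r mulr0 subr0.
Qed.

End Interpolation.

Section BinaryForms.
Variable K : numFieldType.
Implicit Types (p q P a b : {poly K}).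

Lemma natr_unit n : (0 < n)%N -> n%:R != 0 :> K.
Proof. by rewrite pnatr_eq0 -lt0n. Qed.

Lemma size_derivS P d : size P = d.+1 -> size P^`() = d.
Proof.
move=> sP; case: d sP => [|d] sP.
  by rewrite (size1_polyC (eq_leq sP)) derivC size_poly0.
apply/eqP; rewrite eqn_leq; apply/andP; split.
  by rewrite -ltnS -sP lt_size_deriv // -size_poly_gt0 sP.
suff : P^`()`_d != 0 by apply: contraR; rewrite -leqNgt => le; rewrite nth_default.
rewrite coef_deriv -mulr_natr mulf_neq0 ?natr_unit //.
by have := lead_coef_eq0 P; rewrite /lead_coef sP /= => ->; rewrite -size_poly_gt0 sP.
Qed.

(** For a binary form of degree d whose dehomogenization is P, this is the
    dehomogenization of the derivative in the second variable. *)
Definition ypart d P := d%:R *: P - 'X * P^`().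

Lemma size_ypart P d : (size P <= d.+1)%N -> (size (ypart d P) <= d)%N.
Proof.
move=> sP; apply/leq_sizeP => j dj; rewrite /ypart coefB coefZ coefXM.
case: j dj => [|j] dj.
  by move: dj; rewrite leqn0 => /eqP ->; rewrite mul0r subrr.
rewrite /= coef_deriv; have [e|ne] := eqVneq d j.+1.
  by rewrite e mulr_natl subrr.
by rewrite nth_default ?mul0rn ?mulr0 ?subrr //; apply: leq_trans sP _; lia.
Qed.

(** Both derivatives of a squarefree binary form are coprime, so their syzygies
    are multiples of the obvious one. In one variable this is Gauss's lemma
    applied to (a - X b) P' = - d b P, with control of the degrees. *)
Lemma coprime_syzygy P d a b e : (0 < d)%N -> size P = d.+1 -> coprimep P P^`() ->
  (size a <= e.+1)%N -> (size b <= e.+1)%N -> a * P^`() + b * ypart d P = 0 ->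
  exists k, [/\ a = k * ypart d P, b = - (k * P^`()) &
              k != 0 -> (size k + d <= e.+2)%N].
Proof.
move=> d0 sP cP sa sb eq0; have d1 := natr_unit d0.
have sP' := size_derivS sP.
have P'0 : P^`() != 0 by rewrite -size_poly_gt0 sP'.
have E1 : (a - 'X * b) * P^`() = - (d%:R *: b) * P.
  apply/eqP; rewrite -subr_eq0; apply/eqP; rewrite -[RHS]eq0 /ypart -!mul_polyC; ring.
have /dvdpP [k Hk] : P %| a - 'X * b.
  by rewrite -(Gauss_dvdpl _ cP) E1 dvdp_mull.
have P0 : P != 0 by rewrite -size_poly_gt0 sP.
have Eb : - (d%:R *: b) = k * P^`().
  apply: (mulIf P0); rewrite -E1 Hk; ring.
pose k' := d%:R^-1 *: k; have Ek : k = d%:R%:P * k'.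
  by rewrite mul_polyC scalerA divff // scale1r.
have Eb' : b = - (k' * P^`()).
  by rewrite -scalerAl -Eb scalerN scalerA mulVf // scale1r opprK.
exists k'; split=> //.
  rewrite -[a](subrK ('X * b)) Hk Eb' Ek /ypart -!mul_polyC; ring.
move=> k0; have : size b = size (k' * P^`()) by rewrite Eb' size_polyN.
rewrite size_mul // sP'; move: sb; move: (size b) (size k') => s t; lia.
Qed.

(** Two coprime binary forms of degree d-1 generate all forms of degree m as soon
    as m >= 2d-3; the degree bounds follow from reducing the first coefficient
    modulo P. *)
Lemma coprime_span P d p m : (1 < d)%N -> size P = d.+1 -> coprimep P P^`() ->
  (2 * d - 3 <= m)%N -> (size p <= m.+1)%N ->
  exists a b, [/\ (size a <= m + 2 - d)%N, (size b <= m + 2 - d)%N &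
     p = a * P^`() + b * ypart d P].
Proof.
move=> d1 sP cP dm sp; have d0 : (0 < d)%N by lia.
have d2 := natr_unit d0; have sP' := size_derivS sP.
have P'0 : P^`() != 0 by rewrite -size_poly_gt0 sP'.
have P0 : P != 0 by rewrite -size_poly_gt0 sP.
have /Bezout_eq1_coprimepP [[u v] /= uv] := cP.
have [A [sA /dvdpP [b0 Hb]]] : exists A : {poly K}, (size A <= d)%N /\ P %| p - A * P^`().
  exists ((v * p) %% P); split; first by rewrite -ltnS -sP ltn_modp.
  have -> : (v * p) %% P = v * p - (v * p) %/ P * P.
    by rewrite [X in X - _](divp_eq (v * p) P) addrC addKr.
  apply/dvdpP; exists (u * p + (v * p) %/ P * P^`()).
  rewrite -{1}[p]mul1r -uv; ring.
have sb : (size b0 + d <= maxn m.+1 (d + d).-1)%N \/ b0 = 0.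
  have [->|b00] := eqVneq b0 0; first by right.
  left; have : size (b0 * P) = (size b0 + d)%N by rewrite size_mul // sP addnS.
  rewrite -Hb => <-; apply: leq_trans (size_polyD _ _) _; rewrite size_polyN.
  rewrite geq_max !leq_max sp /=; apply/orP; right.
  by apply: leq_trans (poly.size_polyMleq _ _) _; rewrite sP'; lia.
pose b := d%:R^-1 *: b0; pose a := A + 'X * b.
have E : p = a * P^`() + b * ypart d P.
  apply/eqP; rewrite -subr_eq0; apply/eqP.
  have -> : p = b0 * P + A * P^`() by rewrite -Hb subrK.
  have -> : b0 = d%:R%:P * b by rewrite /b mul_polyC scalerA divff // scale1r.
  rewrite /a /ypart -!mul_polyC; ring.
have sb1 : (size b <= m + 2 - d)%N.
  rewrite /b; case: sb => [sb|->]; last by rewrite scaler0 size_poly0.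
  by apply: leq_trans (size_scale_leq _ _) _; move: sb; move: (size b0) => s; lia.
exists a, b; split=> //.
have [->|a0] := eqVneq a 0; first by rewrite size_poly0.
have sa : size (a * P^`()) = (size a + d).-1 by rewrite size_mul // sP'.
have : (size (a * P^`())%R <= m.+1)%N.
  have -> : a * P^`() = p - b * ypart d P by rewrite [X in X - _]E addrK.
  apply: leq_trans (size_polyD _ _) _; rewrite size_polyN geq_max sp /=.
  apply: leq_trans (poly.size_polyMleq _ _) _.
  have := @size_ypart P d; rewrite sP leqnn => /(_ isT).
  by move: sb1; move: (size b) (size (ypart d P)) => s t; lia.
by rewrite sa; move: a0; rewrite -size_poly_gt0; move: (size a) => s; lia.
Qed.

Lemma coefM_top (u v : {poly K}) n k : (size u <= n.+1)%N -> (size v <= k.+1)%N ->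
  (u * v)`_(n + k) = u`_n * v`_k.
Proof.
move=> un vk; have nk : (n < (n + k).+1)%N by lia.
rewrite coefM (bigD1 (Ordinal nk)) //= addKn big1 ?addr0 // => j jn.
have [lt|gt|e] := ltngtP j n.
- by rewrite [v`__]nth_default ?mulr0 //; apply: leq_trans vk _; lia.
- by rewrite nth_default ?mul0r //; apply: leq_trans un _; lia.
- by case/eqP: jn; apply: val_inj; rewrite /= e.
Qed.

(** In characteristic 0 the top coefficient of p'q - pq' is
    (deg p - deg q) times the product of the leading coefficients. *)
Lemma wronskian_size p q : p != 0 -> q != 0 -> p^`() * q = p * q^`() -> size p = size q.
Proof.
move=> p0 q0 pq.
have [n sp] : exists n, size p = n.+1 by exists (size p).-1; rewrite prednK ?size_poly_gt0.
have [k sq] : exists k, size q = k.+1 by exists (size q).-1; rewrite prednK ?size_poly_gt0.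
have lp : p`_n != 0 by have := lead_coef_eq0 p; rewrite /lead_coef sp /= => ->.
have lq : q`_k != 0 by have := lead_coef_eq0 q; rewrite /lead_coef sq /= => ->.
case: n k sp lp sq lq => [|n] [|k] sp lp sq lq; rewrite ?sp ?sq //.
- move: pq; rewrite (size1_polyC (eq_leq sp)) derivC mul0r => /esym/eqP.
  rewrite mulf_eq0 -(size1_polyC (eq_leq sp)) (negbTE p0) /= -size_poly_eq0.
  by rewrite (size_derivS sq).
- move: pq; rewrite (size1_polyC (eq_leq sq)) derivC mulr0 => /eqP.
  rewrite mulf_eq0 -(size1_polyC (eq_leq sq)) (negbTE q0) orbF -size_poly_eq0.
  by rewrite (size_derivS sp).
have := congr1 (fun u : {poly K} => u`_(n + k.+1)) pq.
rewrite /= coefM_top ?sq ?(size_derivS sp) // -addSnnS coefM_top ?sp ?(size_derivS sq) //.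
rewrite !coef_deriv mulrnAl mulrnAr -[LHS]mulr_natr -[RHS]mulr_natr.
have a0 : p`_n.+1 * q`_k.+1 != 0 by rewrite mulf_neq0.
by move/(mulfI a0)/eqP; rewrite eqr_nat => /eqP [->].
Qed.

(** Subtract from p the multiple of q that kills the coefficient of degree deg q.
    The difference satisfies the same relation, and if it were nonzero it would
    have the same degree as q, by [wronskian_size]. *)
Lemma wronskian_proportional p q : p^`() * q = p * q^`() ->
  exists l m, [/\ (l != 0) || (m != 0) & l *: p + m *: q = 0].
Proof.
have [->|q0] := eqVneq q 0.
  by exists 0, 1; rewrite oner_eq0 orbT scale0r scaler0 addr0.
move=> W; pose c := p`_(size q).-1 / lead_coef q; pose r : {poly K} := p - c *: q.
have lq0 : lead_coef q != 0 by rewrite lead_coef_eq0.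
exists 1, (- c); rewrite oner_eq0 scale1r scaleNr; split=> //.
apply/eqP; apply: contraT; rewrite -/r => r0.
have Wr : r^`() * q = r * q^`().
  rewrite /r derivB derivZ -!mul_polyC; move/eqP: W; rewrite -subr_eq0 => /eqP W.
  by apply/eqP; rewrite -subr_eq0 -W; apply/eqP; ring.
have srq := wronskian_size r0 q0 Wr.
have : lead_coef r = 0.
  rewrite /lead_coef srq /r coefB coefZ /c -/(lead_coef q) divfK //.
  by rewrite subrr.
by move/eqP; rewrite lead_coef_eq0 (negbTE r0).
Qed.

End BinaryForms.

(** * A general line meets the curve in d simple points *)

Section Pencil.
Variable K : numClosedFieldType.
Implicit Types (A B E : {poly K}).

(** The forbidden values of b are the roots of one nonzero polynomial. *)
Lemma avoid_pairs (s : seq (K * K)) :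
  (forall w, w \in s -> (w.1 != 0) || (w.2 != 0)) ->
  exists b, forall w, w \in s -> w.1 - b * w.2 != 0.
Proof.
move=> Hs; pose P := \prod_(w <- s) (w.1%:P - w.2 *: 'X).
have P0 : P != 0.
  rewrite /P prodf_seq_neq0; apply/allP => w /Hs w0 /=; apply/eqP => e.
  have e0 : (w.1%:P - w.2 *: 'X)`_0 = 0 by rewrite e coef0.
  have e1 : (w.1%:P - w.2 *: 'X)`_1 = 0 by rewrite e coef0.
  move: e0 e1; rewrite !coefB !coefC !coefZ !coefX /= mulr0 mulr1 subr0 sub0r => w1 /eqP.
  by rewrite oppr_eq0 => /eqP w2; move: w0; rewrite w1 w2 eqxx.
have /closed_nonrootP [b] := P0; rewrite rootE /P horner_prod prodf_seq_neq0 => /allP Pb.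
by exists b => w /Pb; rewrite hornerD hornerN hornerZ hornerX hornerC mulrC.
Qed.

Lemma root_list E : E != 0 -> exists rs : seq K, forall u, E.[u] = 0 -> u \in rs.
Proof.
move=> E0; have [rs Ers] := closed_field_poly_normal E; exists rs => u /rootP.
by rewrite Ers rootZ ?lead_coef_eq0 // root_prod_XsubC.
Qed.

(** Otherwise the two polynomials would be proportional, and a root of one would
    be a root of the other. *)
Lemma wronskian_neq0 d A B : (0 < d)%N -> (size A <= d.+1)%N -> (size B <= d.+1)%N ->
  (forall u, A.[u] = 0 -> B.[u] != 0) -> (A`_d != 0) || (B`_d != 0) ->
  A^`() * B - A * B^`() != 0.
Proof.
move=> d0 sA sB AB lead; rewrite subr_eq0; apply/eqP => /wronskian_proportional.
case=> l [m [lm e]].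
have cst u : (l * A.[u] + m * B.[u]) = 0.
  by have := congr1 (fun p : {poly K} => p.[u]) e; rewrite /= hornerD !hornerZ horner0.
have cstd : l * A`_d + m * B`_d = 0.
  by have := congr1 (fun p : {poly K} => p`_d) e; rewrite /= coefD !coefZ coef0.
have norootA (C : {poly K}) : C`_d != 0 -> exists u, C.[u] = 0.
  move=> Cd; have /closed_rootP [u /rootP Cu] : size C != 1.
    apply/eqP => s1; move: Cd; by rewrite nth_default ?eqxx // s1.
  by exists u.
have [l0|l0] := eqVneq l 0.
  move: lm cstd cst; rewrite l0 eqxx /= => m0; rewrite mul0r add0r => /eqP.
  rewrite mulf_eq0 (negbTE m0) /= => /eqP Bd; move: lead; rewrite Bd eqxx orbF.
  move=> /norootA [u Au] /(_ u) /eqP; rewrite Au mulr0 add0r mulf_eq0 (negbTE m0) /=.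
  by rewrite (negbTE (AB u Au)).
have Bd : B`_d != 0.
  apply/eqP => Bd; move: cstd lead; rewrite Bd mulr0 addr0 eqxx orbF => /eqP.
  by rewrite mulf_eq0 (negbTE l0) /= => ->.
have [u Bu] := norootA _ Bd; move/eqP: (cst u); rewrite Bu mulr0 addr0.
rewrite mulf_eq0 (negbTE l0) /= => /eqP Au.
by have := AB u Au; rewrite Bu eqxx.
Qed.

(** Bertini for a pencil without base points, also at infinity. At a multiple root
    of A - b B the Wronskian of A and B vanishes; so it suffices to choose b such
    that A - b B has no root among the finitely many roots of E times the
    Wronskian, and keeps its degree. *)
Lemma pencil_simple_roots d A B E : (0 < d)%N -> (size A <= d.+1)%N -> (size B <= d.+1)%N ->
  (forall u, A.[u] = 0 -> B.[u] != 0) -> (A`_d != 0) || (B`_d != 0) -> E != 0 ->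
  exists b (x : 'I_d -> K), [/\ injective x, (A - b *: B)`_d != 0,
    forall i, (A - b *: B).[x i] = 0 & forall i, E.[x i] != 0].
Proof.
move=> d0 sA sB AB lead E0; have W0 := wronskian_neq0 d0 sA sB AB lead.
set W := _ - _ in W0.
have [rs rsP] := root_list (mulf_neq0 E0 W0).
have [|b Hb] := @avoid_pairs ((A`_d, B`_d) :: [seq (A.[u], B.[u]) | u <- rs]).
  move=> w; rewrite inE => /orP[/eqP -> //|/mapP[u _ ->]] /=.
  by have [/AB ->|//] := eqVneq A.[u] 0; rewrite orbT.
exists b; pose g := A - b *: B; rewrite -/g.
have gE u : g.[u] = A.[u] - b * B.[u] by rewrite /g hornerD hornerN hornerZ.
(* This first pair of leading coefficients keeps the roots away from infinity. *)
have gd : g`_d != 0 by rewrite /g coefB coefZ (Hb (_, _)) ?mem_head.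
have sg : size g = d.+1.
  apply/eqP; rewrite eqn_leq; apply/andP; split.
    apply: leq_trans (size_polyD _ _) _; rewrite size_polyN geq_max sA /=.
    exact: leq_trans (size_scale_leq _ _) sB.
  by apply: contraR gd; rewrite -leqNgt => le; rewrite nth_default.
have EW u : g.[u] = 0 -> E.[u] != 0 /\ g^`().[u] != 0.
  move=> gu; have nz : (E * W).[u] != 0.
    apply/eqP => /rsP urs; have : (A.[u], B.[u]) \in (A`_d, B`_d) :: [seq (A.[u], B.[u]) | u <- rs].
      by rewrite inE; apply/orP; right; apply: map_f.
    by move/Hb; rewrite /= -gE gu eqxx.
  move: nz; rewrite hornerM mulf_eq0 negb_or => /andP[-> Wu]; split=> //.
  apply: contra Wu => /eqP g'u.
  have -> : W = g^`() * B - g * B^`() by rewrite /W /g derivB derivZ -!mul_polyC; ring.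
  by rewrite hornerD hornerN !hornerM gu g'u !mul0r subrr.
have [s gs] := closed_field_poly_normal g.
have lg : lead_coef g != 0 by rewrite lead_coef_eq0 -size_poly_gt0 sg.
have ss : size s = d.
  by apply/eqP; rewrite -eqSS -sg gs size_scale // size_prod_XsubC.
have us : uniq s.
  rewrite -separable_prod_XsubC -(eqp_separable (eqp_scale _ lg)) -gs.
  rewrite unlock; apply: Pdiv.ClosedField.root_coprimep => u /rootP gu.
  by case: (EW u gu).
have g0 i : g.[nth 0 s i] = 0 \/ (size s <= i)%N.
  have [lt|ge] := ltnP i (size s); [left|by right].
  by apply/rootP; rewrite gs rootZ // root_prod_XsubC mem_nth.
exists (fun i : 'I_d => nth 0 s i); split=> //.
- by move=> i j /eqP; rewrite nth_uniq ?ss // => /eqP/val_inj.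
- by move=> i; case: (g0 i) => //; rewrite ss leqNgt ltn_ord.
- by move=> i; case: (g0 i) => [/EW[]//|]; rewrite ss leqNgt ltn_ord.
Qed.

End Pencil.

Section GoodLine.
Variables (K : numClosedFieldType) (d : nat) (f : 3.-tuple {mpoly K[2]}).
Hypotheses (hd : (1 < d)%N) (hf : forall i : 'I_3, tnth f i \is d.-homog).
Hypotheses (hgcd : gcd_is_1 f) (hgen : generically_1to1 f).

Definition fhat i : {poly K} := hat (tnth f i).

Lemma size_fhat i : (size (fhat i) <= d.+1)%N.
Proof. exact: size_hat (hf i). Qed.

(** A common root u would make X - u Y a common factor of the three forms. *)
Lemma no_base_point u : exists i, (fhat i).[u] != 0.
Proof.
apply: contrapT => /forallNP H.
have {H} H i : (fhat i).[u] = 0 by apply/eqP; apply: contrapT => /negP; apply: H.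
pose g : {mpoly K[2]} := 'X_j0 - u *: 'X_j1.
have gh : g \is 1.-homog by rewrite /g rpredB ?rpredZ // homogX1.
have hg : hat g = 'X - u%:P by rewrite rmorphB /= hatZ !hatXU /= alg_polyC.
have /unitrP [g' [_ gg']] : g \is a GRing.unit.
  apply: hgcd => i; have /factor_theorem [q Hq] : root (fhat i) u by apply/rootP.
  have sq : (size q <= d.-1.+1)%N.
    have := size_fhat i; rewrite Hq; have [->|q0] := eqVneq q 0; first by rewrite size_poly0.
    by rewrite size_Mmonic ?monicXsubC // size_XsubC; move: (size q) hd => s; lia.
  have [q' hq' eq'] := hat_surj sq; exists q'.
  have hM : q' * g \is d.-homog.
    by have := dhomogM hq' gh; rewrite addn1 prednK ?(ltnW hd).
  apply/eqP; rewrite -subr_eq0; apply/eqP/(@hat_inj _ d); first exact: rpredB (hf i) hM.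
  by rewrite rmorphB rmorphM /= hg eq' -/(fhat i) Hq subrr.
have := congr1 (fun p => (hat p).[u]) gg'; rewrite /= rmorphM /= hg hornerM hornerXsubC.
by rewrite subrr mul0r rmorph1 hornerC => /esym/eqP; rewrite oner_eq0.
Qed.

Lemma no_base_point_infinity : exists i, (fhat i)`_d != 0.
Proof.
apply: contrapT => /forallNP H.
have {H} H i : (fhat i)`_d = 0 by apply/eqP; apply: contrapT => /negP; apply: H.
have /unitrP [g' [_ gg']] : ('X_j1 : {mpoly K[2]}) \is a GRing.unit.
  apply: hgcd => i.
  have sq : (size (fhat i) <= d.-1.+1)%N.
    rewrite (prednK (ltnW hd)); apply/leq_sizeP => j; rewrite leq_eqVlt => /orP[/eqP<-//|dj].
    by rewrite nth_default //; apply: leq_trans (size_fhat i) _.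
  have [q' hq' eq'] := hat_surj sq; exists q'.
  have hM : q' * 'X_j1 \is d.-homog.
    by have := dhomogM hq' (homogX1 K j1); rewrite addn1 prednK ?(ltnW hd).
  apply/eqP; rewrite -subr_eq0; apply/eqP/(@hat_inj _ d); first exact: rpredB (hf i) hM.
  by rewrite rmorphB rmorphM /= hatXU mulr1 eq' subrr.
have := congr1 (fun p : {mpoly K[2]} => p.@[fun i => (i == j0)%:R]) gg'.
by rewrite /= mevalM mevalXU mul0r meval1 => /esym/eqP; rewrite oner_eq0.
Qed.

Definition pt (u : K) : 'rV[K]_2 := \row_i (if i == j0 then u else 1).

Lemma param_pt u i : param f (pt u) 0 i = (fhat i).[u].
Proof.
rewrite mxE /fhat horner_hat; apply: meval_eq => j; by rewrite mxE.
Qed.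

(** E is the dehomogenized pull-back of the form G outside whose zeros the fibres
    are single points. The factor c says that the values at u and v are the same
    point of the projective plane. *)
Lemma generic_injectivity : exists2 E : {poly K}, E != 0 &
  forall u v c, E.[u] != 0 -> c != 0 -> (forall i, (fhat i).[u] = c * (fhat i).[v]) -> u = v.
Proof.
have [k [G [hG [p [[w [w0 [c c0 pw]]] Gp]] Gfib]]] := hgen.
have GfE v : (G \mPo f).@[v] = G.@[fun i => (tnth f i).@[v]] by rewrite comp_mpoly_meval.
exists (hat (G \mPo f)).
  apply/eqP => /(hat_inj (comp_homog hf hG)) Gf0.
  have := GfE (w 0); rewrite Gf0 meval0 => /esym GW.
  move: Gp; rewrite pw (_ : _.@[_] = c ^+ k * G.@[fun i => (tnth f i).@[w 0]]).
    by rewrite GW mulr0 eqxx.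
  by rewrite -(meval_homog _ _ hG); apply: meval_eq => i; rewrite !mxE.
move=> u v c' Eu c'0 uv.
have pt0 z : pt z != 0.
  by apply/eqP => /matrixP/(_ 0 j1); rewrite !mxE /= => /eqP; rewrite oner_eq0.
have fu : in_fiber f (param f (pt u)) (pt u).
  by split=> //; exists 1; rewrite ?oner_eq0 // scale1r.
have fv : in_fiber f (param f (pt u)) (pt v).
  by split=> //; exists c' => //; apply/rowP => i; rewrite [RHS]mxE !param_pt.
have := Gfib (param f (pt u)) (ex_intro _ _ fu).
have -> : G.@[param f (pt u) 0] = (hat (G \mPo f)).[u].
  rewrite horner_hat GfE; apply: meval_eq => i; rewrite mxE; apply: meval_eq => j.
  by rewrite mxE.
move/(_ Eu) => [z [_ Hz]].
have [a a0 ea] := Hz _ fu; have [b b0 eb] := Hz _ fv.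
have e1 : u = a * z 0 j0 by move/rowP/(_ j0): ea; rewrite !mxE.
have e2 : 1 = a * z 0 j1 by move/rowP/(_ j1): ea; rewrite !mxE.
have e3 : v = b * z 0 j0 by move/rowP/(_ j0): eb; rewrite !mxE.
have e4 : 1 = b * z 0 j1 by move/rowP/(_ j1): eb; rewrite !mxE.
have z1 : z 0 j1 != 0 by apply/eqP => z0; move/eqP: e2; rewrite z0 mulr0 oner_eq0.
by rewrite e1 e3; congr (_ * _); apply: (mulIf z1); rewrite -e2 -e4.
Qed.

(** If f1 = 0, the curve is contained in a line, and a general member f2 - b f0 of
    the pencil has d >= 2 distinct roots, all mapped to the point (1 : 0 : b). *)
Lemma fhat1_neq0 : fhat i1 != 0.
Proof.
apply/eqP => f10; have [E E0 Einj] := generic_injectivity.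
have [||b [x [xinj _ xg xE]]] := @pencil_simple_roots K d (fhat i2) (fhat i0) E (ltnW hd)
  (size_fhat i2) (size_fhat i0) _ _ E0.
- move=> u u2; apply/eqP => u0; have [] := no_base_point u; apply: ord3P.
  + by rewrite u0 eqxx.
  + by rewrite f10 horner0 eqxx.
  + by rewrite u2 eqxx.
- have [] := no_base_point_infinity; apply: ord3P => [->||->] //; first by rewrite orbT.
  by rewrite f10 coef0 eqxx.
have xg' i : (fhat i2).[x i] = b * (fhat i0).[x i].
  by have /eqP := xg i; rewrite hornerD hornerN hornerZ subr_eq0 => /eqP.
have nz i : (fhat i0).[x i] != 0.
  apply/eqP => u0; have [] := no_base_point (x i); apply: ord3P.
  + by rewrite u0 eqxx.
  + by rewrite f10 horner0 eqxx.
  + by rewrite xg' u0 mulr0 eqxx.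
have lt0 : (0 < d)%N by lia.
pose a0 := Ordinal lt0; pose a1 := Ordinal hd.
suff /xinj : x a0 = x a1 by move/(congr1 val).
apply: (Einj _ _ ((fhat i0).[x a0] / (fhat i0).[x a1]) (xE _)).
  by rewrite mulf_neq0 ?invr_eq0.
apply: ord3P; first by rewrite divfK.
  by rewrite f10 !horner0 mulr0.
by rewrite !xg' mulrCA divfK.
Qed.

(** First al is chosen such that f2 - al f0 and f1 have no common root, not even
    at infinity; then be comes from the pencil that they span. The roots x i
    are the parameters of the d intersection points, whose affine coordinates
    x/y on the line are the quotients in the last clause; they are distinct
    because the x i avoid the zeros of E in [generic_injectivity]. *)
Lemma good_line_exists : exists (al be : K) (x : 'I_d -> K),
  let g := fhat i2 - al *: fhat i0 - be *: fhat i1 in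
  [/\ injective x, g`_d != 0, forall i, g.[x i] = 0,
      forall i, (fhat i1).[x i] != 0 &
      injective (fun i => (fhat i0).[x i] / (fhat i1).[x i])].
Proof.
have [E E0 Einj] := generic_injectivity.
have [rs rsP] := root_list fhat1_neq0.
have [|al Hal] := @avoid_pairs K
  ((if (fhat i1)`_d == 0 then [:: ((fhat i2)`_d, (fhat i0)`_d)] else [::]) ++
   [seq ((fhat i2).[u], (fhat i0).[u]) | u <- [seq u <- rs | (fhat i1).[u] == 0]]).
  move=> w; rewrite mem_cat => /orP[|/mapP[u + ->]].
    case: ifP => // /eqP l1; rewrite inE => /eqP -> /=.
    have [] := no_base_point_infinity; apply: ord3P => [->||->] //; first by rewrite orbT.
    by rewrite l1 eqxx.
  rewrite mem_filter => /andP[/eqP u1 _] /=.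
  have [] := no_base_point u; apply: ord3P => [->||->] //; first by rewrite orbT.
  by rewrite u1 eqxx.
pose A := fhat i2 - al *: fhat i0.
have sA : (size A <= d.+1)%N.
  apply: leq_trans (size_polyD _ _) _; rewrite size_polyN geq_max size_fhat /=.
  exact: leq_trans (size_scale_leq _ _) (size_fhat _).
have [||b [x [xinj gd xg xE]]] := @pencil_simple_roots K d A (fhat i1) (E * fhat i1) (ltnW hd)
  sA (size_fhat i1) _ _ (mulf_neq0 E0 fhat1_neq0).
- move=> u Au; apply/eqP => u1; move/eqP: Au; apply/negP.
  rewrite hornerD hornerN hornerZ; apply: (Hal (_, _)).
  rewrite mem_cat; apply/orP; right; apply: (map_f (fun u => (_.[u], _.[u]))).
  by rewrite mem_filter u1 eqxx rsP.
- have [l1|] := eqVneq (fhat i1)`_d 0; last by rewrite orbT.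
  rewrite orbF coefB coefZ; apply: (Hal (_, _)).
  by rewrite l1 eqxx mem_cat mem_head.
exists al, b, x; split=> //.
  by move=> i; have := xE i; rewrite hornerM mulf_eq0 negb_or => /andP[].
have nz i : (fhat i1).[x i] != 0.
  by have := xE i; rewrite hornerM mulf_eq0 negb_or => /andP[].
have z2 i : (fhat i2).[x i] = al * (fhat i0).[x i] + b * (fhat i1).[x i].
  have /eqP := xg i; rewrite !(hornerD, hornerN, hornerZ) -addrA -opprD subr_eq0.
  by move/eqP.
move=> i j eij; apply: xinj.
apply: (Einj _ _ ((fhat i1).[x i] / (fhat i1).[x j])).
- by have := xE i; rewrite hornerM mulf_eq0 negb_or => /andP[].
- by rewrite mulf_neq0 ?invr_eq0.
have e0 : (fhat i0).[x i] = (fhat i1).[x i] / (fhat i1).[x j] * (fhat i0).[x j].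
  by rewrite -[LHS](divfK (nz i)) eij; field; rewrite nz.
apply: ord3P => //; first by rewrite divfK.
by rewrite !z2 e0 -{2}[(fhat i1).[x i]](divfK (nz j)); ring.
Qed.

End GoodLine.

(** * Polynomials and vector fields along the curve *)

Section Determinants.
Variable K : fieldType.

Lemma dhomog_prod1 n m (G : 'I_m -> {mpoly K[n]}) :
  (forall i, G i \is 1.-homog) -> \prod_i G i \is m.-homog.
Proof.
move=> hG; have : \prod_i G i \is (\sum_(i < m) 1)%N.-homog.
  elim/big_rec2: _ => [|i a p _ Hp]; first exact: dhomog1.
  exact: dhomogM.
by rewrite sum1_card card_ord.
Qed.

Lemma det_homog n m (A : 'M[{mpoly K[n]}]_m) :
  (forall i j, A i j \is 1.-homog) -> \det A \is m.-homog.
Proof.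
move=> hA; apply: rpred_sum => s _; rewrite mulr_sign.
have H : \prod_i A i (s i) \is m.-homog by apply: dhomog_prod1.
by case: ifP; rewrite ?rpredN.
Qed.

Lemma adj_homog n m (A : 'M[{mpoly K[n]}]_m) i j :
  (forall i j, A i j \is 1.-homog) -> (\adj A) i j \is m.-1.-homog.
Proof.
move=> hA; rewrite mxE /cofactor -signr_odd mulr_sign.
have H : \det (row' j (col' i A)) \is m.-1.-homog.
  by apply: det_homog => k l; rewrite !mxE.
by case: ifP; rewrite ?rpredN.
Qed.

(** When the kernel is a line, it contains all columns of the adjugate; the proof
    covers every rank at once. *)
Lemma adj_kernel (A : idomainType) n (M : 'M[A]_n) (w : 'cV[A]_n) i j k :
  M *m w = 0 -> w k 0 * (\adj M) i j = w i 0 * (\adj M) k j.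
Proof.
move=> Mw; have [->|w0] := eqVneq w 0; first by rewrite !mxE !mul0r.
(* Replacing row j by w_k e_i - w_i e_k keeps w in the kernel, so the
   determinant vanishes; its expansion along that row is the claim. *)
pose M' := \matrix_(a, b) (if a == j then w k 0 * (b == i)%:R - w i 0 * (b == k)%:R else M a b).
have M'w : M' *m w = 0.
  apply/colP => a; rewrite !mxE; case: (eqVneq a j) => [->|aj].
    under eq_bigr do rewrite mxE eqxx mulrBl.
    rewrite sumrB (bigD1 i) //= eqxx big1 => [|b /negbTE ->]; last by rewrite mulr0 mul0r.
    rewrite (bigD1 k) //= eqxx big1 => [|b /negbTE ->]; last by rewrite mulr0 mul0r.
    by rewrite !addr0 !mulr1 mulrC subrr.
  under eq_bigr do rewrite mxE (negbTE aj).
  by have /colP/(_ a) := Mw; rewrite !mxE.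
have detM' : \det M' = 0.
  have [a wa] : exists a, w a 0 != 0.
    apply: contrapT => /forallNP H; move/eqP: w0; apply; apply/colP => a.
    by rewrite mxE; apply/eqP; apply: contrapT => /negP; apply: H.
  have /colP/(_ a) : \adj M' *m M' *m w = 0 by rewrite -mulmxA M'w mulmx0.
  rewrite mul_adj_mx mul_scalar_mx !mxE => /eqP.
  by rewrite mulf_eq0 (negbTE wa) orbF => /eqP.
have cof b : cofactor M' j b = cofactor M j b.
  rewrite /cofactor; congr (_ * \det _); apply/matrixP => a c; rewrite !mxE.
  by rewrite eq_sym (negbTE (neq_lift _ _)).
have := expand_det_row M' j; rewrite detM'.
under eq_bigr do rewrite mxE eqxx cof mulrBl.
rewrite sumrB (bigD1 i) //= eqxx big1 => [|b /negbTE ->]; last by rewrite mulr0 mul0r.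
rewrite (bigD1 k) //= eqxx big1 => [|b /negbTE ->]; last by rewrite mulr0 mul0r.
rewrite !addr0 !mulr1 => /esym/eqP; rewrite subr_eq0 => /eqP.
by rewrite !mxE.
Qed.

End Determinants.

Section CurveOnLine.
Variables (K : numClosedFieldType) (d : nat) (f : 3.-tuple {mpoly K[2]}).
Variables (F : {mpoly K[3]}) (al be : K) (x : 'I_d -> K).
Hypotheses (hd : (1 < d)%N) (hf : forall i : 'I_3, tnth f i \is d.-homog).
Hypotheses (hF : F \is d.-homog) (F0 : F != 0) (Ff : F \mPo f = 0).
Local Notation g := (fhat f i2 - al *: fhat f i0 - be *: fhat f i1).
Hypotheses (x_inj : injective x) (gd : g`_d != 0) (gx : forall i, g.[x i] = 0).
Hypothesis (f1x : forall i, (fhat f i1).[x i] != 0).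
Local Notation y := (fun i => (fhat f i0).[x i] / (fhat f i1).[x i]).
Hypothesis y_inj : injective y.
Local Notation rho := (rho al be).
Local Notation line := (line al be).

(** The dehomogenized pull-back along the parametrization. *)
Definition pull (p : {mpoly K[3]}) : {poly K} := ev (fhat f) p.
HB.instance Definition _ := GRing.RMorphism.copy pull pull.

Lemma pullE p : hat (p \mPo f) = pull p.
Proof. exact: ev_comp. Qed.

Lemma pullZ c p : pull (c *: p) = c *: pull p.
Proof. exact: evZ. Qed.

Lemma pullXU i : pull 'X_i = fhat f i.
Proof. exact: evXU. Qed.

Lemma pull_eq0 m p : p \is m.-homog -> p \mPo f = 0 <-> pull p = 0.
Proof.
move=> hp; rewrite -pullE; split=> [->|]; first by rewrite rmorph0.
exact: hat_inj (comp_homog hf hp).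
Qed.

Lemma pull_line : pull line = g.
Proof. by rewrite /line !rmorphB /= !pullZ !pullXU. Qed.

Lemma g_neq0 : g != 0.
Proof. by apply: contraNneq gd => ->; rewrite coef0. Qed.

Lemma fhat2x i : (fhat f i2).[x i] = al * (fhat f i0).[x i] + be * (fhat f i1).[x i].
Proof.
have /eqP := gx i; rewrite !(hornerD, hornerN, hornerZ) -addrA -opprD subr_eq0.
by move/eqP.
Qed.

(** The point of the curve with parameter x i lies on the line, at the affine
    coordinate y i. *)
Lemma pull_at m p i : p \is m.-homog ->
  (pull p).[x i] = (fhat f i1).[x i] ^+ m * (rho p).[y i].
Proof.
move=> hp; rewrite !(horner_ev _ p) -(meval_homog _ _ hp).
apply: meval_eq; apply: ord3P; rewrite /= ?(hornerD, hornerZ, hornerX, hornerC).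
- by rewrite mulrC (divfK (f1x i)).
- by rewrite mulr1.
- by rewrite fhat2x mulrDr mulrCA [_ * (_ / _)]mulrC (divfK (f1x i)) [be * _]mulrC.
Qed.

Lemma rho_at m p i : p \is m.-homog -> pull p = 0 -> (rho p).[y i] = 0.
Proof.
move=> hp pp; have := pull_at i hp; rewrite pp horner0 => /esym/eqP.
by rewrite mulf_eq0 expf_eq0 (negbTE (f1x i)) andbF => /eqP.
Qed.

Lemma pull_divline m p : p \is m.+1.-homog -> pull p = 0 -> rho p = 0 ->
  exists h, [/\ h \is m.-homog, pull h = 0 & p = h * line].
Proof.
move=> hp pp rp; have [h hh e] := rho_kerS hp rp; exists h; split=> //.
move: pp; rewrite e rmorphM /= pull_line => /eqP.
by rewrite mulf_eq0 (negbTE g_neq0) orbF => /eqP.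
Qed.

(** The restriction to the line has d roots, too many for its degree; and the
    quotient by the equation of the line still vanishes on the curve. *)
Lemma low_degree_pull m p : p \is m.-homog -> (m < d)%N -> pull p = 0 -> p = 0.
Proof.
elim: m p => [|m IH] p hp md pp.
  have rp : rho p = 0.
    apply: (poly_zero_at y_inj) => [|i]; last exact: rho_at hp pp.
    by apply: leq_trans (size_rho _ _ hp) md.
  exact: rho_ker0 hp rp.
have rp : rho p = 0.
  apply: (poly_zero_at y_inj) => [|i]; last exact: rho_at hp pp.
  by apply: leq_trans (size_rho _ _ hp) md.
have [h [hh ph ->]] := pull_divline hp pp rp.
by rewrite (IH h) ?mul0r // ltnW.
Qed.

Lemma pullF : pull F = 0.
Proof. by apply/(pull_eq0 hF). Qed.

Lemma rhoF_neq0 : rho F != 0.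
Proof.
apply/eqP => rF; have hF' : F \is d.-1.+1.-homog by rewrite prednK // ltnW.
have [h [hh ph e]] := pull_divline hF' pullF rF.
by move: F0; rewrite e (low_degree_pull hh) ?mul0r ?eqxx //; rewrite prednK // ltnW.
Qed.

Lemma rhoF_split : rho F = (rho F)`_d *: \prod_i ('X - (y i)%:P).
Proof.
apply: (poly_split_at y_inj) => [|i]; first exact: size_rho.
exact: rho_at hF pullF.
Qed.

Lemma rhoF_lead : (rho F)`_d != 0.
Proof. by apply: contraNneq rhoF_neq0 => e; rewrite rhoF_split e scale0r. Qed.

Lemma size_rhoF : size (rho F) = d.+1.
Proof.
by rewrite rhoF_split size_scale ?rhoF_lead // size_prod_XsubC /index_enum -enumT size_enum_ord.
Qed.

Lemma rhoF_separable : coprimep (rho F) (rho F)^`().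
Proof.
have : separable_poly (rho F).
  rewrite rhoF_split (eqp_separable (eqp_scale _ rhoF_lead)).
  rewrite -(big_map y xpredT (fun z => 'X - z%:P)) separable_prod_XsubC.
  by rewrite map_inj_uniq // /index_enum -enumT enum_uniq.
by rewrite unlock.
Qed.

Lemma rho_dvd m p : p \is (m + d).-homog -> pull p = 0 ->
  exists2 k, k \is m.-homog & rho (p - k * F) = 0.
Proof.
move=> hp pp; have rF0 := rhoF_neq0.
have rp0 : rho p %% rho F = 0.
  apply: (poly_zero_at y_inj) => [|i]; first by rewrite -ltnS -size_rhoF ltn_modp.
  have := congr1 (fun u : {poly K} => u.[y i]) (divp_eq (rho p) (rho F)).
  by rewrite /= hornerD hornerM (rho_at i hp pp) (rho_at i hF pullF) mulr0 add0r.
have Hq := divp_eq (rho p) (rho F); rewrite rp0 addr0 in Hq.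
have sq : (size (rho p %/ rho F)%R <= m.+1)%N.
  rewrite size_divp // size_rhoF leq_subLR.
  by apply: leq_trans (size_rho _ _ hp) _; rewrite addnS addnC.
have [k hk rk] := rho_surj al be sq; exists k => //.
by rewrite rmorphB rmorphM /= rk -Hq subrr.
Qed.

(** The same induction, with remainders modulo rho F: the restriction to the line
    is a multiple of rho F, which has exactly the roots y i. *)
Lemma pull_kernel m p : p \is (m + d).-homog -> pull p = 0 ->
  exists2 k, k \is m.-homog & p = k * F.
Proof.
elim: m p => [|m IH] p hp pp; have [k hk rk] := rho_dvd hp pp;
  have pr : pull (p - k * F) = 0
    by [rewrite rmorphB rmorphM /= pp pullF mulr0 subrr];
  have hr := rpredB hp (dhomogM hk hF).
  have hr' : p - k * F \is d.-1.+1.-homog by rewrite prednK // ltnW.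
  have [h [hh ph e]] := pull_divline hr' pr rk.
  exists k => //; apply/eqP; rewrite -subr_eq0 e (low_degree_pull hh) ?mul0r //.
  by rewrite prednK // ltnW.
have [h [hh ph e]] := pull_divline hr pr rk.
have [k' hk' e'] := IH h hh ph.
exists (k + k' * line); last first.
  by rewrite mulrDl -mulrA [line * F]mulrC mulrA -e' -e addrC subrK.
by apply: rpredD => //; have := dhomogM hk' (line_homog al be); rewrite addn1.
Qed.

(** The chain rule for F(f) = 0. *)
Lemma pull_tangent : \sum_i pull F^`M(i) * (fhat f i)^`() = 0.
Proof. by rewrite -deriv_ev -/(pull F) pullF derivC. Qed.

(** Euler's relation for F along the curve. *)
Lemma pull_radial : \sum_i pull F^`M(i) * fhat f i = 0.
Proof.
transitivity (pull (\sum_i 'X_i * F^`M(i))).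
  by rewrite rmorph_sum; apply: eq_bigr => i _; rewrite rmorphM /= pullXU mulrC.
by rewrite (euler hF) pullZ pullF scaler0.
Qed.

(** The value at x i of the derivative of g, see [deriv_g_at]. *)
Definition gam i := g`_d * \prod_(j | j != i) (x i - x j).

Lemma gam_neq0 i : gam i != 0.
Proof.
rewrite /gam mulf_neq0 // prodf_seq_neq0; apply/allP => j _; apply/implyP => ji.
by rewrite subr_eq0; apply: contra ji => /eqP/x_inj->.
Qed.

Lemma size_g : (size (fhat f i2 - al *: fhat f i0 - be *: fhat f i1)%R <= d.+1)%N.
Proof. by rewrite -pull_line; have := size_ev (k := d) (size_fhat hf) (line_homog al be); rewrite mul1n. Qed.

Lemma g_lag i : g = gam i *: (('X - (x i)%:P) * lag x i).
Proof.
rewrite [LHS](poly_split_at x_inj size_g gx) /gam -scalerA; congr (_ *: _).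
rewrite (bigD1 i) //= scalerAr; congr (_ * _).
rewrite /lag scaler_prod scalerA -big_split [X in X *: _]big1 ?scale1r //= => j ji.
by rewrite divff // subr_eq0; apply: contra ji => /eqP/x_inj->.
Qed.

Lemma deriv_g_at i :
  (fhat f i2 - al *: fhat f i0 - be *: fhat f i1)^`().[x i] = gam i.
Proof.
rewrite [X in X^`()](g_lag i) derivZ derivM derivXsubC mul1r.
by rewrite hornerZ hornerD hornerM hornerXsubC subrr mul0r addr0 lag_at // eqxx mulr1.
Qed.

(** The line through (0 : 0 : 1) and the i-th intersection point. *)
Definition tline i : {mpoly K[3]} :=
  (fhat f i0).[x i] *: 'X_i1 - (fhat f i1).[x i] *: 'X_i0.

Definition chord i : {poly K} :=
  ((fhat f i1).[x i] *: fhat f i0 - (fhat f i0).[x i] *: fhat f i1) %/ ('X - (x i)%:P).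

Lemma chordE i : chord i * ('X - (x i)%:P) =
  (fhat f i1).[x i] *: fhat f i0 - (fhat f i0).[x i] *: fhat f i1.
Proof.
rewrite /chord divpK // dvdp_XsubCl; apply/rootP.
by rewrite hornerD hornerN !hornerZ mulrC subrr.
Qed.

Lemma size_chord i : (size (chord i) <= d)%N.
Proof.
rewrite /chord size_divp ?polyXsubC_eq0 // size_XsubC leq_subLR add1n.
apply: leq_trans (size_polyD _ _) _; rewrite size_polyN geq_max.
by rewrite !(leq_trans (size_scale_leq _ _)) ?size_fhat.
Qed.

(** A matrix of linear forms, diagonal on the line, and singular along the curve,
    where the Lagrange polynomials of the x i form a vector of its kernel
    ([bez_kernel]): interpolating [chord], row i expresses the identity
    gam_i t_i L_i + g chord_i = 0, where t_i and g are the pull-backs of [tline]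
    and of [line]. *)
Definition bez : 'M[{mpoly K[3]}]_d :=
  \matrix_(i, j) ((gam i *: tline i) *+ (i == j) + (chord i).[x j] *: line).

Lemma bez_homog i j : bez i j \is 1.-homog.
Proof.
rewrite mxE; apply: rpredD; last by rewrite rpredZ ?line_homog.
by rewrite rpredMn // rpredZ // /tline rpredB ?rpredZ // homogX1.
Qed.

Lemma bez_kernel : map_mx pull bez *m (\col_j lag x j) = 0.
Proof.
apply/colP => i; rewrite !mxE.
transitivity (gam i *: pull (tline i) * lag x i + pull line * chord i).
  rewrite -[chord i](lag_interpolation x_inj (size_chord i)) mulr_sumr.
  have -> : gam i *: pull (tline i) * lag x i =
      \sum_j (gam i *: pull (tline i)) *+ (i == j) * lag x j.
    rewrite (bigD1 i) //= eqxx big1 ?addr0 // => j ji.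
    by rewrite eq_sym (negbTE ji) mul0r.
  rewrite -big_split; apply: eq_bigr => j _.
  by rewrite !mxE rmorphD rmorphMn /= !pullZ mulrDl -scalerAl scalerAr.
rewrite pull_line [X in X * chord i](g_lag i) /tline rmorphB /= !pullZ !pullXU.
rewrite -!scalerAl -scalerDr -mulrA [_ * chord i]mulrC mulrA [_ * chord i]mulrC chordE.
by rewrite -mulrDl addrA subrK subrr mul0r scaler0.
Qed.

Definition Nmx := \adj bez.

Lemma Nmx_homog i j : Nmx i j \is d.-1.-homog.
Proof. apply: adj_homog => k l; exact: bez_homog. Qed.

Lemma pull_Nmx i k a : lag x k * pull (Nmx i a) = lag x i * pull (Nmx k a).
Proof.
have := adj_kernel i a k bez_kernel; rewrite -map_mx_adj.
by rewrite !mxE.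
Qed.

Lemma size_dfhat i : (size (fhat f i)^`() <= d)%N.
Proof.
have [->|f0] := eqVneq (fhat f i) 0; first by rewrite derivC size_poly0.
by rewrite -ltnS; apply: leq_trans (lt_size_deriv f0) (size_fhat hf i).
Qed.

(** A column of the adjugate restricts along the curve to a multiple of the
    Lagrange vector ([pull_Nmx]). Summing it against the values of f' at the x i
    therefore interpolates f': along the curve this vector is proportional to the
    tangent vector f'. *)
Definition vfield a k : {mpoly K[3]} := \sum_j (fhat f k)^`().[x j] *: Nmx j a.

Lemma vfield_homog a k : vfield a k \is d.-1.-homog.
Proof. by apply: rpred_sum => j _; rewrite rpredZ // Nmx_homog. Qed.

Lemma pull_vfield a i k : lag x i * pull (vfield a k) = pull (Nmx i a) * (fhat f k)^`().
Proof.
rewrite rmorph_sum mulr_sumr -{2}[(fhat f k)^`()](lag_interpolation x_inj (size_dfhat k)).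
rewrite mulr_sumr; apply: eq_bigr => j _.
by rewrite /= pullZ -!scalerAr pull_Nmx mulrC.
Qed.

Lemma vfield_tangent a : pull (\sum_k vfield a k * F^`M(k)) = 0.
Proof.
have la : lag x a != 0.
  by apply/eqP => l0; have /eqP := lag_at x_inj a a; rewrite l0 horner0 eqxx eq_sym oner_eq0.
have E k : lag x a * pull (vfield a k * F^`M(k)) =
    pull (Nmx a a) * (pull F^`M(k) * (fhat f k)^`()).
  by rewrite rmorphM /= [LHS]mulrA pull_vfield [RHS]mulrA mulrAC.
apply: (mulfI la); rewrite mulr0 rmorph_sum mulr_sumr (eq_bigr _ (fun k _ => E k)).
by rewrite -mulr_sumr pull_tangent mulr0.
Qed.

Definition rtline i := gam i *: rho (tline i).

Lemma horner_rtline i b : (rtline i).[y b] = gam i * ((fhat f i1).[x i] * (y i - y b)).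
Proof.
rewrite /rtline /tline rmorphB /= !rhoZ rhoX0 rhoX1 !(hornerZ, hornerD, hornerN, hornerX).
rewrite hornerC mulr1; congr (_ * _); rewrite mulrBr; congr (_ - _).
by rewrite mulrC (divfK (f1x i)).
Qed.

Lemma rtline_neq0 i b : i != b -> (rtline i).[y b] != 0.
Proof.
move=> ib; rewrite horner_rtline; apply: mulf_neq0; first exact: gam_neq0.
apply: mulf_neq0; first exact: f1x.
rewrite subr_eq0.
by apply: contra ib => /eqP e; apply/eqP/y_inj.
Qed.

Lemma rho_bez : map_mx rho bez = diag_mx (\row_i rtline i).
Proof.
apply/matrixP => i j; rewrite !mxE rmorphD rmorphMn /= !rhoZ rho_line scaler0 addr0.
by rewrite mulrb; case: (i == j).
Qed.

(** On the line the matrix is diagonal, and so is its adjugate. *)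
Lemma rho_Nmx i a : rho (Nmx i a) = (\prod_(k | k != a) rtline k) *+ (i == a).
Proof.
have r0 b : rtline b != 0.
  apply/eqP => e; have [c cb] : exists c, c != b.
    have lt0 : (0 < d)%N by apply: ltnW.
    have [e0|ne] := eqVneq b (Ordinal lt0); last by exists (Ordinal lt0); rewrite eq_sym.
    by exists (Ordinal hd); rewrite e0.
  by have := @rtline_neq0 b c; rewrite e horner0 eqxx eq_sym => /(_ cb).
have := mul_adj_mx (map_mx rho bez); rewrite -map_mx_adj {1}rho_bez mul_mx_diag.
move/matrixP/(_ i a); rewrite rho_bez det_diag !mxE => e.
apply: (mulIf (r0 a)); rewrite e (bigD1 a) //= mxE mulrnAl mulrC.
by congr (_ * _ *+ _); apply: eq_bigr => k _; rewrite mxE.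
Qed.

(** A multiple of the Lagrange polynomial at y a for the d points on the line. *)
Definition lag_line a := (fhat f i2 - al *: fhat f i0 - be *: fhat f i1)^`().[x a] *:
  \prod_(k | k != a) rtline k.

Lemma lag_line_at a b : (lag_line a).[y b] = (lag_line a).[y a] *+ (a == b).
Proof.
have [->//|ab] := eqVneq a b.
rewrite /lag_line hornerZ horner_prod (bigD1 b) 1?eq_sym //= horner_rtline.
by rewrite subrr !mulr0 mul0r mulr0.
Qed.

Lemma lag_line_neq0 a : (lag_line a).[y a] != 0.
Proof.
rewrite /lag_line hornerZ mulf_neq0 //.
  by rewrite deriv_g_at gam_neq0.
rewrite horner_prod prodf_seq_neq0; apply/allP => k _; apply/implyP => ka.
exact: rtline_neq0.
Qed.

Lemma size_lag_line a : (size (lag_line a) <= d)%N.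
Proof.
apply: leq_trans (size_scale_leq _ _) _.
suff : (size (\prod_(k | k != a) rtline k)%R <= (\sum_(k < d | k != a) 1).+1)%N.
  by rewrite sum1_card cardC1 card_ord prednK // ltnW.
elim/big_rec2: _ => [|j m q _ Hq]; first by rewrite size_poly1.
apply: size_mul_leS => //; apply: leq_trans (size_scale_leq _ _) _.
by apply: size_rho; rewrite /tline rpredB ?rpredZ // homogX1.
Qed.

Definition syzygy e (th : 'I_3 -> {mpoly K[3]}) :=
  (forall k, th k \is e.-homog) /\ \sum_k th k * F^`M(k) = 0.

(** The derivative of the equation of the line along a vector field. *)
Definition transverse (th : 'I_3 -> {mpoly K[3]}) := th i2 - al *: th i0 - be *: th i1.

(** F divides the derivative of F along the vector field [vfield], as it vanishes on the
    curve; the multiple h F is removed by subtracting h/d times the Euler field,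
    which does not change the transverse part on the line. *)
Lemma syzygy_lag a : exists2 th, syzygy d.-1 th & rho (transverse th) = lag_line a.
Proof.
have [e [de hde]] : exists e, d = e.+2 /\ d.-1 = e.+1.
  by exists d.-2; split; move: hd; lia.
have dF k : F^`M(k) \is d.-1.-homog.
  by apply: mderiv_homog; rewrite prednK // ltnW.
have hv : \sum_k vfield a k * F^`M(k) \is (e + d).-homog.
  have -> : (e + d)%N = (d.-1 + d.-1)%N by lia.
  by apply: rpred_sum => k _; apply: dhomogM => //; apply: vfield_homog.
have [h hh eh] := pull_kernel hv (vfield_tangent a).
pose c := d%:R^-1 *: h.
exists (fun k => vfield a k - c * 'X_k).
  split=> [k|].
    apply: rpredB; first exact: vfield_homog.
    by have := dhomogM (rpredZ d%:R^-1 hh) (homogX1 K k); rewrite addn1 hde.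
  under eq_bigr do rewrite mulrBl.
  rewrite sumrB eh; under [X in _ - X]eq_bigr do rewrite -mulrA.
  rewrite -mulr_sumr (euler hF) /c -scalerAl -scalerAr scalerA mulVf ?scale1r ?subrr //.
  by rewrite pnatr_eq0; move: hd; lia.
have -> : transverse (fun k => vfield a k - c * 'X_k) = transverse (vfield a) - c * line.
  by rewrite /transverse /line -!mul_mpolyC; ring.
rewrite rmorphB rmorphM /= rho_line mulr0 subr0 /transverse !rmorphB /= !rhoZ.
have rv k : rho (vfield a k) = (fhat f k)^`().[x a] *: \prod_(k | k != a) rtline k.
  rewrite /vfield rmorph_sum (bigD1 a) //= rhoZ rho_Nmx eqxx [X in _ + X]big1 ?addr0 // => j ja.
  by rewrite rhoZ rho_Nmx (negbTE ja) scaler0.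
rewrite !rv /lag_line !(derivB, derivZ) !(hornerD, hornerN, hornerZ).
by rewrite !scalerBl !scalerA.
Qed.

Lemma syzygy_add e th th' (c : {mpoly K[3]}) e' : c \is e'.-homog -> syzygy (e' + e) th ->
  syzygy e th' -> syzygy (e' + e) (fun k => th k + c * th' k).
Proof.
move=> hc [h1 s1] [h2 s2]; split=> [k|]; first by apply: rpredD => //; apply: dhomogM.
under eq_bigr do rewrite mulrDl -mulrA.
by rewrite big_split /= -mulr_sumr s1 s2 mulr0 addr0.
Qed.

Lemma rho_transverse_add th th' (c : {mpoly K[3]}) :
  rho (transverse (fun k => th k + c * th' k)) =
  rho (transverse th) + rho c * rho (transverse th').
Proof.
by rewrite -rmorphM -rmorphD; congr rho; rewrite /transverse -!mul_mpolyC; ring.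
Qed.

(** For m = 0 this is Lagrange interpolation with the syzygies of [syzygy_lag];
    each further degree costs a multiplication by x or y, which act on the line as
    X and 1. *)
Lemma syzygy_lift m (c : {poly K}) : (size c <= d + m)%N ->
  exists2 th, syzygy (m + d.-1) th & rho (transverse th) = c.
Proof.
elim: m c => [|m IH] c sc; last first.
  pose c1 : {poly K} := \poly_(i < d + m) c`_i.+1.
  have [th1 s1 r1] := IH c1 (size_poly _ _).
  have [th0 s0 r0] := IH (c`_0)%:P (leq_trans (size_polyC_leq1 _) (ltn_addr _ (ltnW hd))).
  have z0 : syzygy (1 + (m + d.-1)) (fun=> 0).
    by split=> [k|]; [exact: rpred0 | rewrite big1 // => k _; rewrite mul0r].
  have t0 := syzygy_add (homogX1 K i1) z0 s0.
  have t1 := syzygy_add (homogX1 K i0) t0 s1.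
  exists (fun k => (0 + 'X_i1 * th0 k) + 'X_i0 * th1 k); first by rewrite addSn -add1n.
  rewrite rho_transverse_add rho_transverse_add r0 r1 rhoX0 rhoX1 mul1r.
  rewrite /transverse !scaler0 !subr0 rmorph0 add0r.
  apply/polyP => -[|i]; rewrite coefD coefC coefXM /= ?addr0 // add0r coef_poly.
  by case: ltnP => // le; rewrite nth_default //; apply: leq_trans sc _; rewrite addnS.
have /fin_all_exists2 [th sth rth] := syzygy_lag.
pose k a := c.[y a] / (lag_line a).[y a].
exists (fun i => \sum_a k a *: th a i).
  split=> [i|]; first by apply: rpred_sum => a _; rewrite rpredZ //; case: (sth a).
  under eq_bigr do rewrite mulr_suml; rewrite exchange_big big1 //= => a _.
  under eq_bigr do rewrite -scalerAl; rewrite -scaler_sumr.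
  by case: (sth a) => _ ->; rewrite scaler0.
have -> : rho (transverse (fun i => \sum_a k a *: th a i)) = \sum_a k a *: lag_line a.
  rewrite /transverse !scaler_sumr -!sumrB rmorph_sum; apply: eq_bigr => a _.
  by rewrite -rth -rhoZ /transverse !scalerBr !scalerA ![k a * _]mulrC.
apply: (poly_eq_at y_inj).
- apply: size_sum_leq => a; apply: leq_trans (size_scale_leq _ _) (size_lag_line a).
- by rewrite addn0 in sc.
- move=> b; rewrite horner_sum (bigD1 b) //= hornerZ /k divfK ?lag_line_neq0 //.
  rewrite big1 ?addr0 // => a ab; rewrite hornerZ (lag_line_at a b) (negbTE ab).
  by rewrite mulr0n mulr0.
Qed.

End CurveOnLine.

(** * The Hilbert function of the Jacobian algebra *)

Lemma submod_homog (K : fieldType) k n :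
  submod (fun p : {mpoly K[k]} => p \is n.-homog).
Proof. by split=> [|a u v hu hv]; [exact: rpred0 | rewrite rpredD ?rpredZ]. Qed.

Section Jacobian.
Variables (K : numClosedFieldType) (d : nat) (F : {mpoly K[3]}) (al be : K).
Hypotheses (hd : (1 < d)%N) (hF : F \is d.-homog).
Local Notation rho := (rho al be).
Local Notation line := (line al be).
Hypotheses (sF : size (rho F) = d.+1) (cF : coprimep (rho F) (rho F)^`()).

Local Notation G0 := (F^`M(i0) + al *: F^`M(i2)).
Local Notation G1 := (F^`M(i1) + be *: F^`M(i2)).
Local Notation G2 := (F^`M(i2)).

Lemma partial_homog i : F^`M(i) \is d.-1.-homog.
Proof. by apply: mderiv_homog; rewrite prednK // ltnW. Qed.

Lemma G0_homog : G0 \is d.-1.-homog.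
Proof. by rewrite rpredD ?rpredZ // partial_homog. Qed.

Lemma G1_homog : G1 \is d.-1.-homog.
Proof. by rewrite rpredD ?rpredZ // partial_homog. Qed.

(** G0 and G1 are the derivatives of F along the line. *)
Lemma rho_G0 : rho G0 = (rho F)^`().
Proof.
rewrite /rho deriv_ev sum_ord3 /= derivX derivC mulr0 addr0 mulr1.
by rewrite derivD derivZ derivX derivC addr0 rmorphD /= evZ -scalerAr mulr1.
Qed.

Lemma rho_G1 : rho G1 = ypart d (rho F).
Proof.
rewrite /ypart -rho_G0 -rhoZ -(euler hF) sum_ord3 !rmorphD !rmorphM /= !rhoZ.
rewrite rhoX0 rhoX1 rhoX2 -!mul_polyC; ring.
Qed.

Lemma G0_neq0 : G0 != 0.
Proof.
apply/eqP => /(congr1 rho); rewrite rho_G0 rmorph0 => e.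
by have := size_derivS sF; rewrite e size_poly0; move: hd => /[swap] <-.
Qed.

(** The syzygy on the line is a Koszul one, by [coprime_syzygy], and its factor
    lifts to a ternary form. *)
Lemma lift_koszul e a b : a \is e.-homog -> b \is e.-homog ->
  rho a * (rho F)^`() + rho b * ypart d (rho F) = 0 ->
  exists k, [/\ k * G1 \is e.-homog, k * G0 \is e.-homog,
     rho (a - k * G1) = 0 & rho (b + k * G0) = 0].
Proof.
move=> ha hb E.
have [k [ak bk sk]] := coprime_syzygy (ltnW hd) sF cF (size_rho al be ha) (size_rho al be hb) E.
have [k0|k0] := eqVneq k 0.
  exists 0; rewrite !mul0r subr0 addr0 ak bk k0 !mul0r oppr0.
  by split=> //; exact: rpred0.
have {}sk := sk k0.
have [|q hq rq] := @rho_surj K al be (e - d.-1) k.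
  by move: sk; rewrite -size_poly_gt0 in k0; move: k0 hd; move: (size k) => s; lia.
have de : (e - d.-1 + d.-1)%N = e.
  by apply: subnK; move: sk; rewrite -size_poly_gt0 in k0; move: k0 hd; move: (size k) => s; lia.
exists q; split.
- by have := dhomogM hq G1_homog; rewrite de.
- by have := dhomogM hq G0_homog; rewrite de.
- by rewrite rmorphB rmorphM /= rho_G1 rq -ak subrr.
- by rewrite rmorphD rmorphM /= rho_G0 rq bk addNr.
Qed.

(** G0 and G1 form a regular sequence: after subtracting a Koszul syzygy, the
    coefficients vanish on the line and can be divided by its equation. *)
Lemma koszul_two e a b : a \is e.-homog -> b \is e.-homog -> a * G0 + b * G1 = 0 ->
  exists k, a = k * G1 /\ b = - (k * G0).
Proof.
elim: e a b => [|e IH] a b ha hb E.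
all: have rE : rho a * (rho F)^`() + rho b * ypart d (rho F) = 0
  by rewrite -rho_G0 -rho_G1 -!rmorphM -rmorphD E rmorph0.
all: have [k [h1 h0 ra rb]] := lift_koszul ha hb rE; have ha' := rpredB ha h1;
  have hb' := rpredD hb h0.
  exists k; split; apply/eqP; first by rewrite -subr_eq0 (rho_ker0 ha' ra).
  by rewrite -subr_eq0 opprK (rho_ker0 hb' rb).
have [a' ha1 ea] := rho_kerS ha' ra; have [b' hb1 eb] := rho_kerS hb' rb.
have [|k' [ek1 ek0]] := IH a' b' ha1 hb1.
  apply: (mulIf (line_neq0 al be)); rewrite mul0r mulrDl !(mulrAC _ _ line) -ea -eb.
  rewrite -[RHS]E; ring.
exists (k + k' * line); split.
  by rewrite -[a](subrK (k * G1)) ea ek1; ring.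
by rewrite -[b](addrK (k * G0)) eb ek0; ring.
Qed.

(** Exactness of the Koszul complex of dF at this place only needs depth two, and
    G0 and G1 already form a regular sequence. *)
Lemma koszul_parallel e (u : 'I_3 -> {mpoly K[3]}) : (forall i, u i \is e.-homog) ->
  (forall i j, u i * F^`M(j) = u j * F^`M(i)) -> exists k, forall i, u i = k * F^`M(i).
Proof.
move=> hu uF.
have h0 : u i0 + al *: u i2 \is e.-homog by rewrite rpredD ?rpredZ.
have h1 : - (u i1 + be *: u i2) \is e.-homog by rewrite rpredN rpredD ?rpredZ.
have [|k [e1 e0]] := koszul_two h1 h0.
  transitivity (- (u i1 * F^`M(i0)) + u i0 * F^`M(i1) +
    be *: (u i0 * F^`M(i2) - u i2 * F^`M(i0)) + al *: (u i2 * F^`M(i1) - u i1 * F^`M(i2))).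
    by rewrite -!mul_mpolyC; ring.
  by rewrite (uF i1 i0) (uF i0 i2) (uF i2 i1) addNr !subrr !scaler0 !addr0.
have e2 : u i2 = - k * G2.
  apply: (mulIf G0_neq0); transitivity ((u i0 + al *: u i2) * G2).
    by rewrite mulrDr mulrDl (uF i0 i2) -scalerAl -scalerAr.
  by rewrite e0; ring.
exists (- k); apply: ord3P => //.
  rewrite -[u i0](addrK (al *: u i2)) e0 e2 -!mul_mpolyC; ring.
have -> : u i1 = - (k * G1) - be *: u i2 by rewrite -e1 opprK addrK.
rewrite e2 -!mul_mpolyC; ring.
Qed.

Lemma jacobianD p q : jacobian_ideal F p -> jacobian_ideal F q -> jacobian_ideal F (p + q).
Proof.
move=> [a ->] [b ->]; exists (fun i => a i + b i); rewrite -big_split.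
by apply: eq_bigr => i _; rewrite mulrDl.
Qed.

Lemma jacobianM p q : jacobian_ideal F q -> jacobian_ideal F (p * q).
Proof.
move=> [a ->]; exists (fun i => p * a i); rewrite mulr_sumr.
by apply: eq_bigr => i _; rewrite mulrA.
Qed.

Lemma jacobian_homog m p : p \is (m + d.-1).-homog -> jacobian_ideal F p ->
  exists2 a : 'I_3 -> {mpoly K[3]}, (forall i, a i \is m.-homog) & p = \sum_i a i * F^`M(i).
Proof.
move=> hp [a e]; exists (fun i => pihomog mdeg m (a i)); first by move=> i; apply: pihomogP.
rewrite -(pihomog_dE hp) e raddf_sum; apply: eq_bigr => i _ /=.
by rewrite (pihomogM _ _ (partial_homog i)).
Qed.

Lemma jacobian_small m p : p \is m.-homog -> (m < d.-1)%N -> jacobian_ideal F p -> p = 0.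
Proof.
move=> hp md [a e]; rewrite -(pihomog_dE hp) e raddf_sum big1 // => i _ /=.
by rewrite (pihomogM_small _ (partial_homog i)).
Qed.

Lemma jacobian_combo (a b c : {mpoly K[3]}) : jacobian_ideal F (a * G0 + b * G1 + c * G2).
Proof.
exists (fun i => if i == i0 then a else if i == i1 then b else al *: a + be *: b + c).
by rewrite sum_ord3 /= -!mul_mpolyC; ring.
Qed.

(** Modulo the line, the ideal J contains the two derivatives of the squarefree
    form rho F, hence every form of this degree. *)
Lemma line_mult_surj m p : (2 * d - 3 <= m.+1)%N -> p \is m.+1.-homog ->
  exists2 q, q \is m.-homog & jacobian_ideal F (p - q * line).
Proof.
move=> dm hp.
have [a [b [sa sb eab]]] := coprime_span hd sF cF dm (size_rho al be hp).
have ed : (m.+1 + 2 - d = (m.+2 - d).+1)%N by move: hd dm; lia.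
rewrite ed in sa sb.
have [a' ha ra] := rho_surj al be sa; have [b' hb rb] := rho_surj al be sb.
have ed' : (m.+2 - d + d.-1 = m.+1)%N by move: hd dm; lia.
have h0 := dhomogM ha G0_homog; have h1 := dhomogM hb G1_homog; rewrite ed' in h0 h1.
have rr : rho (p - (a' * G0 + b' * G1)) = 0.
  by rewrite rmorphB rmorphD !rmorphM /= rho_G0 rho_G1 ra rb -eab subrr.
have [q hq eq] := rho_kerS (rpredB hp (rpredD h0 h1)) rr.
exists q => //; rewrite -eq.
have -> : p - (p - (a' * G0 + b' * G1)) = a' * G0 + b' * G1 + 0 * G2 by ring.
exact: jacobian_combo.
Qed.

Hypothesis syzygy_lift : forall m (c : {poly K}), (size c <= d + m)%N ->
  exists2 th, syzygy F (m + d.-1) th & rho (transverse al be th) = c.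

Lemma transverse_homog e (u : 'I_3 -> {mpoly K[3]}) :
  (forall i, u i \is e.-homog) -> transverse al be u \is e.-homog.
Proof. by move=> hu; rewrite /transverse !rpredB ?rpredZ. Qed.

(** Write h l = sum a_i dF_i. Subtracting from a a syzygy with the same
    transverse part on the line, the combination becomes, on the line, a relation
    between G0 and G1 only; after removing a Koszul syzygy all coefficients are
    divisible by l. *)
Lemma line_mult_inj m h : (2 * d - 3 <= m)%N -> h \is m.-homog ->
  jacobian_ideal F (h * line) -> jacobian_ideal F h.
Proof.
move=> dm hh J.
pose n := (m + 3 - 2 * d)%N; pose e := (n + d.-1)%N.
have ed : (e + d.-1 = m + 1)%N by rewrite /e /n; move: hd dm; lia.
have hl := dhomogM hh (line_homog al be); rewrite -ed in hl.
have [a ha ea] := jacobian_homog hl J.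
have htr := transverse_homog ha.
have [|th [hth eth] rth] := @syzygy_lift n (rho (transverse al be a)).
  apply: leq_trans (size_rho _ _ htr) _; rewrite /e; move: hd; lia.
pose b i := a i - th i.
have hb i : b i \is e.-homog by apply: rpredB (ha i) (hth i).
have eb : h * line = b i0 * G0 + b i1 * G1 + transverse al be b * G2.
  transitivity (\sum_i b i * F^`M(i)).
    rewrite /b; under eq_bigr do rewrite mulrBl.
    by rewrite sumrB eth subr0.
  by rewrite sum_ord3 /transverse -!mul_mpolyC; ring.
have htb := transverse_homog hb.
have rb2 : rho (transverse al be b) = 0.
  have -> : transverse al be b = transverse al be a - transverse al be th.
    by rewrite /b /transverse -!mul_mpolyC; ring.
  by rewrite rmorphB /= rth subrr.
have [|k [h1 h0 ra rb]] := lift_koszul (hb i0) (hb i1).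
  rewrite -rho_G0 -rho_G1 -!rmorphM -rmorphD.
  have -> : b i0 * G0 + b i1 * G1 = h * line - transverse al be b * G2 by rewrite eb addrK.
  by rewrite rmorphB !rmorphM /= rb2 rho_line mulr0 mul0r subrr.
have [e' ee] : exists e', e = e'.+1 by exists e.-1; rewrite prednK // /e; move: hd; lia.
have hb0 := rpredB (hb i0) h1; have hb1 := rpredD (hb i1) h0; rewrite ee in hb0 hb1 htb.
have [a0 _ e0] := rho_kerS hb0 ra; have [a1 _ e1] := rho_kerS hb1 rb.
have [a2 _ e2] := rho_kerS htb rb2.
suff -> : h = a0 * G0 + a1 * G1 + a2 * G2 by apply: jacobian_combo.
apply: (mulIf (line_neq0 al be)); rewrite !mulrDl !(mulrAC _ _ line) -e0 -e1 -e2 eb.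
ring.
Qed.

Lemma submod_jacobian n :
  submod (fun p : {mpoly K[3]} => p \is n.-homog /\ jacobian_ideal F p).
Proof.
split=> [|a u v [hu ju] [hv jv]].
  by split; [exact: rpred0 | exists (fun=> 0); rewrite big1 // => i _; rewrite mul0r].
split; first by rewrite rpredD ?rpredZ.
by apply: jacobianD => //; rewrite -mul_mpolyC; apply: jacobianM.
Qed.

(** Descending induction from the degrees in which tau is the dimension by
    definition. *)
Lemma jacobian_hilbert tau : global_tjurina F tau -> forall m, (2 * d - 3 <= m)%N ->
  free_quot (fun p : {mpoly K[3]} => p \is m.-homog)
            (fun p => p \is m.-homog /\ jacobian_ideal F p) tau.
Proof.
move=> [k0 Hk] m; have [n] := ubnPleq (k0 - m).
elim: n m => [|n IH] m.
  by rewrite leqn0 subn_eq0 => /Hk.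
move=> nm dm; have := IH m.+1 _ (leqW dm); rewrite subnS.
have /[swap] /[apply] : ((k0 - m).-1 <= n)%N by move: nm; lia.
apply: (free_quot_image (h := fun p => p * line) tau (submod_homog K 3 m) (submod_jacobian m)
  (submod_homog K 3 m.+1) (submod_jacobian m.+1) _ _ _ _ _ _).2.
- by move=> a u v; rewrite mulrDl scalerAl.
- by move=> w [].
- by move=> w [].
- by move=> v hv; have := dhomogM hv (line_homog al be); rewrite addn1.
- move=> p hp; have [q hq jq] := line_mult_surj (leqW dm) hp; exists q => //; split=> //.
  by rewrite rpredB //; have := dhomogM hq (line_homog al be); rewrite addn1.
- move=> p hp; split=> [[_ jp]|[_ jp]]; split=> //; last exact: line_mult_inj dm hp jp.
    by have := dhomogM hp (line_homog al be); rewrite addn1.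
  by rewrite mulrC; apply: jacobianM.
Qed.

End Jacobian.

(** * Koszul homology of the gradient *)

Section Dimensions.
Variable K : fieldType.

Lemma homog_dim n :
  free_quot (fun p : {mpoly K[3]} => p \is n.-homog) (fun p => p = 0) 'C(n.+2, 2).
Proof.
have [k klin [l kl lk]] := dhomog_vecaxiom 2 K n.
have e : 'C(n.+2, 2) = 'C(n + 2, n) by rewrite addn2 -(@bin_sub n.+2 2) // subn2.
rewrite e; apply/free_quotP; [exact: submod_homog|exact: submod_zero|].
split=> [w ->|]; first exact: rpred0.
have indE (p : {mpoly K[3]}) : p \is n.-homog -> val (indhomog n p) = p.
  by move=> hp; rewrite /indhomog val_insubd hp.
have k0 : k 0 = 0 by have := klin (-1) 0 0; rewrite scaler0 addr0 scaleN1r addNr.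
exists (fun p => k (indhomog n p)); split.
- move=> a u v hu hv; rewrite -klin; congr k; apply: val_inj.
  rewrite indE ?rpredD ?rpredZ //=.
  by rewrite -[in LHS](indE u hu) -[in LHS](indE v hv).
- move=> p hp; split=> [->|kp].
    by rewrite -k0; congr k; apply: val_inj; rewrite indE ?rpred0.
  by rewrite -[p]indE // -[indhomog n p]kl kp -k0 kl.
- move=> c; exists (val (l c)); first exact: dhomog_is_dhomog.
  by rewrite -{2}(lk c); congr k; apply: val_inj; rewrite indE // dhomog_is_dhomog.
Qed.

Local Notation vec := {ffun 'I_3 -> {mpoly K[3]}}.

Definition homog_vec n (u : vec) : Prop := forall i, u i \is n.-homog.

Lemma submod_homog_vec n : submod (homog_vec n).
Proof.
split=> [i|a u v hu hv i]; first by rewrite ffunE rpred0.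
by rewrite !ffunE rpredD ?rpredZ.
Qed.

Lemma homog_vec_dim n : free_quot (homog_vec n) (fun u => u = 0) (3 * 'C(n.+2, 2)).
Proof.
have sv := submod_homog_vec n; have sh := submod_homog K 3 n.
have [_ [k [klin kker ksurj]]] := (free_quotP _ sh (@submod_zero _ _)).1 (homog_dim n).
rewrite mulSn mul2n -addnn.
apply/free_quotP => //; first exact: submod_zero.
split=> [u ->|]; first by case: sv.
exists (fun u : vec => row_mx (k (u i0)) (row_mx (k (u i1)) (k (u i2)))); split.
- by move=> a u v hu hv; rewrite !ffunE !klin // !scale_row_mx !add_row_mx.
- move=> u hu; split=> [->|/eqP].
    have k0 : k 0 = 0 by apply/kker => //; apply: rpred0.
    by rewrite !ffunE k0 !row_mx0.
  rewrite !row_mx_eq0 => /and3P[/eqP u0 /eqP u1 /eqP u2].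
  by apply/ffunP; apply: ord3P; rewrite ffunE; apply/kker.
- move=> c; have [p0 h0 e0] := ksurj (lsubmx c).
  have [p1 h1 e1] := ksurj (lsubmx (rsubmx c)); have [p2 h2 e2] := ksurj (rsubmx (rsubmx c)).
  exists [ffun i : 'I_3 => [tuple p0; p1; p2]`_i].
    by apply: ord3P; rewrite ffunE.
  by rewrite !ffunE /= e0 e1 e2 !hsubmxK.
Qed.

End Dimensions.

Notation vec K := {ffun 'I_3 -> {mpoly K[3]}}.

Definition cross (K : fieldType) (p q : 'I_3 -> {mpoly K[3]}) : vec K :=
  [ffun i : 'I_3 => [tuple p i1 * q i2 - p i2 * q i1; p i2 * q i0 - p i0 * q i2;
                           p i0 * q i1 - p i1 * q i0]`_i].

Lemma crossE (K : fieldType) (p q : 'I_3 -> {mpoly K[3]}) :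
  [/\ cross p q i0 = p i1 * q i2 - p i2 * q i1,
      cross p q i1 = p i2 * q i0 - p i0 * q i2 & cross p q i2 = p i0 * q i1 - p i1 * q i0].
Proof. by rewrite !ffunE. Qed.

Section KoszulComplex.
Variables (K : numClosedFieldType) (d : nat) (F : {mpoly K[3]}).
Hypotheses (hd : (2 < d)%N) (hF : F \is d.-homog).
Hypothesis partial_parallel : forall e (u : 'I_3 -> {mpoly K[3]}),
  (forall i, u i \is e.-homog) ->
  (forall i j, u i * F^`M(j) = u j * F^`M(i)) -> exists k, forall i, u i = k * F^`M(i).
Hypothesis partial_neq0 : exists i, F^`M(i) != 0.
Variable tau : nat.
Hypothesis hilbert : forall m, (2 * d - 3 <= m)%N ->
  free_quot (fun p : {mpoly K[3]} => p \is m.-homog)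
            (fun p => p \is m.-homog /\ jacobian_ideal F p) tau.

Local Notation grad := (fun i => F^`M(i)).

Lemma grad_homog i : grad i \is d.-1.-homog.
Proof. exact: (partial_homog (ltnW hd) hF). Qed.

Definition syz n (u : vec K) := homog_vec n u /\ \sum_i u i * F^`M(i) = 0.

Definition koszul n (u : vec K) := homog_vec n u /\ exists a : vec K, u = cross grad a.

Lemma submod_syz n : submod (syz n).
Proof.
have [s0 sD] := submod_homog_vec K n; split.
  by split=> //; rewrite big1 // => i _; rewrite ffunE mul0r.
move=> a u v [hu su] [hv sv]; split; first exact: sD.
under eq_bigr do rewrite !ffunE mulrDl -scalerAl.
by rewrite big_split /= -scaler_sumr su sv scaler0 addr0.
Qed.

Lemma cross_linear c (a b : vec K) :
  cross grad (c *: a + b) = c *: cross grad a + cross grad b.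
Proof.
apply/ffunP; apply: ord3P; rewrite !ffunE /= ?ffunE /= ?ffunE -!mul_mpolyC; ring.
Qed.

Lemma submod_koszul n : submod (koszul n).
Proof.
have [s0 sD] := submod_homog_vec K n; split.
  by split=> //; exists 0; apply/ffunP; apply: ord3P; rewrite !ffunE /= ?ffunE !mulr0 subrr.
move=> c u v [hu [a ea]] [hv [b eb]]; split; first exact: sD.
by exists (c *: a + b); rewrite cross_linear -ea -eb.
Qed.

Lemma koszul_syz n u : koszul n u -> syz n u.
Proof.
move=> [hu [a ea]]; split=> //; rewrite ea.
by rewrite sum_ord3 !ffunE /=; ring.
Qed.

Lemma koszul_homog n u : koszul (n + d.-1) u ->
  exists2 a : vec K, homog_vec n a & u = cross grad a.
Proof.
move=> [hu [a ea]]; exists [ffun i => pihomog mdeg n (a i)].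
  by move=> i; rewrite ffunE; apply: pihomogP.
apply/ffunP => i; rewrite -[u i](pihomog_dE (hu i)) ea.
move: i; apply: ord3P; rewrite !ffunE /= ?ffunE raddfB /= ![grad _ * _]mulrC;
  by rewrite !(pihomogM _ _ (grad_homog _)).
Qed.

Lemma koszul_small n u : koszul n u -> (n < d.-1)%N -> u = 0.
Proof.
move=> [hu [a ea]] nd; apply/ffunP => i; rewrite -[u i](pihomog_dE (hu i)) ea.
move: i; apply: ord3P; rewrite !ffunE /= raddfB /= ![grad _ * _]mulrC;
  by rewrite !(pihomogM_small _ (grad_homog _)) // subrr.
Qed.

Lemma cross_homog n (a : vec K) : homog_vec n a -> homog_vec (n + d.-1) (cross grad a).
Proof.
move=> ha; apply: ord3P; rewrite !ffunE /= addnC;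
by apply: rpredB; apply: dhomogM => //; apply: grad_homog.
Qed.

Lemma cross_eq0 n (a : vec K) : homog_vec n a -> cross grad a = 0 ->
  exists k, forall i, a i = k * F^`M(i).
Proof.
move=> ha /ffunP ca; apply: (partial_parallel ha).
have /eqP := ca i0; have /eqP := ca i1; have /eqP := ca i2.
rewrite !ffunE /= !subr_eq0 => /eqP e2 /eqP e1 /eqP e0.
apply: ord3P; apply: ord3P => //; rewrite ![a _ * _]mulrC //.
Qed.

Lemma jacobian_dim m h : free_quot (fun p : {mpoly K[3]} => p \is m.-homog)
    (fun p => p \is m.-homog /\ jacobian_ideal F p) h ->
  (h <= 'C(m.+2, 2))%N /\
  free_quot (fun p => p \is m.-homog /\ jacobian_ideal F p) (fun p => p = 0) ('C(m.+2, 2) - h).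
Proof.
apply: free_quot_kernel; [exact: submod_homog|exact: submod_jacobian|by move=> u []|].
exact: homog_dim.
Qed.

(** The combination of the partial derivatives with coefficients u maps S^3 onto
    J, with kernel AR. *)
Lemma jacobian_syz n h :
  free_quot (homog_vec n) (syz n) h <->
  free_quot (fun p => p \is (n + d.-1).-homog /\ jacobian_ideal F p) (fun p => p = 0) h.
Proof.
apply: (free_quot_image (h := fun u : vec K => \sum_i u i * F^`M(i))).
- exact: submod_homog_vec.
- exact: submod_syz.
- exact: submod_jacobian.
- exact: submod_zero.
- move=> a u v; rewrite scaler_sumr -big_split; apply: eq_bigr => i _ /=.
  by rewrite !ffunE mulrDl scalerAl.
- by move=> u [].
- by move=> p ->; case: (submod_jacobian F (n + d.-1)).
- move=> u hu; split; last by exists u.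
  by apply: rpred_sum => i _; apply: dhomogM (hu i) (grad_homog i).
- move=> p [hp jp]; have [a ha ->] := jacobian_homog (ltnW hd) hF hp jp.
  exists [ffun i => a i]; first by move=> i; rewrite ffunE.
  by apply/eqP; rewrite subr_eq0; apply/eqP/eq_bigr => i _; rewrite ffunE.
- by move=> u hu; split=> [[]|].
Qed.

Lemma syz_dim n h : free_quot (fun p : {mpoly K[3]} => p \is (n + d.-1).-homog)
    (fun p => p \is (n + d.-1).-homog /\ jacobian_ideal F p) h ->
  ('C((n + d.-1).+2, 2) - h <= 3 * 'C(n.+2, 2))%N /\
  free_quot (syz n) (fun u => u = 0) (3 * 'C(n.+2, 2) - ('C((n + d.-1).+2, 2) - h)).
Proof.
move=> /jacobian_dim [_ /jacobian_syz]; apply: free_quot_kernel (homog_vec_dim K n).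
- exact: submod_homog_vec.
- exact: submod_syz.
- by move=> u [].
Qed.

Lemma submod_cross_ker n : submod (fun a : vec K => homog_vec n a /\ cross grad a = 0).
Proof.
have [s0 sD] := submod_homog_vec K n; split.
  by split=> //; apply/ffunP; apply: ord3P; rewrite !ffunE /= ?ffunE !mulr0 subrr.
by move=> c u v [hu su] [hv sv]; split; [exact: sD|rewrite cross_linear su sv scaler0 addr0].
Qed.

(** By exactness these are the multiples k dF, with k of degree n - (d-1). The
    bound d <= n + 3 makes the truncated subtraction harmless, the binomial being
    0 when k would have degree -1 or -2. *)
Lemma grad_multiples_dim n : (d <= n + 3)%N ->
  free_quot (fun a : vec K => homog_vec n a /\ cross grad a = 0) (fun u => u = 0) 'C(n + 3 - d, 2).
Proof.
move=> dn.
have sM := submod_cross_ker n.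
have par k : cross grad [ffun i => k * F^`M(i)] = 0.
  by apply/ffunP; apply: ord3P; rewrite !ffunE /= ?ffunE; ring.
have [lt|ge] := ltnP n d.-1.
  have -> : 'C(n + 3 - d, 2) = 0%N by apply: bin_small; move: lt dn; lia.
  apply/free_quotP => //; first exact: submod_zero.
  split=> [u ->|]; first by case: sM.
  exists (fun=> 0); split=> [a u v _ _|a [ha ca]|c].
  - by rewrite scaler0 addr0.
  - split=> // _; have [k ka] := cross_eq0 ha ca.
    apply/ffunP => i; rewrite ffunE.
    exact: (homog_quotient_small (grad_homog i) (ha i) lt (ka i)).
  - by exists 0; [case: sM | rewrite [c]thinmx0].
have [m em] : exists m, n = (m + d.-1)%N by exists (n - d.-1)%N; rewrite subnK.
have -> : (n + 3 - d = m.+2)%N by rewrite em; move: hd; lia.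
apply: (free_quot_image (h := fun k : {mpoly K[3]} => [ffun i => k * F^`M(i)] : vec K)
  _ _ _ _ _ _ _ _ _ _ _).1 (homog_dim K m) => //.
- exact: submod_homog.
- exact: submod_zero.
- exact: submod_zero.
- by move=> a u v; apply/ffunP => i; rewrite !ffunE mulrDl scalerAl.
- by move=> p ->; apply: rpred0.
- by move=> u ->; case: sM.
- move=> k hk; split; last exact: par.
  by move=> i; rewrite ffunE em; apply: dhomogM (grad_homog i).
- move=> a [ha ca]; have [k ka] := cross_eq0 ha ca; exists (pihomog mdeg m k).
    exact: pihomogP.
  apply/eqP; rewrite subr_eq0; apply/eqP/ffunP => i; rewrite ffunE.
  rewrite -(pihomogM _ _ (grad_homog i)) -ka pihomog_dE //.
  by rewrite -em; apply: ha.
- move=> k hk; split=> [->|/ffunP e]; first by apply/ffunP => i; rewrite !ffunE mul0r.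
  have [i Fi] := partial_neq0; have /eqP := e i; rewrite !ffunE mulf_eq0 (negbTE Fi) orbF.
  by move/eqP.
Qed.

Lemma koszul_dim n : (d <= n + 3)%N ->
  ('C(n + 3 - d, 2) <= 3 * 'C(n.+2, 2))%N /\
  free_quot (koszul (n + d.-1)) (fun u => u = 0) (3 * 'C(n.+2, 2) - 'C(n + 3 - d, 2)).
Proof.
move=> dn; have G := grad_multiples_dim dn.
have sM := submod_cross_ker n.
have [le Q] := free_quot_quotient (submod_homog_vec K n) sM (fun u H => H.1)
  (homog_vec_dim K n) G.
split=> //.
apply: (free_quot_image (h := fun a : vec K => cross grad a) _ _ _ _ _ _ _ _ _ _ _).1 Q => //.
- exact: submod_homog_vec.
- exact: submod_koszul.
- exact: submod_zero.
- exact: cross_linear.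
- by move=> u [].
- by move=> u ->; case: (submod_koszul (n + d.-1)).
- by move=> a ha; split; [exact: cross_homog | exists a].
- move=> u /koszul_homog [a ha ->]; exists a => //; exact: subrr.
- by move=> a ha; split=> [[]|].
Qed.

(** The Euler characteristic of the graded Koszul complex, in terms of binomials:
    with n = m + d - 1, one has 3 C(n+2,2) - C(n+d+1,2) - 3 C(m+2,2) + C(m+3-d,2) = 0,
    so that the two remaining homology spaces have the same dimension. *)
Lemma koszul_homology_dim n : (2 * d - 4 <= n)%N -> free_quot (syz n) (koszul n) tau.
Proof.
move=> dn; have [m em] : exists m, n = (m + d.-1)%N.
  by exists (n - d.-1)%N; rewrite subnK //; move: dn hd; lia.
have [|le1 S1] := @syz_dim n tau; first by apply: hilbert; move: dn hd; lia.
have [|le0 _] := @jacobian_dim (n + d.-1) tau; first by apply: hilbert; move: dn hd; lia.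
have [|le2 K1] := @koszul_dim m; first by move: dn hd; lia.
rewrite -em in K1.
have [le3 Q] := free_quot_quotient (submod_syz n) (submod_koszul n) (@koszul_syz n) S1 K1.
suff <- : (3 * 'C(n.+2, 2) - ('C((n + d.-1).+2, 2) - tau) -
  (3 * 'C(m.+2, 2) - 'C(m + 3 - d, 2)) = tau)%N by [].
have b2 k : (2 * 'C(k, 2) + k = k * k)%N.
  by elim: k => // k IH; rewrite binS bin1; lia.
have [e [d' [ee ed]]] : exists e d', m = (d' + e)%N /\ d = d'.+3.
  by exists (m + 3 - d)%N, (d - 3)%N; move: dn hd; lia.
have := b2 n.+2; have := b2 (n + d.-1).+2; have := b2 m.+2; have := b2 (m + 3 - d)%N.
have -> : (m + 3 - d = e)%N by lia.
have -> : (n + d.-1).+2 = (3 * d' + e + 6)%N by lia.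
have -> : m.+2 = (d' + e + 2)%N by lia.
have E : n.+2 = (2 * d' + e + 4)%N by lia.
move: le0 le1 le2 le3.
have -> : (n + d.-1).+2 = (3 * d' + e + 6)%N by lia.
have -> : (m + 3 - d = e)%N by lia.
have -> : m.+2 = (d' + e + 2)%N by lia.
rewrite E; clear; move: 'C(e, 2) 'C(d' + e + 2, 2) 'C(3 * d' + e + 6, 2) 'C(2 * d' + e + 4, 2).
move=> c0 c1 c2 c3 l0 l1 l2 l3 e0 e1 e2 e3.
(* The relations 2 C(k,2) + k = k^2 turn this into a polynomial identity. *)
have : (3 * c3 + c0 = c2 + 3 * c1)%N by lia.
by move: l0 l1 l2 l3; clear; lia.
Qed.

End KoszulComplex.

(** * Free curves *)

Lemma homog0_const (K : fieldType) n (p : {mpoly K[n]}) : p \is 0.-homog ->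
  exists c, p = c%:MP.
Proof.
elim/dhomog_ind: p / => [|c p q [a ->] [b ->]|m /eqP].
- by exists 0; rewrite mpolyC0.
- by exists (c * a + b); rewrite mpolyCD mpolyCM -mul_mpolyC.
- by rewrite mdeg_eq0 => /eqP ->; exists 1; rewrite mpolyX0 mpolyC1.
Qed.

Section NoConstantSyzygy.
Variables (K : numClosedFieldType) (d : nat) (f : 3.-tuple {mpoly K[2]}).
Variables (F : {mpoly K[3]}) (al be : K) (x : 'I_d -> K).
Hypotheses (hd : (1 < d)%N) (hf : forall i : 'I_3, tnth f i \is d.-homog).
Hypotheses (hF : F \is d.-homog) (F0 : F != 0) (Ff : F \mPo f = 0).
Local Notation g := (fhat f i2 - al *: fhat f i0 - be *: fhat f i1).
Hypotheses (gd : g`_d != 0) (gx : forall i, g.[x i] = 0).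
Hypothesis (f1x : forall i, (fhat f i1).[x i] != 0).
Local Notation y := (fun i => (fhat f i0).[x i] / (fhat f i1).[x i]).
Hypothesis y_inj : injective y.
Local Notation pull := (pull f).

Let sF := size_rhoF hd hf hF F0 Ff gd gx f1x y_inj.
Let cF := rhoF_separable hd hf hF F0 Ff gd gx f1x y_inj.

Lemma partial_nonzero : exists i, F^`M(i) != 0.
Proof.
apply: contrapT => /forallNP H.
have {}H i : F^`M(i) = 0 by apply/eqP; apply: contrapT => /negP; apply: H.
by have := G0_neq0 hd sF; rewrite !H scaler0 addr0 eqxx.
Qed.

(** A nonzero form of degree d-1 < d cannot vanish on the curve. *)
Lemma pull_partial_nonzero : exists i, pull F^`M(i) != 0.
Proof.
have [i Fi] := partial_nonzero; exists i; apply: contra Fi => /eqP pi.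
have hi := partial_homog hd hF i.
rewrite (low_degree_pull gd gx f1x y_inj hi _ pi) //.
by rewrite prednK // ltnW.
Qed.

(** Let c . dF = 0 with c constant. Along the curve, c, f and f' are all orthogonal
    to dF, so det(c, f, f') = 0: the projection of the curve from the point c is
    constant. If c lies off the line, this contradicts the fact that the d
    intersection points are distinct; if it lies on it, c is a syzygy of G0 and G1 of
    too small a degree. *)
Lemma no_constant_syzygy (c : 'I_3 -> K) : \sum_k (c k)%:MP * F^`M(k) = 0 -> forall k, c k = 0.
Proof.
move=> cE; pose cl := c i2 - al * c i0 - be * c i1.
have [cl0|cl0] := eqVneq cl 0.
  have h k : ((c k)%:MP : {mpoly K[3]}) \is 0.-homog.
    by rewrite -[_%:MP]mulr1 mul_mpolyC rpredZ // dhomog1.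
  have [|q [e1 e0]] := koszul_two hd hF sF cF (h i0) (h i1).
    rewrite -[RHS]cE sum_ord3.
    have -> : c i2 = al * c i0 + be * c i1 + cl by rewrite /cl; ring.
    by rewrite cl0 addr0 !mpolyCD !mpolyCM -!mul_mpolyC; ring.
  have c0 : c i0 = 0.
    apply/eqP; rewrite -(mpolyC_eq0 3); apply/eqP.
    by apply: homog_quotient_small (G1_homog be hd hF) (h i0) _ e1; move: hd; lia.
  have c1 : c i1 = 0.
    apply/eqP; rewrite -(mpolyC_eq0 3); apply/eqP; rewrite -mulNr in e0.
    by apply: homog_quotient_small (G0_homog al hd hF) (h i1) _ e0; move: hd; lia.
  by apply: ord3P => //; move: cl0; rewrite /cl c0 c1 !mulr0 !subr0.
have /(congr1 pull) := cE; rewrite rmorph0 rmorph_sum sum_ord3 !rmorphM /=.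
have pullC a : pull a%:MP = a%:P by apply: evC.
rewrite !pullC => pc.
have pr := pull_radial hf hF Ff; have pt := pull_tangent hf hF Ff.
rewrite !sum_ord3 in pr pt.
set P0 := pull _ in pc pr pt; set P1 := pull _ in pc pr pt; set P2 := pull _ in pc pr pt.
set u0 := fhat f i0 in pr pt; set u1 := fhat f i1 in pr pt; set u2 := fhat f i2 in pr pt.
pose D := (c i0)%:P * (u1 * u2^`() - u2 * u1^`()) + (c i1)%:P * (u2 * u0^`() - u0 * u2^`())
   + (c i2)%:P * (u0 * u1^`() - u1 * u0^`()).
have D0 : D = 0.
  have [k] := pull_partial_nonzero.
  have cancelD (P : {poly K}) : P * D = 0 -> P != 0 -> D = 0.
    by move=> /eqP; rewrite mulf_eq0 => /orP[/eqP ->|/eqP //]; rewrite eqxx.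
  move: k; apply: ord3P; apply: cancelD; rewrite -/P0 -/P1 -/P2.
  - transitivity (((c i0)%:P * P0 + (c i1)%:P * P1 + (c i2)%:P * P2) * (u1 * u2^`() - u2 * u1^`())
      + (P0 * u0 + P1 * u1 + P2 * u2) * ((c i2)%:P * u1^`() - (c i1)%:P * u2^`())
      + (P0 * u0^`() + P1 * u1^`() + P2 * u2^`()) * ((c i1)%:P * u2 - (c i2)%:P * u1)).
      by rewrite /D; ring.
    by rewrite pc pr pt !mul0r !addr0.
  - transitivity (((c i0)%:P * P0 + (c i1)%:P * P1 + (c i2)%:P * P2) * (u2 * u0^`() - u0 * u2^`())
      + (P0 * u0 + P1 * u1 + P2 * u2) * ((c i0)%:P * u2^`() - (c i2)%:P * u0^`())
      + (P0 * u0^`() + P1 * u1^`() + P2 * u2^`()) * ((c i2)%:P * u0 - (c i0)%:P * u2)).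
      by rewrite /D; ring.
    by rewrite pc pr pt !mul0r !addr0.
  - transitivity (((c i0)%:P * P0 + (c i1)%:P * P1 + (c i2)%:P * P2) * (u0 * u1^`() - u1 * u0^`())
      + (P0 * u0 + P1 * u1 + P2 * u2) * ((c i1)%:P * u0^`() - (c i0)%:P * u1^`())
      + (P0 * u0^`() + P1 * u1^`() + P2 * u2^`()) * ((c i0)%:P * u1 - (c i1)%:P * u0)).
      by rewrite /D; ring.
    by rewrite pc pr pt !mul0r !addr0.
(* These two polynomials are the coordinates of the projection from c onto the
   line; their Wronskian is - cl D. *)
pose gg := u2 - al *: u0 - be *: u1.
have [|l [m [lm e]]] := @wronskian_proportional K (cl *: u0 - c i0 *: gg) (cl *: u1 - c i1 *: gg).
  apply/eqP; rewrite -subr_eq0; apply/eqP; transitivity (- (cl%:P * D)).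
    rewrite /D /gg !(derivB, derivZ) -!mul_polyC.
    have -> : c i2 = al * c i0 + be * c i1 + cl by rewrite /cl; ring.
    by rewrite !polyCD !polyCM; ring.
  by rewrite D0 mulr0 oppr0.
have lmE i : l * y i + m = 0.
  have [z [ez e0]] : exists z, z = u0.[x i] / u1.[x i] /\ u0.[x i] = z * u1.[x i].
    by exists (u0.[x i] / u1.[x i]); rewrite divfK.
  rewrite -/u0 -/u1 -ez; have := congr1 (fun p : {poly K} => p.[x i]) e.
  have ggx : u2.[x i] - al * u0.[x i] - be * u1.[x i] = 0.
    by rewrite -[RHS](gx i) !(hornerD, hornerN, hornerZ).
  rewrite /= hornerD !hornerZ !(hornerD, hornerN, hornerZ) ?ggx.
  rewrite !mulr0 !subr0 horner0 e0 => E; apply: (mulIf (f1x i)); apply: (mulfI cl0).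
  by rewrite mul0r mulr0 -[RHS]E -/u1; ring.
have lt0 : (0 < d)%N by apply: ltnW.
pose a0 := Ordinal lt0; pose a1 := Ordinal hd.
have l0 : l = 0.
  have /addIr/eqP : l * y a0 + m = l * y a1 + m by rewrite !lmE.
  rewrite -subr_eq0 -mulrBr mulf_eq0.
  by case/orP => [/eqP //|]; rewrite subr_eq0 => /eqP/y_inj/(congr1 val).
move: lm; have := lmE a0; rewrite l0 mul0r add0r => ->.
by rewrite eqxx.
Qed.

End NoConstantSyzygy.

Section ShiftedForms.
Variable K : fieldType.

(** Forms of degree n - a, this being a possibly negative integer: the degrees of
    multipliers of a form of degree a. *)
Definition shifted n a (k : {mpoly K[3]}) : Prop :=
  if (a <= n)%N then is_true (k \is (n - a).-homog) else k = 0.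

Lemma submod_shifted n a : submod (shifted n a).
Proof.
by rewrite /shifted; case: (a <= n)%N; [apply: submod_homog | apply: submod_zero].
Qed.

Lemma shifted_dim n a : free_quot (shifted n a) (fun k => k = 0) 'C(n.+2 - a, 2).
Proof.
rewrite /shifted; case: (leqP a n) => an.
  by rewrite !subSn ?(leqW an) //; apply: homog_dim.
rewrite bin_small; last by move: an; lia.
apply/free_quotP; [exact: submod_zero|exact: submod_zero|split=> //].
exists (fun=> 0); split=> [x u v _ _|//|c].
  by rewrite scaler0 addr0.
by exists 0; rewrite // [c]thinmx0.
Qed.

Lemma shifted_homog n e k (p : {mpoly K[3]}) : p \is e.-homog -> shifted n e k ->
  k * p \is n.-homog.
Proof.
move=> hp; rewrite /shifted; case: leqP => en hk; last by rewrite hk mul0r rpred0.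
by have := dhomogM hk hp; rewrite subnK.
Qed.

Definition shift_part n a (k : {mpoly K[3]}) := if (a <= n)%N then pihomog mdeg (n - a) k else 0.

Lemma shift_partP n a k : shifted n a (shift_part n a k).
Proof. by rewrite /shifted /shift_part; case: (a <= n)%N => //; apply: pihomogP. Qed.

Lemma pihomog_shift n e k (p : {mpoly K[3]}) : p \is e.-homog ->
  pihomog mdeg n (k * p) = shift_part n e k * p.
Proof.
move=> hp; rewrite /shift_part; case: leqP => en.
  by rewrite -{1}(subnK en) (pihomogM _ _ hp).
by rewrite mul0r (pihomogM_small _ hp).
Qed.

End ShiftedForms.

(** The value of the Hilbert function of a Hilbert-Burch quotient with generators
    of degrees a and b: once M >= a and M >= b, all binomials are quadratic
    polynomials in M, and their alternating sum is constant. *)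
Lemma free_count a b M : (a <= M)%N -> (b <= M)%N ->
  ('C(M - a, 2) + 'C(M - b, 2) <= 3 * 'C(M, 2))%N ->
  (3 * 'C(M, 2) - ('C(M - a, 2) + 'C(M - b, 2)) <= 'C(M + (a + b), 2))%N ->
  ('C(M + (a + b), 2) - (3 * 'C(M, 2) - ('C(M - a, 2) + 'C(M - b, 2))) =
   (a + b) * (a + b) - a * b)%N.
Proof.
have b2 k : (2 * 'C(k, 2) + k = k * k)%N.
  by elim: k => // k IH; rewrite binS bin1; lia.
move=> aM bM; wlog leab : a b aM bM / (a <= b)%N.
  move=> W; case: (leqP a b) => [|/ltnW] lt; first exact: W.
  by rewrite [(a + b)%N]addnC [('C(M - a, 2) + _)%N]addnC [(a * b)%N]mulnC; apply: W.
have [t et] : exists t, b = (a + t)%N by exists (b - a)%N; rewrite subnKC.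
have [p ep] : exists p, M = (a + t + p)%N by exists (M - b)%N; rewrite -et subnKC.
have -> : (M - b = p)%N by lia.
have -> : (M - a = t + p)%N by lia.
move: (b2 M) (b2 p) (b2 (t + p)%N) (b2 (M + (a + b))%N).
move: 'C(M, 2) 'C(p, 2) 'C(t + p, 2) 'C(M + (a + b), 2) => cM cp ct cA.
rewrite {}ep {}et; clear => e0 e1 e2 e3 l0 l1.
(* Here cA, cM, ct, cp are the binomials of M + a + b, M, M - a and M - b. *)
have : (cA + ct + cp + a * (a + t) = (a + (a + t)) * (a + (a + t)) + 3 * cM)%N by lia.
by move: l0 l1; clear; lia.
Qed.

Section FreeCurve.
Variables (K : numClosedFieldType) (d : nat) (F : {mpoly K[3]}).
Hypotheses (hd : (2 < d)%N) (hF : F \is d.-homog).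
Hypothesis partial_parallel : forall e (u : 'I_3 -> {mpoly K[3]}),
  (forall i, u i \is e.-homog) ->
  (forall i j, u i * F^`M(j) = u j * F^`M(i)) -> exists k, forall i, u i = k * F^`M(i).
Hypothesis partial_neq0 : exists i, F^`M(i) != 0.
Local Notation grad := (fun i => F^`M(i)).
Local Notation "u _|_ 'dF'" := (\sum_i u i * F^`M(i) = 0) (at level 70).

(** The homogeneous components of u are parallel to dF one by one. *)
Lemma parallel_any (u : 'I_3 -> {mpoly K[3]}) :
  (forall i j, u i * F^`M(j) = u j * F^`M(i)) -> exists k, forall i, u i = k * F^`M(i).
Proof.
move=> uF.
have /choice [k Hk] : forall e, exists k, forall i, pihomog mdeg e (u i) = k * F^`M(i).
  move=> e; apply: (partial_parallel (e := e)) => [i|i j]; first exact: pihomogP.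
  by rewrite -!(pihomogM _ _ (grad_homog hd hF _)) uF.
pose N := (msize (u i0) + msize (u i1) + msize (u i2))%N.
exists (\sum_(e < N) k e) => i; rewrite mulr_suml.
have uN : (msize (u i) <= N)%N by move: i; apply: ord3P; rewrite /N; lia.
rewrite [LHS](pihomog_partitionE uN).
by apply: eq_bigr => e _; apply: Hk.
Qed.

(** Over a field, both vectors lie in the plane orthogonal to dF; the
    factor is a polynomial by exactness of the Koszul complex. *)
Lemma cross_parallel (u v : 'I_3 -> {mpoly K[3]}) : u _|_ dF -> v _|_ dF ->
  exists k, forall i, cross u v i = k * F^`M(i).
Proof.
rewrite !sum_ord3 => uF vF; apply: parallel_any.
set A := (X in X = _) in uF; set B := (X in X = _) in vF.
have E (p q a b : {mpoly K[3]}) : p - q = a * A - b * B -> p = q.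
  by rewrite uF vF !mulr0 subrr => /eqP; rewrite subr_eq0 => /eqP.
have e01 : cross u v i0 * F^`M(i1) = cross u v i1 * F^`M(i0).
  by apply: (E _ _ (v i2) (u i2)); rewrite /A /B !ffunE /=; ring.
have e12 : cross u v i1 * F^`M(i2) = cross u v i2 * F^`M(i1).
  by apply: (E _ _ (v i0) (u i0)); rewrite /A /B !ffunE /=; ring.
have e20 : cross u v i2 * F^`M(i0) = cross u v i0 * F^`M(i2).
  by apply: (E _ _ (v i1) (u i1)); rewrite /A /B !ffunE /=; ring.
by apply: ord3P; apply: ord3P.
Qed.

Lemma cancel_partial k l : (forall i, k * F^`M(i) = l * F^`M(i)) -> k = l.
Proof. by move=> H; have [i Fi] := partial_neq0; apply: (mulIf Fi). Qed.

Lemma syz_part e u : u _|_ dF -> syz F e [ffun i => pihomog mdeg e (u i)].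
Proof.
move=> uF; split=> [i|]; first by rewrite ffunE; apply: pihomogP.
under eq_bigr do rewrite ffunE -(pihomogM _ _ (grad_homog hd hF _)).
by rewrite -raddf_sum uF raddf0.
Qed.

Lemma meval_homog0 n (p : {mpoly K[3]}) : p \is n.+1.-homog -> p.@[fun=> 0] = 0.
Proof.
move=> hp; transitivity (p.@[fun=> 0 * 0 : K]).
  by apply: meval_eq => i; rewrite mul0r.
by rewrite (meval_homog 0 (fun=> 0) hp) exprS !mul0r.
Qed.

(** A basis e0, e1 has e0 x e1 = w dF; expressing the Koszul syzygies in this basis shows
    that w divides the partial derivatives, so w is invertible. A pair of homogeneous
    components whose vector product is k dF with k(0) <> 0 then exists, and k is a
    constant for reasons of degree. This replaces the graded Nakayama lemma. *)
Lemma free_curve_basis : free_curve F ->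
  exists a b (r s : vec K) (c : K), [/\ (a + b = d.-1)%N, syz F a r, syz F b s, c != 0 &
    forall i, cross r s i = c *: F^`M(i)].
Proof.
move=> [_ [e [eAR He]]].
pose u i := e j0 0 i; pose v i := e j1 0 i.
have uF : u _|_ dF by exact: (eAR j0).
have vF : v _|_ dF by exact: (eAR j1).
have [w Hw] := cross_parallel uF vF.
have span (z : vec K) : z _|_ dF -> exists l m, forall i, z i = l * u i + m * v i.
  move=> zF; have [|c [Hc _]] := He (\row_i z i).
    by rewrite /AR -[RHS]zF; apply: eq_bigr => i _; rewrite mxE.
  exists (c 0 j0), (c 0 j1) => i; move/matrixP/(_ 0 i): Hc.
  rewrite big_ord_recl big_ord1 !mxE => /eqP; rewrite subr_eq0 => /eqP ->.
  by congr (c 0 _ * e _ 0 i + c 0 _ * e _ 0 i); apply: val_inj.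
(* The vector product of the Koszul syzygies
   dF x e_i and dF x e_j is, up to sign, dF_k times dF, and a minor times w dF. *)
have wF i : exists D, F^`M(i) = D * w.
  have kosF (a : vec K) : cross grad a _|_ dF by rewrite sum_ord3 !ffunE /=; ring.
  pose delta j : vec K := [ffun k => (k == j)%:R].
  have [l0 [m0 E0]] := span _ (kosF (delta i0)).
  have [l1 [m1 E1]] := span _ (kosF (delta i1)).
  have [l2 [m2 E2]] := span _ (kosF (delta i2)).
  have W : forall k, cross u v k = w * F^`M(k) by [].
  have key (l m l' m' : {mpoly K[3]}) (z z' : vec K) k :
     (forall i, z i = l * u i + m * v i) -> (forall i, z' i = l' * u i + m' * v i) ->
     cross z z' k = (l * m' - m * l') * w * F^`M(k).
    move=> Ez Ez'; rewrite -mulrA -W.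
    by move: k; apply: ord3P; rewrite !ffunE /= !Ez !Ez'; ring.
  have [k Fk] := partial_neq0.
  move: i; apply: ord3P.
  - exists (l1 * m2 - m1 * l2); apply: (mulIf Fk); rewrite -(key _ _ _ _ _ _ k E1 E2).
    by move: (k); apply: ord3P; rewrite !ffunE /= ?ffunE /=; ring.
  - exists (l2 * m0 - m2 * l0); apply: (mulIf Fk); rewrite -(key _ _ _ _ _ _ k E2 E0).
    by move: (k); apply: ord3P; rewrite !ffunE /= ?ffunE /=; ring.
  - exists (l0 * m1 - m0 * l1); apply: (mulIf Fk); rewrite -(key _ _ _ _ _ _ k E0 E1).
    by move: (k); apply: ord3P; rewrite !ffunE /= ?ffunE /=; ring.
have w0 : w.@[fun=> 0] != 0.
  have /choice [D HD] := wF.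
  have [|k Hk] := @parallel_any D.
    by move=> i j; rewrite !HD; ring.
  have wk : k * w = 1.
    apply: cancel_partial => i; rewrite mul1r [RHS]HD Hk; ring.
  apply/eqP => w0; have := congr1 (meval (fun=> 0)) wk.
  by rewrite mevalM w0 mulr0 meval1 => /esym/eqP; rewrite oner_eq0.
pose up n : vec K := [ffun i => pihomog mdeg n (u i)].
pose vp n : vec K := [ffun i => pihomog mdeg n (v i)].
(* w is the sum of the factors k (a, b) of all pairs of components, and w(0) <> 0. *)
have /choice [k Hk] : forall ab : nat * nat, exists k, forall i,
    cross (up ab.1) (vp ab.2) i = k * F^`M(i).
  by move=> [a b]; apply: cross_parallel; [case: (syz_part a uF) | case: (syz_part b vF)].
pose N := (msize (u i0) + msize (u i1) + msize (u i2) +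
           (msize (v i0) + msize (v i1) + msize (v i2)))%N.
have uN i : u i = \sum_(n < N) up n i.
  under eq_bigr do rewrite ffunE.
  by apply: pihomog_partitionE; move: i; apply: ord3P; rewrite /N; lia.
have vN i : v i = \sum_(n < N) vp n i.
  under eq_bigr do rewrite ffunE.
  by apply: pihomog_partitionE; move: i; apply: ord3P; rewrite /N; lia.
have wE : w = \sum_(a < N) \sum_(b < N) k (val a, val b).
  apply: cancel_partial => i; rewrite -Hw mulr_suml.
  under eq_bigr do rewrite mulr_suml.
  under eq_bigr => a _ do under eq_bigr => b _ do rewrite -Hk.
  move: i; apply: ord3P; rewrite !ffunE /= !uN !vN !big_distrlr /= -sumrB;
    by apply: eq_bigr => a _; rewrite -sumrB; apply: eq_bigr => b _; rewrite !ffunE.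
have [a [b kab]] : exists a b, (k (a, b)).@[fun=> 0] != 0.
  apply: contrapT => H; move/eqP: w0; apply.
  rewrite wE raddf_sum big1 // => a _; rewrite raddf_sum big1 // => b _.
  apply/eqP; apply: contrapT => /negP Hab; apply: H.
  by exists (val a), (val b).
have hup n i : up n i \is n.-homog by rewrite ffunE; apply: pihomogP.
have hvp n i : vp n i \is n.-homog by rewrite ffunE; apply: pihomogP.
have hc : homog_vec (a + b) (cross (up a) (vp b)).
  have [e0 e1 e2] := crossE (up a) (vp b).
  by apply: ord3P; rewrite ?e0 ?e1 ?e2; apply: rpredB; apply: dhomogM.
have [j Fj] := partial_neq0.
have hF' := grad_homog hd hF.
have ab : (a + b = d.-1)%N.
  have := hc j; rewrite (Hk (a, b)) => hkF.
  have k0 : k (a, b) != 0 by apply: contraNneq kab => ->; rewrite meval0.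
  have [lt|le] := ltnP (a + b) d.-1.
    have := homog_quotient_small (hF' j) hkF lt erefl => /eqP.
    by rewrite mulf_eq0 (negbTE k0) (negbTE Fj).
  have [m em] : exists m, (a + b = m + d.-1)%N by exists (a + b - d.-1)%N; rewrite subnK.
  rewrite em in hkF; have [k' hk' ek'] := homog_quotient (hF' j) hkF erefl.
  have ekk : k (a, b) = k' by apply: (mulIf Fj).
  case: m em hkF hk' => [//|m] em hkF hk'.
  by move: kab; rewrite ekk (meval_homog0 hk') eqxx.
have [c ec] : exists c, k (a, b) = c%:MP.
  have := hc j; rewrite (Hk (a, b)) ab => hkF.
  have [k' hk' ek'] := homog_quotient (m := 0) (hF' j) hkF erefl.
  have -> : k (a, b) = k' by apply: (mulIf Fj).
  exact: homog0_const hk'.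
exists a, b, (up a), (vp b), c; split=> //.
- exact: syz_part.
- exact: syz_part.
- by move: kab; rewrite ec mevalC.
- by move=> i; rewrite (Hk (a, b)) ec mul_mpolyC.
Qed.

Section WithBasis.
Variables (a b : nat) (r s : vec K) (c : K).
Hypotheses (rS : syz F a r) (sS : syz F b s) (c0 : c != 0).
Hypothesis rs : forall i, cross r s i = c *: F^`M(i).

Lemma cross_eq0_parallel (p q : 'I_3 -> {mpoly K[3]}) : (forall i, cross p q i = 0) ->
  forall i j, p i * q j = p j * q i.
Proof.
move=> pq; have := pq i0; have := pq i1; have := pq i2; rewrite !ffunE /=.
move=> /eqP; rewrite subr_eq0 => /eqP e2 /eqP; rewrite subr_eq0 => /eqP e1 /eqP.
by rewrite subr_eq0 => /eqP e0; apply: ord3P; apply: ord3P.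
Qed.

(** Because r x s is nonzero, r and s are independent. *)
Lemma parallel_both_eq0 (z : 'I_3 -> {mpoly K[3]}) :
  (forall i, cross z s i = 0) -> (forall i, cross r z i = 0) -> forall i, z i = 0.
Proof.
move=> /cross_eq0_parallel zs /cross_eq0_parallel rz w.
have Z p q : z w * (r p * s q - r q * s p) = 0.
  transitivity (r p * (z w * s q) - r q * (z w * s p)); first by ring.
  rewrite (zs w q) (zs w p).
  transitivity (s w * (r p * z q - r q * z p)); first by ring.
  by rewrite (rz p q) subrr mulr0.
have [u] := partial_neq0.
have Fu : F^`M(u) != 0 -> z w * cross r s u = 0 -> z w = 0.
  by move=> Fu /eqP; rewrite rs mulf_eq0 scaler_eq0 (negbTE c0) (negbTE Fu) !orbF => /eqP.
move=> /Fu; apply; have [e0 e1 e2] := crossE r s.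
by move: (u); apply: ord3P; rewrite ?e0 ?e1 ?e2.
Qed.

(** Cramer's rule: z x s and r x z are multiples of dF, with factors the
    coordinates of z up to the constant c. *)
Lemma basis_decomposition n z : syz F n z ->
  exists k l, [/\ shifted n a k, shifted n b l & z = [ffun i => k * r i + l * s i]].
Proof.
move=> [hz zF]; have [hr rF] := rS; have [hs sF] := sS.
have [k Hk] := cross_parallel zF sF; have [l Hl] := cross_parallel rF zF.
have zE i : c *: z i - (k * r i + l * s i) = 0.
  apply: (parallel_both_eq0 (z := fun i => c *: z i - (k * r i + l * s i))) i.
  - move=> i; transitivity (c *: cross z s i - k * cross r s i).
      by move: i; apply: ord3P; rewrite !ffunE /= -!mul_mpolyC; ring.
    by rewrite rs Hk -!mul_mpolyC; ring.
  - move=> i; transitivity (c *: cross r z i - l * cross r s i).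
      by move: i; apply: ord3P; rewrite !ffunE /= -!mul_mpolyC; ring.
    by rewrite rs Hl -!mul_mpolyC; ring.
exists (shift_part n a (c^-1 *: k)), (shift_part n b (c^-1 *: l)).
split; [exact: shift_partP|exact: shift_partP|apply/ffunP => i].
rewrite ffunE -(pihomog_shift _ _ (hr i)) -(pihomog_shift _ _ (hs i)) -pihomogD.
rewrite -!scalerAl -scalerDr; have /eqP := zE i; rewrite subr_eq0 => /eqP <-.
by rewrite scalerA mulVf // scale1r pihomog_dE.
Qed.

Lemma multiple_syz n e l (u : vec K) : syz F e u -> shifted n e l ->
  syz F n [ffun i => l * u i].
Proof.
move=> [hu uF] hl; split=> [i|]; first by rewrite ffunE; apply: shifted_homog hl.
under eq_bigr do rewrite ffunE -mulrA.
by rewrite -mulr_sumr uF mulr0.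
Qed.

Lemma free_syz_dim n :
  free_quot (syz F n) (fun u => u = 0) ('C(n.+2 - a, 2) + 'C(n.+2 - b, 2)).
Proof.
have [j Fj] := partial_neq0; have z0 := @submod_zero K (vec K).
pose U (u : vec K) := exists2 l, shifted n b l & u = [ffun i => l * s i].
have sY := submod_syz F n; have sA := submod_shifted K n a; have sB := submod_shifted K n b.
have sU : submod U.
  split; first by exists 0; [case: sB | apply/ffunP => i; rewrite !ffunE mul0r].
  move=> x _ _ [l hl ->] [m hm ->]; exists (x *: l + m); first by apply: sB.2.
  by apply/ffunP => i; rewrite !ffunE mulrDl scalerAl.
have nz l : (forall i, l * cross r s i = 0) -> l = 0.
  move=> /(_ j)/eqP; rewrite rs mulf_eq0 scaler_eq0 (negbTE c0) (negbTE Fj) !orbF.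
  by move/eqP.
have US u : U u -> syz F n u by move=> [l hl ->]; apply: multiple_syz sS hl.
apply: (free_quot_trans sY sU z0).
  apply: (free_quot_image (h := fun k => [ffun i => k * r i] : vec K) _ sA
    (@submod_zero _ _) sY sU _ _ US _ _ _).1 (shifted_dim K n a).
  - by move=> x k l; apply/ffunP => i; rewrite !ffunE mulrDl scalerAl.
  - by move=> k ->; case: sA.
  - by move=> k hk; apply: multiple_syz rS hk.
  - move=> z /basis_decomposition [k [l [hk hl ->]]]; exists k => //; exists l => //.
    by apply/ffunP => i; rewrite !ffunE addrC addKr.
  - move=> k hk; split=> [->|[l hl /ffunP e]].
      by exists 0; [case: sB | apply/ffunP => i; rewrite !ffunE !mul0r].
    have {}e i : k * r i = l * s i by have := e i; rewrite !ffunE.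
    have [e0 e1 e2] := crossE r s.
    by apply: nz; apply: ord3P; rewrite ?e0 ?e1 ?e2 mulrBr !mulrA !e; ring.
apply: (free_quot_image (h := fun k => [ffun i => k * s i] : vec K) _ sB
    (@submod_zero _ _) sU z0 _ _ _ _ _ _).1 (shifted_dim K n b).
- by move=> x k l; apply/ffunP => i; rewrite !ffunE mulrDl scalerAl.
- by move=> k ->; case: sB.
- by move=> u ->; case: sU.
- by move=> k hk; exists k.
- by move=> _ [l hl ->]; exists l; rewrite // subrr.
- move=> k hk; split=> [->|/ffunP e]; first by apply/ffunP => i; rewrite !ffunE mul0r.
  have {}e i : k * s i = 0 by have := e i; rewrite !ffunE.
  have [e0 e1 e2] := crossE r s.
  by apply: nz; apply: ord3P; rewrite ?e0 ?e1 ?e2 mulrBr mulrCA [k * (_ * s _)]mulrCA !e !mulr0 subrr.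
Qed.

Hypothesis ab : (a + b = d.-1)%N.

(** J is the quotient of S^3 by AR, which is free on r and s. *)
Lemma free_hilbert_step n : (a <= n.+2)%N -> (b <= n.+2)%N ->
  free_quot (fun p : {mpoly K[3]} => p \is (n + d.-1).-homog)
    (fun p => p \is (n + d.-1).-homog /\ jacobian_ideal F p) (d.-1 * d.-1 - a * b).
Proof.
move=> an bn; have sY := submod_syz F n; have sV := submod_homog_vec K n.
have sJ := submod_jacobian F (n + d.-1); have sH := submod_homog K 3 (n + d.-1).
have [le Q] := free_quot_quotient sV sY (fun u H => H.1) (homog_vec_dim K n) (free_syz_dim n).
have J : free_quot (fun p => p \is (n + d.-1).-homog /\ jacobian_ideal F p) (fun p => p = 0)
     (3 * 'C(n.+2, 2) - ('C(n.+2 - a, 2) + 'C(n.+2 - b, 2))).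
  by apply/(jacobian_syz hd hF).
have [le' H] := free_quot_quotient sH sJ (fun u H => H.1) (homog_dim K _) J.
suff <- : ('C((n + d.-1).+2, 2) - (3 * 'C(n.+2, 2) - ('C(n.+2 - a, 2) + 'C(n.+2 - b, 2))) =
   d.-1 * d.-1 - a * b)%N by [].
move: le le'; rewrite -addSn -addSn -ab; move: (n.+2) an bn => M aM bM.
by move=> le le'; apply: free_count.
Qed.

End WithBasis.

(** The formula of [free_hilbert_step] needs a, b <= n + 2, and both are at most
    d - 2 since neither vanishes; in degrees large enough it identifies tau with
    (d-1)^2 - ab. The remaining degree m < d - 1 occurs only for d = 3, m = 1. *)
Lemma free_hilbert tau : free_curve F -> global_tjurina F tau ->
  (forall c : 'I_3 -> K, \sum_k (c k)%:MP * F^`M(k) = 0 -> forall k, c k = 0) ->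
  forall m, (2 * d - 5 <= m)%N ->
  free_quot (fun p : {mpoly K[3]} => p \is m.-homog)
            (fun p => p \is m.-homog /\ jacobian_ideal F p) tau.
Proof.
move=> free [k0 Hk] noconst m dm.
have [a [b [r [s [c [ab rS sS c0 rs]]]]]] := free_curve_basis free.
have [j Fj] := partial_neq0.
have const0 (u : vec K) : syz F 0 u -> forall i, u i = 0.
  move=> [hu uF]; have /choice [e He] : forall i, exists e, u i = e%:MP.
    by move=> i; apply: homog0_const.
  have e0 : forall i, e i = 0.
    by apply: noconst; rewrite -[RHS]uF; apply: eq_bigr => i _; rewrite He.
  by move=> i; rewrite He e0 mpolyC0.
have cF : c *: F^`M(j) != 0 by rewrite scaler_eq0 (negbTE c0) (negbTE Fj).
have a0 : (0 < a)%N.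
  rewrite lt0n; apply/eqP => a0; rewrite a0 in rS; have r0 := const0 _ rS.
  move: cF; rewrite -rs (_ : cross r s j = 0) ?eqxx //.
  by move: (j); apply: ord3P; rewrite !ffunE /= !r0 !mul0r subrr.
have b0 : (0 < b)%N.
  rewrite lt0n; apply/eqP => b0; rewrite b0 in sS; have s0 := const0 _ sS.
  move: cF; rewrite -rs (_ : cross r s j = 0) ?eqxx //.
  by move: (j); apply: ord3P; rewrite !ffunE /= !s0 !mulr0 subrr.
have step n := free_hilbert_step rS sS c0 rs ab (n := n).
have -> : tau = (d.-1 * d.-1 - a * b)%N.
  have H1 := Hk (k0 + d + d.-1)%N; have H2 := step (k0 + d)%N.
  apply: (free_quot_uniq (submod_homog K 3 _) (submod_jacobian F _) (H1 _) (H2 _ _));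
    by move: ab a0 b0 hd; lia.
have [lt|le] := ltnP m d.-1.
  have -> : (d.-1 * d.-1 - a * b = 'C(m.+2, 2))%N.
    have d3 : d = 3%N by move: dm lt hd; lia.
    have m1 : m = 1%N by move: dm lt hd; rewrite d3; lia.
    have a1 : a = 1%N by move: ab a0 b0; rewrite d3; lia.
    have b1 : b = 1%N by move: ab a0 b0; rewrite d3; lia.
    by rewrite d3 m1 a1 b1.
  apply: (free_quot_image (h := id) _ (submod_homog K 3 m) (@submod_zero _ _)
    (submod_homog K 3 m) (submod_jacobian F m) _ _ _ _ _ _).1 (homog_dim K m) => //.
  - by move=> p ->; apply: rpred0.
  - by move=> p [].
  - by move=> p hp; exists p => //; rewrite subrr; case: (submod_jacobian F m).
  - move=> p hp; split=> [->|[_ jp]]; first by case: (submod_jacobian F m).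
    exact: (jacobian_small (ltnW hd) hF hp lt jp).
have [n en] : exists n, m = (n + d.-1)%N by exists (m - d.-1)%N; rewrite subnK.
by rewrite en; apply: step; move: dm ab a0 b0 hd; rewrite en; lia.
Qed.

End FreeCurve.

(** * Logarithmic 1-forms and 2-forms modulo the trivial ones *)

Lemma vec_linE (K : fieldType) c (u v : vec K) i : (c *: u + v) i = c *: u i + v i.
Proof. by rewrite !ffunE. Qed.

Lemma vec_subE (K : fieldType) (u v : vec K) i : (u - v) i = u i - v i.
Proof. by rewrite !ffunE. Qed.

Lemma vec0E (K : fieldType) i : (0 : vec K) i = 0.
Proof. exact: ffunE. Qed.

Lemma vecNE (K : fieldType) (u : vec K) i : (- u) i = - u i.
Proof. exact: ffunE. Qed.

Section LogarithmicForms.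
Variables (K : numClosedFieldType) (d : nat) (F : {mpoly K[3]}).
Hypotheses (hd : (2 < d)%N) (hF : F \is d.-homog) (F0 : F != 0).
Hypothesis partial_parallel : forall e (u : 'I_3 -> {mpoly K[3]}),
  (forall i, u i \is e.-homog) ->
  (forall i j, u i * F^`M(j) = u j * F^`M(i)) -> exists k, forall i, u i = k * F^`M(i).
Variable n : nat.
Local Notation grad := (fun i => F^`M(i)).
Local Notation X := (fun i => 'X_i : {mpoly K[3]}).

Let d0 : d%:R != 0 :> K.
Proof. by rewrite pnatr_eq0; move: hd; lia. Qed.

Lemma euler3 : 'X_i0 * F^`M(i0) + 'X_i1 * F^`M(i1) + 'X_i2 * F^`M(i2) = d%:R%:MP * F.
Proof. by rewrite -[LHS](sum_ord3 (fun i => 'X_i * F^`M(i))) (euler hF) mul_mpolyC. Qed.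

(** The double vector product formula together with Euler's relation. *)
Lemma grad_cross_X (u : 'I_3 -> {mpoly K[3]}) :
  forall i, cross grad (cross u X) i = d%:R%:MP * F * u i - (\sum_i u i * F^`M(i)) * 'X_i.
Proof.
by rewrite -euler3 sum_ord3; apply: ord3P; rewrite !ffunE /= ?ffunE /=; ring.
Qed.

Lemma cross_koszul_X (u : 'I_3 -> {mpoly K[3]}) :
  forall i, cross (cross grad u) X i = d%:R%:MP * F * u i - (\sum_i u i * 'X_i) * F^`M(i).
Proof.
by rewrite -euler3 sum_ord3; apply: ord3P; rewrite !ffunE /= ?ffunE /=; ring.
Qed.

Lemma cross_X_homog m u : homog_vec m u -> homog_vec m.+1 (cross u X).
Proof.
move=> hu; have [e0 e1 e2] := crossE u X.
have H i j : u i * 'X_j \is m.+1.-homog.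
  by have := dhomogM (hu i) (homogX1 K j); rewrite addn1.
by apply: ord3P; rewrite ?e0 ?e1 ?e2; apply: rpredB.
Qed.

Lemma cross_X_linear c (u v : vec K) : cross (c *: u + v) X = c *: cross u X + cross v X.
Proof.
apply/ffunP; apply: ord3P; rewrite !ffunE /= ?ffunE /= ?ffunE -!mul_mpolyC; ring.
Qed.

Definition shifted_vec m e (b : vec K) := forall i, shifted m e (b i).

Lemma submod_shifted_vec m e : submod (shifted_vec m e).
Proof.
have [s0 sD] := submod_shifted K m e.
by split=> [i|c u v hu hv i]; rewrite !ffunE //; apply: sD.
Qed.

Lemma shifted_mulF m (k : {mpoly K[3]}) : shifted m d k -> F * k \is m.-homog.
Proof. by move=> hk; rewrite mulrC; apply: shifted_homog hk. Qed.

Lemma shifted_grad m i (k : {mpoly K[3]}) : shifted m.+1 d k -> k * F^`M(i) \is m.-homog.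
Proof.
move=> hk; apply: (shifted_homog (grad_homog hd hF i)); move: hk; rewrite /shifted.
have -> : (d.-1 <= m)%N = (d <= m.+1)%N by move: hd; lia.
by case: (leqP d m.+1) => // le; have -> : (m - d.-1 = m.+1 - d)%N by move: hd; lia.
Qed.

Lemma homog_shifted m (k : {mpoly K[3]}) : k \is m.-homog -> shifted (m + d) d k.
Proof. by rewrite /shifted leq_addl addnK. Qed.

(** [log1] and [rel1] are the coefficient vectors of the 1-forms of degree n + 3
    that vanish on the curve, see [tangent_log], and of those in F Omega^1 + S dF. Starting
    at degree 3 keeps the degrees of the coefficients natural numbers. *)
Definition log1 (u : vec K) : Prop :=
  homog_vec n.+2 u /\ exists eta : vec K, forall i, cross grad u i = eta i * F.

Definition rel1 (u : vec K) : Prop :=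
  exists (b : vec K) (c : {mpoly K[3]}), [/\ shifted_vec n.+2 d b, shifted n.+3 d c &
    u = [ffun i => F * b i + c * F^`M(i)]].

Lemma submod_log1 : submod log1.
Proof.
have [s0 sD] := submod_homog_vec K n.+2; split.
  split=> //; exists 0; apply: ord3P; rewrite !ffunE /= ?ffunE; ring.
move=> c u v [hu [eta Hu]] [hv [th Hv]]; split; first exact: sD.
exists (c *: eta + th) => i; rewrite cross_linear !vec_linE Hu Hv.
rewrite -!mul_mpolyC; ring.
Qed.

Lemma submod_rel1 : submod rel1.
Proof.
have [b0 bD] := submod_shifted_vec n.+2 d; have [c0 cD] := submod_shifted K n.+3 d; split.
  by exists 0, 0; split=> //; apply/ffunP => i; rewrite !ffunE mulr0 mul0r addr0.
move=> x _ _ [b [c [hb hc ->]]] [b' [c' [hb' hc' ->]]].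
exists (x *: b + b'), (x *: c + c'); split; [exact: bD|exact: cD|].
apply/ffunP => i; rewrite !ffunE -!mul_mpolyC; ring.
Qed.

Lemma rel1_log1 u : rel1 u -> log1 u.
Proof.
move=> [b [c [hb hc ->]]]; split=> [i|].
  by rewrite ffunE; apply: rpredD; [apply: shifted_mulF; apply: hb | apply: shifted_grad hc].
exists (cross grad b); apply: ord3P; rewrite !ffunE /= ?ffunE; ring.
Qed.

(** The inverse of r |-> r x E: if dF x v = F eta, then eta/d is a syzygy, and v differs
    from its product with E by a multiple of dF, since their products with dF
    agree. *)
Lemma log1_dim tau : free_quot (syz F n.+1) (koszul F n.+1) tau -> free_quot log1 rel1 tau.
Proof.
have mulFI (p q : {mpoly K[3]}) : F * p = F * q -> p = q by apply: mulfI.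
have dI (p : {mpoly K[3]}) : d%:R%:MP * ((d%:R)^-1 *: p) = p.
  by rewrite mul_mpolyC scalerA divff // scale1r.
apply: (free_quot_image (h := fun r : vec K => cross r X) _ (submod_syz F n.+1)
  (submod_koszul F n.+1) submod_log1 submod_rel1 cross_X_linear _ rel1_log1 _ _ _).1.
- exact: koszul_syz.
- move=> r [hr rF]; split; first exact: cross_X_homog.
  by exists [ffun i => d%:R%:MP * r i] => i; rewrite grad_cross_X rF ffunE; ring.
- move=> v [hv [eta Hv]].
  have hc := cross_homog hd hF hv.
  have heta : homog_vec n.+1 [ffun i => pihomog mdeg n.+1 (eta i)].
    by move=> i; rewrite ffunE; apply: pihomogP.
  have Ev i : cross grad v i = pihomog mdeg n.+1 (eta i) * F.
    have ed : (n.+2 + d.-1 = n.+1 + d)%N by move: hd; lia.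
    by rewrite -(pihomogM _ _ hF) -Hv pihomog_dE // -ed.
  pose r : vec K := [ffun i => d%:R^-1 *: pihomog mdeg n.+1 (eta i)].
  have hr : homog_vec n.+1 r by move=> i; rewrite ffunE rpredZ // pihomogP.
  have rF : \sum_i r i * F^`M(i) = 0.
    apply: mulFI; rewrite mulr0.
    transitivity (d%:R^-1 *: \sum_i cross grad v i * F^`M(i)).
      rewrite mulr_sumr scaler_sumr; apply: eq_bigr => i _.
      by rewrite Ev ffunE -!mul_mpolyC; ring.
    by rewrite sum_ord3 !ffunE /= -!mul_mpolyC; ring.
  exists r; first by [].
  pose w : vec K := v - cross r X.
  have hw : homog_vec n.+2 w.
    by move=> i; rewrite /w vec_subE; apply: rpredB => //; apply: cross_X_homog.
  have gw : cross grad w = 0.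
    apply/ffunP => i; transitivity (cross grad v i - cross grad (cross r X) i).
      by move: i; apply: ord3P; rewrite !ffunE /= ?ffunE /=; ring.
    have e1 : d%:R%:MP * r i = pihomog mdeg n.+1 (eta i) by rewrite ffunE dI.
    by rewrite grad_cross_X rF Ev -e1 mul0r subr0 [RHS]ffunE; ring.
  have [k Hk] := cross_eq0 partial_parallel hw gw.
  exists 0, (shift_part n.+3 d k); split.
  - by case: (submod_shifted_vec n.+2 d).
  - exact: shift_partP.
  - apply/ffunP => i; rewrite -/w [RHS]ffunE vec0E mulr0 add0r.
    have -> : shift_part n.+3 d k = shift_part n.+2 d.-1 k.
      have [e ->] : exists e, d = e.+1 by exists d.-1; move: hd; lia.
      by rewrite /shift_part ltnS subSS.
    by rewrite -(pihomog_shift _ _ (grad_homog hd hF i)) -Hk pihomog_dE.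
- move=> r [hr rF]; split=> [kr|[b [c [hb hc E]]]].
    have [lt|le] := ltnP n.+1 d.-1.
      rewrite (koszul_small hd hF kr lt); have -> : cross (0 : vec K) X = 0.
        by apply/ffunP; apply: ord3P; rewrite !ffunE /= ?ffunE !mul0r subrr.
      by case: submod_rel1.
    have [m em] : exists m, n.+1 = (m + d.-1)%N by exists (n.+1 - d.-1)%N; rewrite subnK.
    rewrite em in kr; have [a ha ->] := koszul_homog hd hF kr.
    exists [ffun i => d%:R%:MP * a i], (- \sum_i a i * 'X_i); split.
    - move=> i; rewrite ffunE mul_mpolyC; apply: submodZ; first exact: submod_shifted.
      have -> : n.+2 = (m + d)%N by move: em hd; lia.
      exact: homog_shifted.
    - have -> : n.+3 = (m.+1 + d)%N by move: em hd; lia.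
      apply: homog_shifted; rewrite rpredN; apply: rpred_sum => i _.
      by have := dhomogM (ha i) (homogX1 K i); rewrite addn1.
    - by apply/ffunP => i; rewrite cross_koszul_X !ffunE; ring.
  split=> //; exists [ffun i => d%:R^-1 *: b i]; apply/ffunP => i.
  apply: mulFI; transitivity (d%:R^-1 *: cross grad (cross r X) i).
    by rewrite grad_cross_X rF mul0r subr0 -mulrA mul_mpolyC scalerA mulVf // scale1r.
  by rewrite E; move: i; apply: ord3P; rewrite !ffunE /= ?ffunE -!mul_mpolyC; ring.
Qed.

(** [log2] and [rel2] are the coefficient vectors of the 2-forms of degree n + 3 that
    vanish on the curve, see [flux_log], and of those in F Omega^2 + dF /\ Omega^1. *)
Definition log2 (u : vec K) : Prop :=
  homog_vec n.+1 u /\ exists h, \sum_i u i * F^`M(i) = h * F.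

Definition rel2 (u : vec K) : Prop :=
  exists b c : vec K, [/\ shifted_vec n.+1 d b, shifted_vec n.+2 d c &
    u = [ffun i => F * b i + cross grad c i]].

(** The vectors of AR + J E: the intermediate step of the filtration. *)
Definition mid2 (u : vec K) : Prop :=
  homog_vec n.+1 u /\ exists p : {mpoly K[3]}, [/\ p \is n.-homog, jacobian_ideal F p &
     \sum_i u i * F^`M(i) = d%:R%:MP * p * F].

Lemma submod_log2 : submod log2.
Proof.
have [s0 sD] := submod_homog_vec K n.+1; split.
  by split=> //; exists 0; rewrite mul0r big1 // => i _; rewrite ffunE mul0r.
move=> c u v [hu [h Hu]] [hv [k Hv]]; split; first exact: sD.
exists (c *: h + k); rewrite mulrDl -scalerAl -Hu -Hv scaler_sumr -big_split.
by apply: eq_bigr => i _; rewrite !ffunE mulrDl scalerAl.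
Qed.

Lemma submod_rel2 : submod rel2.
Proof.
have [b0 bD] := submod_shifted_vec n.+1 d; have [c0 cD] := submod_shifted_vec n.+2 d; split.
  by exists 0, 0; split=> //; apply/ffunP; apply: ord3P; rewrite !ffunE /= ?ffunE; ring.
move=> x _ _ [b [c [hb hc ->]]] [b' [c' [hb' hc' ->]]].
exists (x *: b + b'), (x *: c + c'); split; [exact: bD|exact: cD|].
by apply/ffunP; apply: ord3P; rewrite !ffunE /= ?ffunE -!mul_mpolyC; ring.
Qed.

Lemma submod_mid2 : submod mid2.
Proof.
have [s0 sD] := submod_homog_vec K n.+1; have [[j0 j0'] jD] := submod_jacobian F n; split.
  by split=> //; exists 0; split=> //; rewrite mulr0 mul0r big1 // => i _; rewrite ffunE mul0r.
move=> c u v [hu [h [hh jh Hu]]] [hv [k [hk jk Hv]]]; split; first exact: sD.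
have [hj jj] := jD c h k (conj hh jh) (conj hk jk).
exists (c *: h + k); split=> //.
transitivity (c *: \sum_i u i * F^`M(i) + \sum_i v i * F^`M(i)).
  by rewrite scaler_sumr -big_split; apply: eq_bigr => i _; rewrite !ffunE mulrDl scalerAl.
by rewrite Hu Hv -!mul_mpolyC; ring.
Qed.

Lemma shifted_cross m (c : vec K) : shifted_vec m.+1 d c -> homog_vec m (cross grad c).
Proof.
move=> hc; have [e0 e1 e2] := crossE grad c.
have H i j : F^`M(i) * c j \is m.-homog by rewrite mulrC; apply: shifted_grad.
by apply: ord3P; rewrite ?e0 ?e1 ?e2; apply: rpredB; apply: H.
Qed.

Lemma rel2_mid2 u : rel2 u -> mid2 u.
Proof.
move=> [b [c [hb hc ->]]]; split=> [i|].
  rewrite ffunE; apply: rpredD; first by apply: shifted_mulF; apply: hb.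
  exact: shifted_cross.
exists (d%:R^-1 *: \sum_i b i * F^`M(i)); split.
- by apply: rpredZ; apply: rpred_sum => i _; apply: shifted_grad.
- by exists (fun i => d%:R^-1 *: b i); rewrite scaler_sumr; apply: eq_bigr => i _; rewrite scalerAl.
- rewrite mul_mpolyC scalerA divff // scale1r !sum_ord3 !ffunE /=; ring.
Qed.

(** If u . dF = d p F, then u - p E is a syzygy, by Euler's relation; p gives the
    quotient S/J, and on the part where p lies in J the syzygy gives AR/KR. *)
Lemma log2_dim tau :
  free_quot (fun p : {mpoly K[3]} => p \is n.-homog)
            (fun p => p \is n.-homog /\ jacobian_ideal F p) tau ->
  free_quot (syz F n.+1) (koszul F n.+1) tau -> free_quot log2 rel2 (2 * tau).
Proof.
have mulFI (p q : {mpoly K[3]}) : F * p = F * q -> p = q by apply: mulfI.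
have d0' : d%:R%:MP != 0 :> {mpoly K[3]} by rewrite mpolyC_eq0.
have dI (p : {mpoly K[3]}) : d%:R%:MP * ((d%:R)^-1 *: p) = p.
  by rewrite mul_mpolyC scalerA divff // scale1r.
have pE (p : {mpoly K[3]}) : \sum_i (p * 'X_i) * F^`M(i) = d%:R%:MP * p * F.
  by rewrite [in RHS]mulrAC -euler3 sum_ord3; ring.
have hpE (p : {mpoly K[3]}) : p \is n.-homog -> homog_vec n.+1 [ffun i => p * 'X_i].
  by move=> hp i; rewrite ffunE; have := dhomogM hp (homogX1 K i); rewrite addn1.
move=> Hh Hs; rewrite mul2n -addnn.
apply: (free_quot_trans submod_log2 submod_mid2 submod_rel2).
  apply: (free_quot_image (h := fun p => [ffun i => p * 'X_i] : vec K) _ (submod_homog K 3 n)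
    (submod_jacobian F n) submod_log2 submod_mid2 _ _ _ _ _ _).1 Hh.
  - by move=> c p q; apply/ffunP => i; rewrite !ffunE mulrDl scalerAl.
  - by move=> p [].
  - by move=> u [hu [p [_ _ E]]]; split=> //; exists (d%:R%:MP * p).
  - move=> p hp; split; first exact: hpE.
    by exists (d%:R%:MP * p); rewrite -pE; apply: eq_bigr => i _; rewrite ffunE.
  - move=> u [hu [h Hu]]; pose p := d%:R^-1 *: pihomog mdeg n h.
    have hp : p \is n.-homog by rewrite rpredZ // pihomogP.
    have Eu : \sum_i u i * F^`M(i) = d%:R%:MP * p * F.
      rewrite dI -(pihomogM _ _ hF) -Hu pihomog_dE //.
      have -> : (n + d = n.+1 + d.-1)%N by move: hd; lia.
      by apply: rpred_sum => i _; apply: dhomogM (hu i) (grad_homog hd hF i).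
    exists p => //; split.
      by move=> i; rewrite !ffunE; apply: rpredB => //; have := hpE p hp i; rewrite ffunE.
    have [[z0 z1] _] := submod_jacobian F n.
    exists 0; split=> //; rewrite mulr0 mul0r; under eq_bigr do rewrite !ffunE mulrBl.
    by rewrite sumrB pE Eu subrr.
  - move=> p hp; split=> [[_ jp]|[_ [p' [_ jp' E]]]].
      split; first exact: hpE.
      by exists p; split=> //; rewrite -pE; apply: eq_bigr => i _; rewrite ffunE.
    split=> //; suff -> : p = p' by [].
    have E' : d%:R%:MP * p * F = d%:R%:MP * p' * F.
      by rewrite -E -pE; apply: eq_bigr => i _; rewrite ffunE.
    by apply: (mulfI d0'); apply: (mulIf F0).
apply: (free_quot_image (h := id) _ (submod_syz F n.+1)
  (submod_koszul F n.+1) submod_mid2 submod_rel2 _ _ rel2_mid2 _ _ _).1 Hs => //.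
- exact: koszul_syz.
- move=> r [hr rF]; split=> //; have [[z0 z1] _] := submod_jacobian F n.
  by exists 0; split=> //; rewrite mulr0 mul0r.
- move=> u [hu [p [hp jp E]]]; exists (u - [ffun i => p * 'X_i]).
    split=> [i|].
      by rewrite !ffunE; apply: rpredB => //; have := hpE p hp i; rewrite ffunE.
    by under eq_bigr do rewrite !ffunE mulrBl; rewrite sumrB pE E subrr.
  rewrite opprB addrC subrK.
  have [lt|le] := ltnP n d.-1.
    have -> : p = 0 by apply: (jacobian_small (ltnW hd) hF hp lt jp).
    have -> : [ffun i => 0 * 'X_i] = 0 :> vec K by apply/ffunP => i; rewrite !ffunE mul0r.
    by case: submod_rel2.
  have [m em] : exists m, n = (m + d.-1)%N by exists (n - d.-1)%N; rewrite subnK.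
  rewrite em in hp; have [b' hb' eb'] := jacobian_homog (ltnW hd) hF hp jp.
  have {b' hb' eb'} [b [hb eb]] : exists b : vec K, homog_vec m b /\ p = \sum_i b i * F^`M(i).
    exists [ffun i => b' i]; split=> [i|]; first by rewrite ffunE.
    by rewrite eb'; apply: eq_bigr => i _; rewrite ffunE.
  exists [ffun i => d%:R%:MP * b i], (- cross b X); split.
  - move=> i; rewrite ffunE mul_mpolyC; apply: submodZ; first exact: submod_shifted.
    have -> : n.+1 = (m + d)%N by move: em hd; lia.
    exact: homog_shifted.
  - move=> i; rewrite vecNE -scaleN1r; apply: submodZ; first exact: submod_shifted.
    have -> : n.+2 = (m.+1 + d)%N by move: em hd; lia.
    by apply: homog_shifted; apply: cross_X_homog.
  - apply/ffunP => i; rewrite [LHS]ffunE eb.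
    transitivity (F * (d%:R%:MP * b i) - cross grad (cross b X) i).
      by rewrite grad_cross_X; ring.
    by move: i; apply: ord3P; rewrite !ffunE /= ?ffunE /=; ring.
- move=> r [hr rF]; split=> [kr|[b [c [hb hc E]]]].
    have [lt|le] := ltnP n.+1 d.-1.
      by rewrite (koszul_small hd hF kr lt); case: submod_rel2.
    have [m em] : exists m, n.+1 = (m + d.-1)%N by exists (n.+1 - d.-1)%N; rewrite subnK.
    rewrite em in kr; have [a ha ->] := koszul_homog hd hF kr.
    exists 0, a; split; first by case: (submod_shifted_vec n.+1 d).
      move=> i; have -> : n.+2 = (m + d)%N by move: em hd; lia.
      exact: homog_shifted.
    by apply/ffunP => i; rewrite [RHS]ffunE vec0E mulr0 add0r.
  split=> //; exists (c + d%:R^-1 *: cross b X).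
  have bF : \sum_i b i * F^`M(i) = 0.
    by apply: mulFI; rewrite mulr0 -[RHS]rF E !sum_ord3 !ffunE /=; ring.
  apply/ffunP => i; transitivity (cross grad c i + d%:R^-1 *: cross grad (cross b X) i).
    rewrite grad_cross_X bF mul0r subr0 E ffunE addrC; congr (_ + _).
    by rewrite -mulrA mul_mpolyC scalerA mulVf // scale1r.
  by move: i; apply: ord3P; rewrite !ffunE /= ?ffunE /= ?ffunE /= -!mul_mpolyC; ring.
Qed.

End LogarithmicForms.

(** * Differential forms in coordinates *)

Local Notation form := Defs.form.

Section FormCoordinates.
Variables (K : fieldType) (n : nat).
Implicit Types (u v : 'I_n -> {mpoly K[n]}) (L : {set 'I_n}).

Definition form0_of (p : {mpoly K[n]}) : form K n := [ffun I : {set 'I_n} => p *+ (I == set0)].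

Definition form1_of u : form K n := [ffun I : {set 'I_n} => \sum_(i | I == [set i]) u i].

Lemma mdiffE (p : {mpoly K[n]}) : mdiff p = form1_of (fun i => p^`M(i)).
Proof. by []. Qed.

Lemma form1_at u i : form1_of u [set i] = u i.
Proof.
rewrite ffunE (bigD1 i) //= big1 ?addr0 // => j /andP[/eqP/set1_inj -> ].
by rewrite eqxx.
Qed.

Lemma form1_out u L : #|L| != 1%N -> form1_of u L = 0.
Proof.
by move=> L1; rewrite ffunE big1 // => i /eqP e; move: L1; rewrite e cards1.
Qed.

Lemma wedge1E u (b : form K n) L : wedge (form1_of u) b L =
  \sum_(i in L) (-1) ^+ inversions [set i] (L :\ i) * (u i * b (L :\ i)).
Proof.
rewrite ffunE.
under eq_bigr do rewrite ffunE mulr_suml mulr_sumr.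
rewrite (exchange_big_dep xpredT) //= [RHS]big_mkcond; apply: eq_bigr => i _.
have [iL|iL] := boolP (i \in L).
  rewrite (bigD1 [set i]) ?sub1set ?iL //= big1 ?addr0 // => I.
  by case/andP => /andP[_ /eqP ->]; rewrite eqxx.
rewrite big1 // => I /andP[IL /eqP e].
by move: IL; rewrite e sub1set (negbTE iL).
Qed.

Lemma inversions1 (i j : 'I_n) : inversions [set i] [set j] = (j < i)%N.
Proof.
rewrite /inversions; have [ji|ij] := ltnP j i.
  rewrite -[RHS](cards1 (i, j)); apply: eq_card => -[a b]; rewrite !inE /= xpair_eqE.
  by case: eqP => // ->; case: eqP => // ->.
apply/eqP; rewrite cards_eq0 -subset0; apply/subsetP => -[a b]; rewrite !inE /=.
by case/and3P => /eqP -> /eqP ->; rewrite ltnNge ij.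
Qed.

Lemma wedge11_at u v (k l : 'I_n) : (k < l)%N ->
  wedge (form1_of u) (form1_of v) [set k; l] = u k * v l - u l * v k.
Proof.
move=> kl; have nkl : k != l by rewrite neq_ltn kl.
have e1 : [set k; l] :\ k = [set l] by rewrite setU1K // inE.
have e2 : [set k; l] :\ l = [set k] by rewrite setUC setU1K // inE eq_sym.
rewrite wedge1E big_setU1 ?inE //= big_set1 e1 e2 !inversions1 !form1_at kl.
by rewrite ltnNge (ltnW kl) expr0 expr1 mul1r mulN1r.
Qed.

Lemma wedge11_out u v L : #|L| != 2 -> wedge (form1_of u) (form1_of v) L = 0.
Proof.
move=> L2; rewrite wedge1E big1 // => i iL; rewrite form1_out ?mulr0 //.
by apply: contra L2 => /eqP e; rewrite (cardsD1 i) iL e.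
Qed.

Lemma wedge_form0 u p : wedge (form1_of u) (form0_of p) = form1_of (fun i => u i * p).
Proof.
apply/ffunP => L; rewrite wedge1E [RHS]ffunE.
have [/eqP/cards1P [i ->]|L1] := eqVneq #|L| 1%N.
  rewrite big_set1 (bigD1 i) //= [X in _ + X]big1 => [|j /andP[/eqP/set1_inj ->]]; last by rewrite eqxx.
  rewrite setDv ffunE eqxx mulr1n addr0 /inversions.
  rewrite (_ : [set _ | _] = set0) ?cards0 ?expr0 ?mul1r //.
  by apply/setP => -[a b]; rewrite !inE /= andbF.
rewrite !big1 // => [i /eqP e|i iL]; first by move: L1; rewrite e cards1.
rewrite ffunE; case: eqP => [e|]; rewrite ?mulr0n ?mulr0 //.
by move: L1; rewrite (cardsD1 i) iL e cards0.
Qed.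

Lemma wedge1_unit u : wedge (form1_of u) (form1 K n) = form1_of u.
Proof.
have -> : form1 K n = form0_of 1 by apply/ffunP => L; rewrite !ffunE.
by rewrite wedge_form0; apply/ffunP => L; rewrite !ffunE; apply: eq_bigr => i _; rewrite mulr1.
Qed.

Lemma fscale_form1 p u : fscale p (form1_of u) = form1_of (fun i => p * u i).
Proof. by apply/ffunP => L; rewrite !ffunE mulr_sumr. Qed.

Lemma form1_inj u v : form1_of u = form1_of v -> forall i, u i = v i.
Proof. by move=> /ffunP e i; have := e [set i]; rewrite !form1_at. Qed.

Lemma form1_ext u v : (forall i, u i = v i) -> form1_of u = form1_of v.
Proof. by move=> e; apply/ffunP => L; rewrite !ffunE; apply: eq_bigr. Qed.

Lemma Omega0P q (a : form K n) :
  Omega 0 q a <-> exists2 p, homogz q p & a = form0_of p.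
Proof.
split=> [Oa|[p hp ->] I]; last first.
  rewrite (_ : 0 = 0%N%:Z) // eqz_nat ffunE cards_eq0 subr0.
  by case: eqP.
exists (a set0); first by have := Oa set0; rewrite cards0 eqxx subr0.
apply/ffunP => I; rewrite ffunE; have := Oa I.
rewrite (_ : 0 = 0%N%:Z) // eqz_nat cards_eq0.
by case: eqP => [->|].
Qed.

Lemma Omega1P q (a : form K n) :
  Omega 1 q a <-> exists2 u : {ffun 'I_n -> {mpoly K[n]}}, (forall i, homogz (q - 1) (u i)) & a = form1_of u.
Proof.
split=> [Oa|[u hu ->] I]; last first.
  rewrite (_ : 1 = 1%N%:Z) // eqz_nat; case: ifP => [/cards1P [i ->]|/negbT I1].
    by rewrite form1_at.
  exact: form1_out.
exists [ffun i => a [set i]] => [i|].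
  by rewrite ffunE; have := Oa [set i]; rewrite cards1 eqxx.
apply/ffunP => I; have := Oa I; rewrite (_ : 1 = 1%N%:Z) // eqz_nat.
case: ifP => [/cards1P [i ->] _|/negbT I1 ->]; last by rewrite form1_out.
by rewrite form1_at ffunE.
Qed.

(** The forms of degree -1 appear as factors of dF in the relations among 0-forms. *)
Lemma Omega_neg q (a : form K n) : Omega (-1) q a -> a = 0.
Proof. by move=> Oa; apply/ffunP => I; rewrite ffunE; have := Oa I. Qed.

End FormCoordinates.

Lemma enum_compl3 : [/\ enum (~: [set i0]) = [:: i1; i2], enum (~: [set i1]) = [:: i0; i2] &
  enum (~: [set i2]) = [:: i0; i1]].
Proof.
have E : enum 'I_3 = [:: i0; i1; i2] by apply: (inj_map val_inj); rewrite val_enum_ord.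
have F (A : {set 'I_3}) : enum A = [seq i <- enum 'I_3 | i \in A].
  by rewrite enumT; apply: eq_filter.
by split; rewrite F E /= !inE.
Qed.

Lemma compl3 : [/\ ~: [set i0] = [set i1; i2], ~: [set i1] = [set i0; i2] &
  ~: [set i2] = [set i0; i1]].
Proof. by split; apply/setP; apply: ord3P; rewrite !inE. Qed.

Lemma card2_compl (I : {set 'I_3}) : #|I| = 2 -> exists k, I = ~: [set k].
Proof.
move=> I2; have /eqP/cards1P [k ek] : #|~: I| = 1%N by rewrite cardsCs setCK card_ord I2.
by exists k; rewrite -ek setCK.
Qed.

Section TwoForms.
Variable K : fieldType.
Implicit Types (u v : 'I_3 -> {mpoly K[3]}) (I : {set 'I_3}).

(** The coefficient of dx_j /\ dx_k for the complement {j < k} of {i} carries the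
    sign (-1)^i, so that the wedge product of 1-forms is the vector product of
    their coefficients. *)
Definition form2_of u : form K 3 :=
  [ffun I : {set 'I_3} => \sum_(k | I == ~: [set k]) (-1) ^+ k * u k].

Lemma form2_at u k : form2_of u (~: [set k]) = (-1) ^+ k * u k.
Proof.
rewrite ffunE (bigD1 k) //= big1 ?addr0 // => j /andP[/eqP/setC_inj/set1_inj -> ].
by rewrite eqxx.
Qed.

Lemma form2_out u I : #|I| != 2 -> form2_of u I = 0.
Proof.
by move=> I2; rewrite ffunE big1 // => i /eqP e; move: I2; rewrite e cardsC1 card_ord.
Qed.

Lemma wedge11E u v : wedge (form1_of u) (form1_of v) = form2_of (cross u v).
Proof.
apply/ffunP => I; have [/card2_compl [k ->]|I2] := eqVneq #|I| 2; last first.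
  by rewrite wedge11_out // form2_out.
have [c0 c1 c2] := compl3; rewrite form2_at.
move: k; apply: ord3P; rewrite ?c0 ?c1 ?c2 wedge11_at // !ffunE /= ?expr0 ?expr1 ?expr2.
- by rewrite mul1r.
- by rewrite mulN1r opprB.
- by rewrite mulrNN !mul1r.
Qed.

Lemma fscale_form2 p u : fscale p (form2_of u) = form2_of (fun i => p * u i).
Proof.
apply/ffunP => L; rewrite !ffunE mulr_sumr; apply: eq_bigr => k _.
by rewrite mulrCA.
Qed.

Lemma form2_inj u v : form2_of u = form2_of v -> forall i, u i = v i.
Proof.
move=> /ffunP e i; have := e (~: [set i]); rewrite !form2_at.
by apply: mulrI; rewrite unitrX // unitrN unitr1.
Qed.

Lemma homogz_sign q k (p : {mpoly K[3]}) : homogz q p -> homogz q ((-1) ^+ k * p).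
Proof.
rewrite -signr_odd mulr_sign; case: (odd k) => //.
by case: q => m /=; [rewrite rpredN | move=> ->; rewrite oppr0].
Qed.

Lemma Omega2P q (a : form K 3) :
  Omega 2 q a <-> exists2 u : vec K, (forall i, homogz (q - 2) (u i)) & a = form2_of u.
Proof.
split=> [Oa|[u hu ->] I]; last first.
  rewrite (_ : 2 = 2%N%:Z) // eqz_nat; case: ifP => [/eqP/card2_compl [k ->]|/negbT I1].
    by rewrite form2_at; apply: homogz_sign.
  exact: form2_out.
exists [ffun k : 'I_3 => (-1) ^+ k * a (~: [set k])] => [k|].
  rewrite ffunE; apply: homogz_sign; have := Oa (~: [set k]).
  by rewrite cardsC1 card_ord.
apply/ffunP => I; have := Oa I; rewrite (_ : 2 = 2%N%:Z) // eqz_nat.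
case: ifP => [/eqP/card2_compl [k ->] _|/negbT I1 ->]; last by rewrite form2_out.
by rewrite form2_at ffunE mulrA -exprD addnn -signr_odd odd_double mul1r.
Qed.

End TwoForms.

Section Pullback.
Variables (K : fieldType).

Lemma fscale_suml m (I : finType) (P : pred I) (p : I -> {mpoly K[m]}) (b : form K m) :
  fscale (\sum_(i | P i) p i) b = \sum_(i | P i) fscale (p i) b.
Proof.
apply/ffunP => L; rewrite ffunE sum_ffunE mulr_suml.
by apply: eq_bigr => i _; rewrite ffunE.
Qed.

Lemma fscale0 m (b : form K m) : fscale 0 b = 0.
Proof. by apply/ffunP => L; rewrite !ffunE mul0r. Qed.

Lemma pullback_form0 n m (f : n.-tuple {mpoly K[m]}) p :
  pullback f (form0_of p) = form0_of (p \mPo f).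
Proof.
rewrite /pullback (bigD1 set0) //= big1 => [|I I0]; last first.
  by rewrite ffunE (negbTE I0) mulr0n comp_mpoly0 fscale0.
rewrite ffunE eqxx mulr1n enum_set0 big_nil addr0.
by apply/ffunP => L; rewrite !ffunE; case: eqP => _; rewrite ?mulr1 ?mulr0.
Qed.

Lemma pullback_form1 n m (f : n.-tuple {mpoly K[m]}) u :
  pullback f (form1_of u) = form1_of (fun j => \sum_i (u i \mPo f) * (tnth f i)^`M(j)).
Proof.
rewrite /pullback.
transitivity (\sum_(I : {set 'I_n}) \sum_(i | I == [set i]) fscale (u i \mPo f) (mdiff (tnth f i))).
  apply: eq_bigr => I _; rewrite ffunE [X in fscale X _]raddf_sum fscale_suml.
  apply: eq_bigr => i /eqP ->; rewrite enum_set1 big_cons big_nil.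
  by rewrite mdiffE wedge1_unit.
rewrite (exchange_big_dep xpredT) //=.
under eq_bigr do rewrite big_pred1_eq mdiffE fscale_form1.
apply/ffunP => L; rewrite sum_ffunE ffunE.
under eq_bigr do rewrite ffunE.
by rewrite exchange_big.
Qed.

Lemma pullback_form2 m (f : 3.-tuple {mpoly K[m]}) u :
  pullback f (form2_of u) =
   fscale (u i0 \mPo f) (wedge (mdiff (tnth f i1)) (mdiff (tnth f i2))) +
   fscale (- u i1 \mPo f) (wedge (mdiff (tnth f i0)) (mdiff (tnth f i2))) +
   fscale (u i2 \mPo f) (wedge (mdiff (tnth f i0)) (mdiff (tnth f i1))).
Proof.
rewrite /pullback.
transitivity (\sum_(I : {set 'I_3}) \sum_(k | I == ~: [set k])
   fscale (((-1) ^+ k * u k) \mPo f) (\big[@wedge K m/form1 K m]_(i <- enum (~: [set k])) mdiff (tnth f i))).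
  apply: eq_bigr => I _; rewrite ffunE [X in fscale X _]raddf_sum fscale_suml.
  by apply: eq_bigr => i /eqP ->.
rewrite (exchange_big_dep xpredT) //=.
under eq_bigr do rewrite big_pred1_eq.
have [e0 e1 e2] := enum_compl3; rewrite sum_ord3 e0 e1 e2 !big_cons !big_nil.
rewrite !mdiffE !wedge1_unit /= expr0 expr1 expr2 mulrNN !mul1r.
by rewrite mulN1r.
Qed.

End Pullback.

(** * Which forms vanish on the curve *)

Section Vectors.
Variable A : idomainType.
Implicit Types (p q a b u : 'I_3 -> A).

Definition parallel p q := forall i j, p i * q j = p j * q i.

(** The vector product, over an arbitrary domain. *)
Definition normal a b : 'I_3 -> A := fun i =>
  [tuple a i1 * b i2 - a i2 * b i1; a i2 * b i0 - a i0 * b i2; a i0 * b i1 - a i1 * b i0]`_i.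

Lemma parallel_common p q u k : u k != 0 -> parallel p u -> parallel q u -> parallel p q.
Proof.
move=> uk pu qu i j; apply: (mulfI uk); apply: (mulfI uk).
transitivity ((p i * u k) * (q j * u k)); first by ring.
rewrite (pu i k) (qu j k).
transitivity ((p j * u k) * (q i * u k)); last by ring.
by rewrite (pu j k) (qu i k); ring.
Qed.

Lemma parallel_dot p q a k : q k != 0 -> parallel p q ->
  \sum_i q i * a i = 0 -> \sum_i p i * a i = 0.
Proof.
move=> qk pq qa; apply: (mulfI qk); rewrite mulr0 mulr_sumr.
transitivity (p k * \sum_i q i * a i); last by rewrite qa mulr0.
by rewrite mulr_sumr; apply: eq_bigr => i _; rewrite !mulrA [q k * _]mulrC (pq i k).
Qed.

(** Over the field of fractions, a vector orthogonal to a and b is a multiple of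
    their vector product; the identities are cross-multiplied. *)
Lemma orthogonal_parallel p a b : \sum_i p i * a i = 0 -> \sum_i p i * b i = 0 ->
  parallel p (normal a b).
Proof.
rewrite !sum_ord3 => pa pb.
set D := (X in X = _) in pa; set E := (X in X = _) in pb.
have H (s t x y : A) : s - t = x * D - y * E -> s = t.
  by rewrite pa pb !mulr0 subrr => /eqP; rewrite subr_eq0 => /eqP.
have e01 : p i0 * normal a b i1 = p i1 * normal a b i0.
  by apply: (H _ _ (- b i2) (- a i2)); rewrite /D /E /normal /=; ring.
have e12 : p i1 * normal a b i2 = p i2 * normal a b i1.
  by apply: (H _ _ (- b i0) (- a i0)); rewrite /D /E /normal /=; ring.
have e20 : p i2 * normal a b i0 = p i0 * normal a b i2.
  by apply: (H _ _ (- b i1) (- a i1)); rewrite /D /E /normal /=; ring.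
by apply: ord3P; apply: ord3P.
Qed.

Lemma parallel_sym p q : parallel p q -> parallel q p.
Proof. by move=> pq i j; rewrite mulrC -pq mulrC. Qed.

End Vectors.

Section PullbackKernels.
Variables (K : numClosedFieldType) (d : nat) (f : 3.-tuple {mpoly K[2]}).
Variables (F : {mpoly K[3]}) (al be : K) (x : 'I_d -> K).
Hypotheses (hd3 : (2 < d)%N) (hf : forall i : 'I_3, tnth f i \is d.-homog).
Hypotheses (hF : F \is d.-homog) (F0 : F != 0) (Ff : F \mPo f = 0).
Local Notation g := (fhat f i2 - al *: fhat f i0 - be *: fhat f i1).
Hypotheses (x_inj : injective x) (gd : g`_d != 0) (gx : forall i, g.[x i] = 0).
Hypothesis (f1x : forall i, (fhat f i1).[x i] != 0).
Local Notation y := (fun i => (fhat f i0).[x i] / (fhat f i1).[x i]).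
Hypothesis y_inj : injective y.
Let hd : (1 < d)%N := ltnW hd3.
Local Notation pull := (pull f).
Local Notation P := (fun i => pull F^`M(i)).
Local Notation df := (fun i => (fhat f i)^`()).
Local Notation N := (normal (fhat f) df).

(** At an intersection point x a of the curve and the line, f1 g' <> 0 while g = 0: the
    line crosses the curve there. *)
Lemma normal_nonzero : exists k, N k != 0.
Proof.
apply: contrapT => /forallNP H.
have {}H i : N i = 0 by apply/eqP; apply: contrapT => /negP; apply: H.
pose a : 'I_d := Ordinal (ltnW hd).
have : (fhat f i1).[x a] * g^`().[x a] != 0.
  by rewrite (deriv_g_at hf x_inj gx) mulf_neq0 // gam_neq0.
have -> : (fhat f i1).[x a] * g^`().[x a] = (N i0 + al *: N i2).[x a].
  transitivity ((fhat f i1) * g^`() - (fhat f i1)^`() * g).[x a].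
    by rewrite hornerD hornerN !hornerM gx mulr0 subr0.
  congr (_.[_]); rewrite /normal /= !derivB !derivZ -!mul_polyC; ring.
by rewrite !H scaler0 addr0 horner0 eqxx.
Qed.

(** The gradient and f x f' are both orthogonal to f and to f'. *)
Lemma gradient_normal : parallel P N.
Proof.
apply: orthogonal_parallel; first exact: (pull_radial hf hF Ff).
exact: (pull_tangent hf hF Ff).
Qed.

Lemma gradient_nonzero : exists k, P k != 0.
Proof. exact: (pull_partial_nonzero hd hf hF F0 Ff gd gx f1x y_inj). Qed.

Lemma pull_multiple e p : p \is e.-homog -> pull p = 0 <-> exists h, p = h * F.
Proof.
move=> hp; split=> [pp|[h ->]]; last first.
  by rewrite rmorphM /= (pullF hf hF Ff) mulr0.
have [lt|le] := ltnP e d.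
  by exists 0; rewrite mul0r (low_degree_pull gd gx f1x y_inj hp lt).
rewrite -(subnK le) in hp.
have [h _ ->] := pull_kernel hd hf hF F0 Ff gd gx f1x y_inj hp pp.
by exists h.
Qed.

(** The components along ds and dt; by Euler's relation the dt component of df is,
    after dehomogenization, a combination of f and f'. *)
Lemma tangent_hat m (u : vec K) : homog_vec m u ->
  (forall j, \sum_i (u i \mPo f) * (tnth f i)^`M(j) = 0) <->
  (\sum_i pull (u i) * fhat f i = 0 /\ \sum_i pull (u i) * (fhat f i)^`() = 0).
Proof.
move=> hu; have hh j : \sum_i (u i \mPo f) * (tnth f i)^`M(j) \is (m * d + d.-1).-homog.
  apply: rpred_sum => i _; apply: dhomogM; first exact: comp_homog.
  by apply: mderiv_homog; rewrite prednK // ltnW.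
have e0 : hat (\sum_i (u i \mPo f) * (tnth f i)^`M(j0)) = \sum_i pull (u i) * (fhat f i)^`().
  by rewrite rmorph_sum; apply: eq_bigr => i _; rewrite rmorphM /= pullE hat_mderiv0.
have e1 : hat (\sum_i (u i \mPo f) * (tnth f i)^`M(j1)) =
    d%:R *: \sum_i pull (u i) * fhat f i - 'X * \sum_i pull (u i) * (fhat f i)^`().
  rewrite rmorph_sum scaler_sumr mulr_sumr -sumrB; apply: eq_bigr => i _.
  rewrite rmorphM /= pullE (hat_mderiv1 (hf i)) -/(fhat f i) -!mul_polyC; ring.
have d0 : d%:R != 0 :> K by rewrite pnatr_eq0; move: hd; lia.
split=> [H|[H0 H1]].
  have E0 : \sum_i pull (u i) * (fhat f i)^`() = 0 by rewrite -e0 H rmorph0.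
  split=> //; move: e1; rewrite H rmorph0 E0 mulr0 subr0 => /esym/eqP.
  by rewrite scaler_eq0 (negbTE d0) => /eqP.
apply: ord2P; apply: hat_inj (hh _) _; first by rewrite e0.
by rewrite e1 H0 H1 scaler0 mulr0 subr0.
Qed.

(** u is orthogonal to f and f' along the curve iff it is parallel to f x f', hence
    to dF; and this is the vanishing of dF x u along the curve. *)
Lemma tangent_log m (u : vec K) : homog_vec m u ->
  (forall j, \sum_i (u i \mPo f) * (tnth f i)^`M(j) = 0) <->
  exists eta : vec K, forall i, cross (fun i => F^`M(i)) u i = eta i * F.
Proof.
move=> hu; have hc := cross_homog hd3 hF hu.
have [k Nk] := normal_nonzero; have [l Pl] := gradient_nonzero.
have PN := gradient_normal.
rewrite (tangent_hat hu).
have cE i : pull (cross (fun i => F^`M(i)) u i) = normal P (fun i => pull (u i)) i.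
  by move: i; apply: ord3P; rewrite !ffunE /normal /= rmorphB !rmorphM.
split=> [[H0 H1]|[eta H]].
  have UN : parallel (fun i => pull (u i)) N by apply: orthogonal_parallel.
  have UP := parallel_common Nk UN PN.
  have /choice [eta Heta] : forall i, exists h, cross (fun i => F^`M(i)) u i = h * F.
    move=> i; apply/(pull_multiple (hc i)); rewrite cE.
    by move: i; apply: ord3P; rewrite /normal /= ![pull F^`M(_) * _]mulrC UP subrr.
  by exists [ffun i => eta i] => i; rewrite Heta [in RHS]ffunE.
have UP : parallel (fun i => pull (u i)) P.
  have z i : normal P (fun i => pull (u i)) i = 0.
    by rewrite -cE H rmorphM /= (pullF hf hF Ff) mulr0.
  have := z i0; have := z i1; have := z i2; rewrite /normal /=.
  do 3 (move=> /eqP; rewrite subr_eq0 => /eqP ?).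
  by apply: parallel_sym; apply: ord3P; apply: ord3P.
split; apply: (parallel_dot Pl UP); first exact: (pull_radial hf hF Ff).
exact: (pull_tangent hf hF Ff).
Qed.

Definition jac2 (a b : 'I_3) : {mpoly K[2]} :=
  (tnth f a)^`M(j0) * (tnth f b)^`M(j1) - (tnth f a)^`M(j1) * (tnth f b)^`M(j0).

(** The coefficient of ds /\ dt in the pull-back of the 2-form given by u. *)
Definition flux (u : vec K) : {mpoly K[2]} := (u i0 \mPo f) * jac2 i1 i2 +
  (- u i1 \mPo f) * jac2 i0 i2 + (u i2 \mPo f) * jac2 i0 i1.

(** The flux is, after dehomogenization, - d times u . (f x f'), and dF is
    parallel to f x f'. *)
Lemma flux_log m (u : vec K) : homog_vec m u ->
  flux u = 0 <-> exists h, \sum_i u i * F^`M(i) = h * F.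
Proof.
move=> hu; have [k Nk] := normal_nonzero; have [l Pl] := gradient_nonzero.
have PN := gradient_normal; have NP := parallel_sym PN.
have d0 : d%:R != 0 :> K by rewrite pnatr_eq0; move: hd; lia.
have hs : \sum_i u i * F^`M(i) \is (m + d.-1).-homog.
  by apply: rpred_sum => i _; apply: dhomogM (hu i) (partial_homog hd hF i).
rewrite -(pull_multiple hs).
have -> : pull (\sum_i u i * F^`M(i)) = \sum_i P i * pull (u i).
  by rewrite rmorph_sum; apply: eq_bigr => i _; rewrite rmorphM mulrC.
have hJ a b : jac2 a b \is (d.-1 + d.-1).-homog.
  by rewrite /jac2; apply: rpredB; apply: dhomogM; apply: mderiv_homog; rewrite prednK // ltnW.
have hc i : u i \mPo f \is (m * d).-homog by apply: comp_homog.
have hf' : flux u \is (m * d + (d.-1 + d.-1)).-homog.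
  rewrite /flux comp_mpolyN mulNr; apply: rpredD; last exact: dhomogM.
  by apply: rpredB; apply: dhomogM.
have jE a b : hat (jac2 a b) =
    d%:R *: ((fhat f a)^`() * fhat f b - (fhat f b)^`() * fhat f a).
  rewrite rmorphB !rmorphM /= !hat_mderiv0 !(hat_mderiv1 (hf _)) -!/(fhat f _) -!mul_polyC.
  ring.
have hE : hat (flux u) = - d%:R *: \sum_i N i * pull (u i).
  rewrite /flux comp_mpolyN !rmorphD !rmorphM rmorphN /= !pullE !jE sum_ord3 /normal /=.
  rewrite -!mul_polyC polyCN; ring.
have E : flux u = 0 <-> \sum_i N i * pull (u i) = 0.
  split=> [e|e]; last by apply: hat_inj hf' _; rewrite hE e scaler0.
  move: hE; rewrite e rmorph0 => /esym/eqP.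
  by rewrite scaler_eq0 oppr_eq0 (negbTE d0) => /eqP.
rewrite E; split; first exact: (parallel_dot Nk PN).
exact: (parallel_dot Pl NP).
Qed.

End PullbackKernels.

(** * Dimensions of the kernels *)

(** Describing V' and W' as images under an injective map is how spaces of forms
    are reduced to spaces of coefficient vectors. *)
Lemma free_quot_embedding (K : fieldType) (M N : lmodType K) (V W : M -> Prop)
    (V' W' : N -> Prop) (h : M -> N) n :
  submod V -> submod W -> (forall w, W w -> V w) ->
  (forall a u v, h (a *: u + v) = a *: h u + h v) -> injective h ->
  (forall v', V' v' <-> exists2 v, V v & v' = h v) ->
  (forall w', W' w' <-> exists2 w, W w & w' = h w) ->
  free_quot V W n -> free_quot V' W' n.
Proof.
move=> sV sW WV hlin hinj V'E W'E.
have h0 : h 0 = 0 by have := hlin (-1) 0 0; rewrite scaler0 addr0 scaleN1r addNr.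
have sub (U : M -> Prop) (U' : N -> Prop) : submod U ->
    (forall v', U' v' <-> exists2 v, U v & v' = h v) -> submod U'.
  move=> [U0 UD] U'E; split; first by apply/U'E; exists 0.
  move=> a u v /U'E [u1 Uu ->] /U'E [v1 Uv ->]; apply/U'E.
  by exists (a *: u1 + v1); [apply: UD | rewrite hlin].
apply: (free_quot_image (h := h) n sV sW (sub _ _ sV V'E) (sub _ _ sW W'E) hlin WV _ _ _ _).1.
- by move=> w' /W'E [w Ww ->]; apply/V'E; exists w => //; apply: WV.
- by move=> v Vv; apply/V'E; exists v.
- move=> v' /V'E [v Vv ->]; exists v => //; rewrite subrr; apply/W'E.
  by exists 0; [case: sW | ].
- move=> v Vv; split=> [Wv|/W'E [w Ww /hinj ->] //].
  by apply/W'E; exists v.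
Qed.

(** Integer degrees are turned into the truncated degrees of [shifted]. *)
Lemma homogz_shift (K : fieldType) m e (p : {mpoly K[3]}) :
  homogz (m%:Z - e%:Z) p <-> shifted m e p.
Proof.
rewrite /shifted; case: leqP => em; first by rewrite subzn.
have -> : m%:Z - e%:Z = Negz (e - m).-1 by lia.
by [].
Qed.

Lemma wedge_zero (K : fieldType) k (a : form K k) : wedge a 0 = 0.
Proof.
apply/ffunP => L; rewrite !ffunE big1 // => I _.
by rewrite [(0 : form K k) _]ffunE !mulr0.
Qed.

Section FormsOfCurve.
Variables (K : numClosedFieldType) (d : nat) (f : 3.-tuple {mpoly K[2]}) (F : {mpoly K[3]}).
Hypotheses (hd : (2 < d)%N) (hF : F \is d.-homog) (F0 : F != 0) (Ff : F \mPo f = 0).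
Hypothesis pull_mult : forall e p, p \is e.-homog -> p \mPo f = 0 -> exists h, p = h * F.
Hypothesis tangentP : forall m (u : vec K), homog_vec m u ->
  (forall j, \sum_i (u i \mPo f) * (tnth f i)^`M(j) = 0) <->
  exists eta : vec K, forall i, cross (fun i => F^`M(i)) u i = eta i * F.
Hypothesis fluxP : forall m (u : vec K), homog_vec m u ->
  flux f u = 0 <-> exists h, \sum_i u i * F^`M(i) = h * F.

Lemma ker_zero_form0 q : ker_zero f d F 0 q%:Z.
Proof.
move=> a; split.
  move=> [/Omega0P [p hp ->]]; rewrite pullback_form0 => /ffunP /(_ set0).
  rewrite !ffunE eqxx mulr1n => pf.
  have [h eh] := pull_mult hp pf.
  exists (form0_of (shift_part q d h)), 0; split.
  - by apply/Omega0P; exists (shift_part q d h) => //; apply/homogz_shift/shift_partP.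
  - by move=> I; rewrite sub0r ffunE.
  - rewrite wedge_zero addr0; apply/ffunP => I; rewrite !ffunE.
    by rewrite mulrnAr mulrC -(pihomog_shift _ _ hF) -eh pihomog_dE.
move=> [b [c [/Omega0P [h hh ->]]]]; rewrite sub0r => /Omega_neg -> ->.
have -> : fscale F (form0_of h) + wedge (mdiff F) 0 = form0_of (F * h) :> form K 3.
  by rewrite wedge_zero addr0; apply/ffunP => I; rewrite !ffunE mulrnAr.
split; first by apply/Omega0P; exists (F * h) => //; apply: (shifted_mulF hF); apply/homogz_shift.
by rewrite pullback_form0 rmorphM /= Ff mul0r; apply/ffunP => I; rewrite !ffunE mul0rn.
Qed.

Lemma pullback_form1_eq0 (u : vec K) : pullback f (form1_of u) = 0 <->
  (forall j, \sum_i (u i \mPo f) * (tnth f i)^`M(j) = 0).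
Proof.
have z : form1_of (fun _ : 'I_2 => 0) = 0 :> form K 2.
  by apply/ffunP => L; rewrite !ffunE big1.
rewrite pullback_form1 -[X in _ = X]z; split=> [/form1_inj //|H]; exact: form1_ext.
Qed.

Lemma pullback_form2_at (u : vec K) L : pullback f (form2_of u) L =
  (u i0 \mPo f) * wedge (mdiff (tnth f i1)) (mdiff (tnth f i2)) L +
  (- u i1 \mPo f) * wedge (mdiff (tnth f i0)) (mdiff (tnth f i2)) L +
  (u i2 \mPo f) * wedge (mdiff (tnth f i0)) (mdiff (tnth f i1)) L.
Proof.
have addE (a b : form K 2) : (a + b) L = a L + b L by rewrite ffunE.
have scaleE p (a : form K 2) : fscale p a L = p * a L by rewrite ffunE.
by rewrite pullback_form2 !addE !scaleE.
Qed.

Lemma pullback_form2_eq0 (u : vec K) : pullback f (form2_of u) = 0 <-> flux f u = 0.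
Proof.
have E : pullback f (form2_of u) [set j0; j1] = flux f u.
  by rewrite pullback_form2_at !mdiffE !wedge11_at.
split=> [e|e]; first by rewrite -E e ffunE.
apply/ffunP => L; rewrite [RHS]ffunE; have [L2|L2] := eqVneq #|L| 2.
  have -> : L = [set j0; j1].
    apply/eqP; rewrite eqEcard L2 cards2 /= andbT; apply/subsetP => i _.
    by move: i; apply: ord2P; rewrite !inE.
  by rewrite E e.
by rewrite pullback_form2_at !mdiffE !wedge11_out // !mulr0 !addr0.
Qed.

Variable n : nat.

Lemma pullback_ker1 a : pullback_ker f 1 n.+3%:Z a <-> exists2 u, log1 F n u & a = form1_of u.
Proof.
have e1 : n.+3%:Z - 1 = n.+2%:Z by lia.
split=> [[/Omega1P [u hu ->]]|[u [hu lu] ->]].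
  rewrite pullback_form1_eq0 => pu; exists u => //.
  have hv : homog_vec n.+2 u by move=> i; have := hu i; rewrite e1.
  by split=> //; apply/(tangentP hv).
split; first by apply/Omega1P; exists u => // i; rewrite e1; apply: hu.
by apply/pullback_form1_eq0/(tangentP hu).
Qed.

Lemma relations1 a : relations d F 1 n.+3%:Z a <-> exists2 u, rel1 d F n u & a = form1_of u.
Proof.
have e1 : n.+3%:Z - d%:Z - 1 = n.+2%:Z - d%:Z by lia.
have E (b : vec K) c : fscale F (form1_of b) + wedge (mdiff F) (form0_of c) =
    form1_of [ffun i => F * b i + c * F^`M(i)].
  rewrite mdiffE wedge_form0 fscale_form1; apply/ffunP => L; rewrite !ffunE -big_split.
  by apply: eq_bigr => i _; rewrite ffunE [c * _]mulrC.
split=> [[b [c [/Omega1P [u hu ->]]]]|[u [b [c [hb hc ->]]] ->]].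
  rewrite subrr => /Omega0P [p hp ->] ->.
  exists [ffun i => F * u i + p * F^`M(i)]; last by rewrite E.
  exists u, p; split=> // [i|]; last exact/homogz_shift.
  by apply/homogz_shift; have := hu i; rewrite e1.
exists (form1_of b), (form0_of c); split; last by rewrite E.
  by apply/Omega1P; exists b => // i; rewrite e1; apply/homogz_shift/hb.
by rewrite subrr; apply/Omega0P; exists c => //; apply/homogz_shift.
Qed.

Lemma pullback_ker2 a : pullback_ker f 2 n.+3%:Z a <-> exists2 u, log2 F n u & a = form2_of u.
Proof.
have e1 : n.+3%:Z - 2 = n.+1%:Z by lia.
split=> [[/Omega2P [u hu ->]]|[u [hu lu] ->]].
  rewrite pullback_form2_eq0 => pu; exists u => //.
  have hv : homog_vec n.+1 u by move=> i; have := hu i; rewrite e1.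
  by split=> //; apply/(fluxP hv).
split; first by apply/Omega2P; exists u => // i; rewrite e1; apply: hu.
by apply/pullback_form2_eq0/(fluxP hu).
Qed.

Lemma relations2 a : relations d F 2 n.+3%:Z a <-> exists2 u, rel2 d F n u & a = form2_of u.
Proof.
have e1 : n.+3%:Z - d%:Z - 2 = n.+1%:Z - d%:Z by lia.
have e2 : n.+3%:Z - d%:Z - 1 = n.+2%:Z - d%:Z by lia.
have e3 : 2 - 1 = 1 :> int by [].
have E (b c : vec K) : fscale F (form2_of b) + wedge (mdiff F) (form1_of c) =
    form2_of [ffun i => F * b i + cross (fun i => F^`M(i)) c i].
  rewrite mdiffE wedge11E fscale_form2; apply/ffunP => L.
  rewrite [LHS]ffunE ![form2_of _ L]ffunE -big_split.
  by apply: eq_bigr => i _; rewrite [in RHS]ffunE mulrDr.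
split=> [[b [c [/Omega2P [u hu ->]]]]|[u [b [c [hb hc ->]]] ->]].
  rewrite e3 => /Omega1P [p hp ->] ->.
  exists [ffun i => F * u i + cross (fun i => F^`M(i)) p i]; last by rewrite E.
  exists u, p; split=> // i; apply/homogz_shift.
    by have := hu i; rewrite e1.
  by have := hp i; rewrite e2.
exists (form2_of b), (form1_of c); split; last by rewrite E.
  by apply/Omega2P; exists b => // i; rewrite e1; apply/homogz_shift/hb.
by rewrite e3; apply/Omega1P; exists c => // i; rewrite e2; apply/homogz_shift/hc.
Qed.

Hypothesis partial_parallel : forall e (u : 'I_3 -> {mpoly K[3]}),
  (forall i, u i \is e.-homog) ->
  (forall i j, u i * F^`M(j) = u j * F^`M(i)) -> exists k, forall i, u i = k * F^`M(i).

Lemma ker_dim1 tau : free_quot (syz F n.+1) (koszul F n.+1) tau ->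
  ker_dim f d F 1 n.+3%:Z tau.
Proof.
move=> H; refine (free_quot_embedding (h := fun u : vec K => form1_of u)
  (submod_log1 F n) (submod_rel1 d F n) (@rel1_log1 _ _ _ hd hF F0 n) _ _ pullback_ker1 relations1 _).
- move=> a u v; apply/ffunP => L; rewrite !ffunE scaler_sumr -big_split.
  by apply: eq_bigr => i _; rewrite !ffunE.
- by move=> u v /form1_inj e; apply/ffunP.
- exact: log1_dim.
Qed.

Lemma ker_dim2 tau :
  free_quot (fun p : {mpoly K[3]} => p \is n.-homog)
            (fun p => p \is n.-homog /\ jacobian_ideal F p) tau ->
  free_quot (syz F n.+1) (koszul F n.+1) tau ->
  ker_dim f d F 2 n.+3%:Z (2 * tau).
Proof.
move=> Hh Hs; refine (free_quot_embedding (h := fun u : vec K => form2_of u)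
  (submod_log2 F n) (submod_rel2 d F n) _ _ _ pullback_ker2 relations2 _).
- move=> u /(rel2_mid2 hd hF F0) [hu [p [_ _ E]]]; split=> //.
  by exists (d%:R%:MP * p).
- move=> a u v; apply/ffunP => L; rewrite !ffunE scaler_sumr -big_split.
  by apply: eq_bigr => i _; rewrite !ffunE mulrDr scalerAr.
- by move=> u v /form2_inj e; apply/ffunP.
- exact: log2_dim.
Qed.

End FormsOfCurve.

Theorem pullback_kernels (K : numClosedFieldType) (d : nat) (f : 3.-tuple {mpoly K[2]})
    (F : {mpoly K[3]}) (tau : nat)
    (hd : (3 <= d)%N)
    (hf : forall i : 'I_3, tnth f i \is d.-homog)
    (hgcd : gcd_is_1 f)
    (hgen : generically_1to1 f)
    (hF : reduced_equation f d F)
    (htau : global_tjurina F tau) :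
  [/\ (forall q : nat, (0 < q)%N -> ker_zero f d F 0 q%:Z),
      (forall q : nat, (0 < q)%N -> (2 * d - 2 <= q)%N ->
         ker_dim f d F 1 q%:Z tau),
      (forall q : nat, (0 < q)%N -> (2 * d <= q)%N ->
         ker_dim f d F 2 q%:Z (2 * tau)%N) &
      (free_curve F -> forall q : nat, (0 < q)%N -> (2 * d - 2 <= q)%N ->
         ker_dim f d F 2 q%:Z (2 * tau)%N)].
Proof.
have [Fh Fsq Fim] := hF; have hd2 : (1 < d)%N by apply: ltnW.
(* The square of 0 divides 0, but 0 is not a unit. *)
have F0 : F != 0.
  apply/eqP => F0; have : (0 : {mpoly K[3]}) \is a GRing.unit.
    by apply: Fsq; rewrite F0; exists 0; rewrite mul0r.
  by rewrite unitr0.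
(* The zero locus of F is the image, so the pull-back of F has no nonzero value;
   an algebraically closed field is infinite. *)
have Ff : F \mPo f = 0.
  apply: (hat_inj (comp_homog hf Fh)); apply/eqP/negPn/negP => /closed_nonrootP [u /negP []].
  rewrite rootE horner_hat comp_mpoly_meval; apply/eqP.
  have p0 : param f (pt u) != 0.
    apply/eqP => /rowP p0; have [k] := no_base_point hd2 hf hgcd u.
    by rewrite -param_pt p0 mxE eqxx.
  have u0 : pt u != 0.
    by apply/eqP => /rowP/(_ j1); rewrite !mxE /= => /eqP; rewrite oner_eq0.
  have [_] := Fim _ p0; rewrite (meval_eq (v2 := fun i => (tnth f i).@[fun j => if j == j0 then u else 1])).
    by apply; exists (pt u); split=> //; exists 1; rewrite ?oner_eq0 // scale1r.
  by move=> i; rewrite mxE; apply: meval_eq => j; rewrite mxE.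
have [al [be [x [x_inj gd gx f1x y_inj]]]] := good_line_exists hd2 hf hgcd hgen.
have sF := size_rhoF hd2 hf Fh F0 Ff gd gx f1x y_inj.
have cF := rhoF_separable hd2 hf Fh F0 Ff gd gx f1x y_inj.
have par := koszul_parallel hd2 Fh sF cF.
have pnz := partial_nonzero hd2 hf Fh F0 Ff gd gx f1x y_inj.
have lift := syzygy_lift hd2 hf Fh F0 Ff x_inj gd gx f1x y_inj.
have hilb := jacobian_hilbert hd2 Fh sF cF lift htau.
have tang := tangent_log hd hf Fh F0 Ff x_inj gd gx f1x y_inj.
have flx := flux_log hd hf Fh F0 Ff x_inj gd gx f1x y_inj.
have homology n : (2 * d - 4 <= n)%N -> free_quot (syz F n) (koszul F n) tau.
  exact: (@koszul_homology_dim _ _ _ hd Fh par pnz tau hilb n).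
split.
- move=> q _; apply: ker_zero_form0 => // e p hp pf.
  apply/(pull_multiple hd hf Fh F0 Ff gd gx f1x y_inj hp).
  by apply/(pull_eq0 hf hp).
- move=> q _ hq; have [n en] : exists n, q = n.+3 by exists (q - 3)%N; move: hd hq; lia.
  rewrite en in hq *.
  apply: ker_dim1 => //; apply: homology; move: hq; lia.
- move=> q _ hq; have [n en] : exists n, q = n.+3 by exists (q - 3)%N; move: hd hq; lia.
  rewrite en in hq *; apply: ker_dim2 => //; first by apply: hilb; move: hd hq; lia.
  apply: homology; move: hq; lia.
- move=> free q _ hq; have [n en] : exists n, q = n.+3 by exists (q - 3)%N; move: hd hq; lia.
  rewrite en in hq *; apply: ker_dim2 => //; last by apply: homology; move: hq; lia.
  apply: (free_hilbert hd Fh par pnz free htau); last by move: hd hq; lia.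
  exact: no_constant_syzygy hd2 hf Fh F0 Ff gd gx f1x y_inj.
Qed.

Theorem theorem4p2 (R : realType) (d : nat) (f : 3.-tuple {mpoly R[i][2]})
    (F : {mpoly R[i][3]}) (tau : nat)
    (hd : (3 <= d)%N)
    (hf : forall i : 'I_3, tnth f i \is d.-homog)
    (hgcd : gcd_is_1 f)
    (hgen : generically_1to1 f)
    (hF : reduced_equation f d F)
    (htau : global_tjurina F tau) :
  [/\ (forall q : nat, (0 < q)%N -> ker_zero f d F 0 q%:Z),
      (forall q : nat, (0 < q)%N -> (2 * d - 2 <= q)%N ->
         ker_dim f d F 1 q%:Z tau),
      (forall q : nat, (0 < q)%N -> (2 * d <= q)%N ->
         ker_dim f d F 2 q%:Z (2 * tau)%N) &
      (free_curve F -> forall q : nat, (0 < q)%N -> (2 * d - 2 <= q)%N ->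
         ker_dim f d F 2 q%:Z (2 * tau)%N)].
Proof. exact: (pullback_kernels hd hf hgcd hgen hF htau). Qed.
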